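(* Let $X$ be a CAT(0) cube complex, endowed with the piecewise $\ell^p$ metric $d$ for some $p\in(1,\infty)$, and let $x,y\in X$. Let $\gamma$ be a piecewise affine path from $x$ to $y$ in $X$ with break points $x_0=x,x_1,\dots,x_{k+1}=y$. For each $i$, let $C_i$ denote the minimal cube containing $\{x_i,x_{i+1}\}$. Then $\gamma$ is a local $\ell^p$-geodesic if and only if for every $i\in\{1,\dots,k\}$ the following two conditions hold. (Zero-tension condition) $$\frac{(x_{i-1}-x_i)_{C_{i-1}\cap C_i}}{d(x_{i-1},x_i)}+\frac{(x_{i+1}-x_i)_{C_{i-1}\cap C_i}}{d(x_{i+1},x_i)}=0.$$ (No-shortcut condition) For any decompositions $C_{i-1}=A_1\times A_2$ and $C_i=B_1\times B_2$ such that $B_1\times A_2$ belongs to $X$, one has $$\frac{\|x_{i-1}-x_i\|_{A_1}}{\|x_{i+1}-x_i\|_{B_1}}\ \ge\ \frac{\|x_{i-1}-x_i\|_{A_2}}{\|x_{i+1}-x_i\|_{B_2}}.$$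
   Context: CAT(0) cube complexes are not assumed finite-dimensional (each cube is finite-dimensional). The piecewise $\ell^p$ metric is the length metric obtained by giving each cube $[0,1]^n$ the $\ell^p$ metric. A piecewise affine path with break points $x_0,\dots,x_{k+1}$ is a concatenation of nondegenerate affine segments $[x_i,x_{i+1}]$, each contained in a cube. A local $\ell^p$-geodesic is a path which, parametrised with constant speed, is locally a geodesic for $d$. Notation: for points $a,b$ of a cube $C=[0,1]^n$ and a factor (or face) $A$ of $C$, $(a-b)_A$ is the vector difference of the orthogonal projections of $a$ and $b$ to $A$, and $\|a-b\|_A$ is its $\ell^p$ norm. A decomposition $C=A_1\times A_2$ of a cube is a product decomposition obtained by partitioning the set of coordinates; one of the factors may be trivial (a point). Fixing a vertex $v$ of $C_{i-1}\cap C_i$, factors of $C_{i-1}$ and of $C_i$ are identified with the corresponding faces containing $v$; ''$B_1\times A_2$ belongs to $X$'' means that $B_1\cap A_2=\{v\}$ and that some cube of $X$ containing $v$ is the product of its faces $B_1$ and $A_2$. An inequality $\frac ab\ge\frac cd$ between ratios of nonnegative numbers is read as $ad\ge bc$ when denominators vanish. *)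

(* Defs.v *)
(* MathComp / MathComp-Analysis *)
From HB Require Import structures.
From mathcomp Require Import all_boot all_order all_algebra.
From mathcomp Require Import boolp classical_sets reals exp.

Set Implicit Arguments.
Unset Strict Implicit.
Unset Printing Implicit Defensive.

Import Order.TTheory GRing.Theory Num.Theory.

Local Open Scope classical_set_scope.
Local Open Scope ring_scope.

Section Cube.
Context {R : realType}.

Definition unit_cube n : set 'rV[R]_n := [set u | forall j, 0 <= u 0 j <= 1].

Definition cube_vertex n (w : 'rV[R]_n) : Prop :=
  forall j, w 0 j = 0 \/ w 0 j = 1.

(* For a vertex w, these are exactly the faces of the cube that contain w:
   J is the set of coordinates that vary. *)
Definition cube_face n (w : 'rV[R]_n) (J : {set 'I_n}) : set 'rV[R]_n :=
  [set u | unit_cube u /\ forall j, j \notin J -> u 0 j = w 0 j].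

Definition lp_norm (p : R) n (J : {set 'I_n}) (u : 'rV[R]_n) : R :=
  (\sum_(j in J) `|u 0 j| `^ p) `^ p^-1.

End Cube.

(* The cubes of the complex are the images of the unit cubes [0,1]^n, where
   n = cell_dim c, under the maps [chart c]; the values of [chart c] outside the
   unit cube are irrelevant. Two cubes are disjoint or meet in a common face,
   along an isometry of faces: such an isometry is given by a pair of vertices
   w, w' that correspond to each other and a matching f l <-> g l of the k
   varying coordinates, the coordinates being measured from w and w'. There is
   no bound on the dimensions, and no finiteness assumption. *)
Record cube_complex (R : realType) := CubeComplex {
  points : Type;
  cell : Type;
  cell_dim : cell -> nat;
  chart : forall c : cell, 'rV[R]_(cell_dim c) -> points;
  chart_cover : forall x, exists c, exists2 u, unit_cube u & @chart c u = x;
  chart_inj : forall c (u u' : 'rV[R]_(cell_dim c)),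
    unit_cube u -> unit_cube u' -> chart u = chart u' -> u = u';
  cell_face : forall c (w : 'rV[R]_(cell_dim c)) (J : {set 'I_(cell_dim c)}),
    cube_vertex w ->
    exists c', @chart c' @` @unit_cube R (cell_dim c') = @chart c @` cube_face w J;
  cell_meet : forall c c' : cell,
    (@chart c @` @unit_cube R (cell_dim c)) `&` (@chart c' @` @unit_cube R (cell_dim c'))
      !=set0 ->
    exists (w : 'rV[R]_(cell_dim c)) (w' : 'rV[R]_(cell_dim c')) (k : nat)
           (f : 'I_k -> 'I_(cell_dim c)) (g : 'I_k -> 'I_(cell_dim c')),
      [/\ cube_vertex w, cube_vertex w', injective f, injective g &
        forall u u', unit_cube u -> unit_cube u' ->
          (chart u = chart u' <->
           [/\ cube_face w [set f l | l in 'I_k] u,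
               cube_face w' [set g l | l in 'I_k] u' &
               forall l, `|u 0 (f l) - w 0 (f l)| =
                         `|u' 0 (g l) - w' 0 (g l)|])]
}.

Arguments points {R} X : rename.
Arguments cell {R} X : rename.
Arguments cell_dim {R X} c : rename.
Arguments chart {R X} c u : rename.

Section CubeComplexTheory.
Context {R : realType} {X : cube_complex R}.
Implicit Types (c : cell X) (x y v : points X) (p : R).

Definition carrier c : set (points X) := chart c @` @unit_cube R (cell_dim c).

(* Only meaningful when [carrier c x]. *)
Definition coords c x : 'rV[R]_(cell_dim c) :=
  xget 0 [set u | unit_cube u /\ chart c u = x].

Definition vertex_of c v : Prop :=
  exists2 w : 'rV[R]_(cell_dim c), cube_vertex w & chart c w = v.

(* For a vertex v of c: the face of c containing v in the directions J. *)
Definition face_at c v (J : {set 'I_(cell_dim c)}) : set (points X) :=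
  chart c @` cube_face (coords c v) J.

(* Lengths of the strings x = y_0, ..., y_m = y in which two consecutive points
   lie in a common cube and are joined by a straight segment of that cube. *)
Inductive string_length p : points X -> points X -> R -> Prop :=
| string_nil x : string_length p x x 0
| string_cons c (u u' : 'rV[R]_(cell_dim c)) y l :
    unit_cube u -> unit_cube u' -> string_length p (chart c u') y l ->
    string_length p (chart c u) y (lp_norm p [set: 'I_(cell_dim c)] (u - u') + l).

End CubeComplexTheory.

(* The piecewise l^p length metric (meaningful when X is connected). *)
Definition lp_dist {R : realType} (X : cube_complex R) (p : R)
    (x y : points X) : R :=
  inf [set l | string_length p x y l].

Arguments lp_dist {R} X p x y.

Section MetricGeometry.
Context {R : realType} {T : Type} (d : T -> T -> R).

Definition is_metric : Prop :=
  [/\ forall x y, 0 <= d x y,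
      forall x y, d x y = 0 <-> x = y,
      forall x y, d x y = d y x &
      forall x y z, d x z <= d x y + d y z].

(* Geodesics are parametrised by [0,1] proportionally to arc length. *)
Definition geodesic (x y : T) (c : R -> T) : Prop :=
  [/\ c 0 = x, c 1 = y &
      forall s t : R, 0 <= s <= 1 -> 0 <= t <= 1 ->
        d (c s) (c t) = `|s - t| * d x y].

Definition euclid_dist n (a b : 'rV[R]_n) : R :=
  lp_norm 2 [set: 'I_n] (a - b).

(* Comparison of points on two sides of a geodesic triangle with vertices
   x, y, z; by relabelling the vertices, the two sides issued from x are any two
   sides of the triangle. *)
Definition CAT0_space : Prop :=
  [/\ is_metric,
      forall x y, exists c, geodesic x y c &
      forall x y z (c c' : R -> T), geodesic x y c -> geodesic x z c' ->
      forall xb yb zb : 'rV[R]_2,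
        euclid_dist xb yb = d x y -> euclid_dist xb zb = d x z ->
        euclid_dist yb zb = d y z ->
      forall s t : R, 0 <= s <= 1 -> 0 <= t <= 1 ->
        d (c s) (c' t) <= euclid_dist ((1 - s) *: xb + s *: yb)
                                      ((1 - t) *: xb + t *: zb)].

Definition local_geodesic (gamma : R -> T) : Prop :=
  exists speed : R, forall t, 0 <= t <= 1 ->
  exists2 e, 0 < e & forall s s' : R, 0 <= s <= 1 -> 0 <= s' <= 1 ->
    `|s - t| < e -> `|s' - t| < e ->
    d (gamma s) (gamma s') = speed * `|s - s'|.

End MetricGeometry.

Definition CAT0_cube_complex {R : realType} (X : cube_complex R) : Prop :=
  (forall x y : points X, exists l, string_length 2 x y l) /\
  CAT0_space (lp_dist X 2).

Section PiecewiseAffine.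
Context {R : realType} {X : cube_complex R}.
Implicit Types (c : cell X) (x y v : points X) (p : R).

(* gamma : [0,1] -> X runs at constant speed along the affine segments
   [b i, b i.+1], i <= k, which it traverses on [tau i, tau i.+1]. *)
Definition piecewise_affine_path p k x y (b : nat -> points X)
    (gamma : R -> points X) : Prop :=
  [/\ b 0%N = x, b k.+1 = y &
      exists (tau : nat -> R) (speed : R),
        [/\ tau 0%N = 0, tau k.+1 = 1 &
            forall i, (i <= k)%N ->
              [/\ tau i < tau i.+1, b i <> b i.+1 &
                exists c,
                  [/\ carrier c (b i), carrier c (b i.+1),
                    lp_norm p [set: 'I_(cell_dim c)]
                      (coords c (b i.+1) - coords c (b i)) =
                      speed * (tau i.+1 - tau i) &
                    forall s : R, 0 <= s <= 1 ->
                      gamma ((1 - s) * tau i + s * tau i.+1) =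
                      chart c ((1 - s) *: coords c (b i) +
                               s *: coords c (b i.+1))]]]].

Definition minimal_cube c x y : Prop :=
  [/\ carrier c x, carrier c y &
      forall c', carrier c' x -> carrier c' y -> carrier c `<=` carrier c'].

(* For a face f of c: the coordinates in f of the orthogonal projection to f of
   the point a of c, i.e. of the point of f closest to a for the Euclidean
   metric of c. *)
Definition proj c (f : cell X) (a : points X) : 'rV[R]_(cell_dim f) :=
  xget 0 [set q | unit_cube q /\ forall r, unit_cube r ->
    euclid_dist (coords c a) (coords c (chart f q)) <=
    euclid_dist (coords c a) (coords c (chart f r))].

(* The path goes from x to m in the cube C, then from m to y in the cube C'.
   The cell D exists because a nonempty intersection of two cells is a face of
   both; the equation does not depend on its choice. *)
Definition zero_tension p (C C' : cell X) x m y : Prop :=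
  exists2 D : cell X, carrier D = carrier C `&` carrier C' &
    (lp_dist X p x m)^-1 *: (proj C D x - proj C D m) +
    (lp_dist X p y m)^-1 *: (proj C' D y - proj C' D m) = 0.

(* At the vertex v, B stands for a face of C' and A for a face of C. *)
Definition product_belongs v (C' : cell X) (B : {set 'I_(cell_dim C')})
    (C : cell X) (A : {set 'I_(cell_dim C)}) : Prop :=
  face_at v B `&` face_at v A = [set v] /\
  exists2 E : cell X, carrier E v &
    exists K : {set 'I_(cell_dim E)},
      face_at v K = face_at v B /\ face_at v (~: K) = face_at v A.

(* a / b >= c / d for nonnegative a, b, c, d *)
Definition ratio_ge (a b c d : R) : Prop :=
  if (b == 0) || (d == 0) then b * c <= a * d else c / d <= a / b.

Definition dist_along p c (J : {set 'I_(cell_dim c)}) (a b : points X) : R :=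
  lp_norm p J (coords c a - coords c b).

Definition no_shortcut p (C C' : cell X) v x m y : Prop :=
  forall (A1 A2 : {set 'I_(cell_dim C)}) (B1 B2 : {set 'I_(cell_dim C')}),
    A2 = ~: A1 -> B2 = ~: B1 -> product_belongs v B1 A2 ->
    ratio_ge (dist_along p A1 x m) (dist_along p B1 y m)
             (dist_along p A2 x m) (dist_along p B2 y m).

End PiecewiseAffine.

(* Main.v *)
(* Project to a geodesic edge [v, n] of the CAT(0) complex and read the projection
   as a number in [0, 1]. This function restricts to every cell either as one of
   the coordinates, possibly reversed, or as a constant: it is the coordinate
   transverse to the hyperplane dual to [v, n], and edges at v give distinct
   coordinates. A linear combination of such functions with dual norm at most 1
   on every cell near a point is locally 1-Lipschitz for the l^p metric and thus
   bounds distances from below; in particular cells embed isometrically.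

   If both conditions hold at a break point, combine the coordinates of the edges
   at v with the slopes of the functionals that norm the two directions. By zero
   tension the slopes agree on the common coordinates, so the combination grows at
   unit speed along the path; the no-shortcut condition says that its dual norm is
   at most 1 on every cell at the break point.

   Conversely, if zero tension fails, moving the break point in the common face
   shortens the path. If B1 x A2 violates the no-shortcut condition, then by the
   flag property of the link of v the common directions, A2 and B1 span one cell,
   and crossing this cell shortens the path. *)
From HB Require Import structures.
Require Import Defs.
From mathcomp Require Import all_boot all_order all_algebra.
From mathcomp Require Import ring lra.
From mathcomp Require Import boolp classical_sets reals exp topology normedtype derive.
Import Order.TTheory GRing.Theory Num.Theory numFieldNormedType.Exports.

Set Implicit Arguments.
Unset Strict Implicit.
Unset Printing Implicit Defensive.

Local Open Scope classical_set_scope.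
Local Open Scope ring_scope.

(** * Powers and finite sums *)

(** A point may lie in infinitely many cells of unbounded dimension; the local arguments work
    because its interior coordinates are the same in all of them, so that one cell determines a
    radius for the whole star. The projection to an edge is easy to compute only near that edge. It
    is constant on the geodesic from the foot of a point to the point, and a coordinate of a star is
    affine along such a geodesic, by the zero-tension lemma with exponent 2. If the two agree on an
    initial piece they agree further on, and real induction carries the agreement to the point
    itself. The same lemma with exponent p gives the necessity of zero tension. Distinct edges at v
    give distinct coordinates because the relation between two edges, that the projection to one is
    a coordinate in the direction of the other, is symmetric. *)

Section RealLemmas.
Context {R : realType}.
Implicit Types a b e m p q s t x y : R.

Lemma powRK p a : 0 < p -> 0 <= a -> (a `^ p) `^ p^-1 = a.
Proof. by move=> p0 a0; rewrite -powRrM mulfV ?gt_eqF// powRr1. Qed.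

Lemma powRVK p a : 0 < p -> 0 <= a -> (a `^ p^-1) `^ p = a.
Proof. by move=> p0 a0; rewrite -powRrM mulVf ?gt_eqF// powRr1. Qed.

Lemma ler_powR2 p a b : 0 <= p -> 0 <= a -> a <= b -> a `^ p <= b `^ p.
Proof.
by move=> p0 a0 ab; apply: ge0_ler_powR => //; rewrite nnegrE// (le_trans a0).
Qed.

Lemma ltr_powR2 p a b : 0 < p -> 0 <= a -> a < b -> a `^ p < b `^ p.
Proof.
move=> p0 a0 ab; apply: gt0_ltr_powR => //; rewrite nnegrE//.
by rewrite (le_trans a0)// ltW.
Qed.

Lemma ler_powR2E p a b : 0 < p -> 0 <= a -> 0 <= b ->
  (a `^ p <= b `^ p) = (a <= b).
Proof.
move=> p0 a0 b0; apply/idP/idP; last by apply: ler_powR2 => //; exact: ltW.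
by case: (leP a b) => // ba; rewrite leNgt ltr_powR2.
Qed.

Lemma conjugate_exponent p : 1 < p -> p^-1 + (p / (p - 1))^-1 = 1.
Proof.
move=> p1; rewrite invf_div -[X in X + _]mul1r -mulrDl addrC subrK divff// gt_eqF//.
exact: lt_trans ltr01 p1.
Qed.

(* The derivative of |a|^p / p. *)
Definition dual_pow p a : R := Num.sg a * `|a| `^ (p - 1).

Lemma dual_pow_mul p a : 0 < p -> dual_pow p a * a = `|a| `^ p.
Proof. by move=> p0; rewrite /dual_pow mulrAC -normrEsg mulr_powRB1. Qed.

Lemma dual_pow_norm p a : 1 < p -> `|dual_pow p a| `^ (p / (p - 1)) = `|a| `^ p.
Proof.
move=> p1; have q0 : 0 < p / (p - 1) by rewrite divr_gt0// ?subr_gt0//; lra.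
rewrite /dual_pow; have [->|a0] := eqVneq a 0.
  by rewrite sgr0 mul0r normr0 !powR0// gt_eqF//; lra.
rewrite normrM normr_sg a0 mul1r ger0_norm ?powR_ge0// -powRrM.
by rewrite mulrCA divff ?mulr1// gt_eqF// subr_gt0.
Qed.

(** Young's inequality for the factors t and 1 with the exponents p and p / (p - 1). *)
Lemma powR_bernoulli p t : 1 < p -> 0 <= t -> 1 + p * (t - 1) <= t `^ p.
Proof.
move=> p1 t0; have p0 : 0 < p by lra.
have q0 : 0 < p / (p - 1) by apply: divr_gt0; lra.
have := conjugate_powR t0 ler01 p0 q0 (conjugate_exponent p1); rewrite mulr1 powR1.
rewrite -(ler_pM2l p0) mulrDr mulrCA divff ?gt_eqF// mulr1.
by rewrite mul1r invf_div mulrCA divff ?gt_eqF//; lra.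
Qed.

(** The weak inequality at the square root [s] of t, once squared, gains the term p (p - 1) (s -
    1)^2. *)
Lemma powR_bernoulli_strict p t : 1 < p -> 0 <= t -> t != 1 ->
  1 + p * (t - 1) < t `^ p.
Proof.
move=> p1 t0 t1; have p0 : 0 < p by lra.
have s0 := sqrtr_ge0 t; set s := Num.sqrt t in s0.
have tE : t = s ^+ 2 by rewrite sqr_sqrtr.
have s1 : s != 1 by apply: contra t1 => /eqP s1; rewrite tE s1 expr1n.
have tp : t `^ p = (s `^ p) ^+ 2.
  by rewrite tE expr2 powRM// -expr2.
have B := powR_bernoulli p1 s0; have P := powR_ge0 s p.
rewrite tp tE.
(* A negative bound cannot be squared, but then the left side for t is negative as well. *)
have [neg|pos] := ltP (1 + p * (s - 1)) 0.
  apply: (@lt_le_trans _ _ 0); last exact: sqr_ge0.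
  have : p * (s - 1) * s <= 0.
    by rewrite mulr_le0_ge0//; nra.
  by nra.
apply: (@lt_le_trans _ _ ((1 + p * (s - 1)) ^+ 2)); last first.
  by rewrite lerXn2r// nnegrE.
have : 0 < (s - 1) ^+ 2 by rewrite exprn_even_gt0//= subr_eq0.
have : 0 < p * (p - 1) by apply: mulr_gt0; lra.
by move=> u v; have := mulr_gt0 u v; rewrite !expr2; lra.
Qed.

Lemma powR_tangent p a m : 1 < p -> 0 < m -> 0 <= a -> a != m ->
  m `^ p + p * m `^ p / m * (a - m) < a `^ p.
Proof.
move=> p1 m0 a0 am.
have n1 : a / m != 1.
  by apply: contra am => /eqP h; rewrite -(divfK (lt0r_neq0 m0) a) h mul1r.
have := powR_bernoulli_strict p1 (divr_ge0 a0 (ltW m0)) n1.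
have mp : 0 < m `^ p by rewrite powR_gt0.
rewrite -(ltr_pM2l mp) -powRM ?(ltW m0) ?divr_ge0 ?(ltW m0)//.
rewrite [X in _ < X `^ _]mulrC divfK ?gt_eqF//.
rewrite (_ : m `^ p * _ = m `^ p + p * m `^ p / m * (a - m))//.
by field; rewrite gt_eqF.
Qed.

(** If |a| = |b| then a = - b and the left side is 0. Otherwise the tangent at the mean [m] of |a|
    and |b| lies strictly below the graph at both points, and its two increments cancel. *)
Lemma powR_midpoint_lt p a b : 1 < p -> a != b ->
  `|(a + b) / 2| `^ p < (`|a| `^ p + `|b| `^ p) / 2.
Proof.
move=> p1 ab; have p0 : 0 < p by lra.
have [eab|nab] := eqVneq `|a| `|b|.
  have ba : a = - b.
    move/eqP: eab; rewrite eqr_norm2 (negPf ab)/= => /eqP//.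
  rewrite ba addNr mul0r normr0 powR0 ?gt_eqF// normrN.
  have b0 : 0 < `|b|.
    by rewrite normr_gt0; apply: contra ab; rewrite ba => /eqP->; rewrite oppr0.
  by have := powR_gt0 p b0; lra.
set m := (`|a| + `|b|) / 2.
have a0 := normr_ge0 a; have b0 := normr_ge0 b.
have m0 : 0 < m.
  rewrite lt_neqAle; apply/andP; split; last by rewrite /m; lra.
  apply/eqP => mE; case/eqP: nab; rewrite /m in mE; lra.
have le1 : `|(a + b) / 2| <= m.
  rewrite /m normrM [`|2^-1|]ger0_norm ?invr_ge0//.
  by have := ler_normD a b; lra.
apply: (@le_lt_trans _ _ (m `^ p)).
  by apply: ler_powR2 => //; exact: ltW.
have am : `|a| != m by apply/eqP => h; case/eqP: nab; rewrite /m in h; lra.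
have bm : `|b| != m by apply/eqP => h; case/eqP: nab; rewrite /m in h; lra.
have A := powR_tangent p1 m0 a0 am; have B := powR_tangent p1 m0 b0 bm.
set c := _ / m in A B.
have : c * (`|a| - m) + c * (`|b| - m) = 0.
  by rewrite -mulrDr /m; apply/eqP; rewrite mulf_eq0; apply/orP; right; apply/eqP; lra.
by move: A B; lra.
Qed.

Lemma powR_midpoint p a b : 1 < p ->
  `|(a + b) / 2| `^ p <= (`|a| `^ p + `|b| `^ p) / 2.
Proof.
move=> p1; have [->|ab] := eqVneq a b; last exact/ltW/powR_midpoint_lt.
have -> : (b + b) / 2 = b by lra.
by lra.
Qed.

Lemma powR_root_le p a : 1 < p -> 0 <= a -> a `^ p^-1 <= 1 + (a - 1) / p.
Proof.
move=> p1 a0; have p0 : 0 < p by lra.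
have := powR_bernoulli p1 (powR_ge0 a p^-1); rewrite powRVK//.
by rewrite -lerBlDl ler_pdivlMr//; nra.
Qed.

(** The product (1 - e)(1 + e) is at most 1, Bernoulli bounds the power of 1 + e from below, and 1 /
    (1 + z) is at most 1 - z + z^2 for z = p e. *)
Lemma powR_sub_le p e : 1 < p -> 0 <= e < 1 -> (1 - e) `^ p <= 1 - p * e + (p * e) ^+ 2.
Proof.
move=> p1 /andP[e0 e1].
have n0 : 0 <= 1 - e by lra.
have : ((1 - e) * (1 + e)) `^ p <= 1.
  apply: (@le_trans _ _ (1 `^ p)); last by rewrite powR1.
  apply: ler_powR2; first lra.
    by apply: mulr_ge0; lra.
  by have := mulr_ge0 e0 e0; lra.
rewrite powRM//; last lra.
have := @powR_bernoulli p (1 + e) p1 _; rewrite addrAC subrr add0r.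
move=> /(_ ltac:(lra)) B.
have P0 := powR_ge0 (1 - e) p; set P := (_ - _) `^ _ in P0 *.
move=> H; have H1 : P * (1 + p * e) <= 1 by apply: le_trans H; rewrite ler_wpM2l.
have pe : 0 <= p * e by apply: mulr_ge0 => //; lra.
set z := p * e in H1 pe *.
have : 1 <= (1 - z + z ^+ 2) * (1 + z).
  rewrite (_ : _ * _ = 1 + z ^+ 3); last by ring.
  by rewrite lerDl exprn_ge0.
move=> H2; have z1 : 0 < 1 + z by lra.
by rewrite -(ler_pM2r z1); apply: le_trans H1 H2.
Qed.

Lemma left_near s m : 0 < s -> 0 < m -> exists2 t, 0 <= t < s & s - t < m.
Proof.
move=> s0 m0; have k0 : 0 < Num.min s m / 2 by rewrite divr_gt0// lt_min s0.
have [k1 k2] : Num.min s m <= s /\ Num.min s m <= m by rewrite !ge_min !lexx !orbT.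
by exists (s - Num.min s m / 2); lra.
Qed.

(** Real induction, the form in which all open-and-closed arguments below are made: consider the
    supremum of the s such that Q holds on the whole of [a, s]. *)
Lemma interval_ind a b (Q : R -> Prop) : a <= b -> Q a ->
  (forall s, a <= s < b -> (forall t, a <= t <= s -> Q t) ->
     exists2 e, 0 < e & forall t, s <= t -> t < s + e -> t <= b -> Q t) ->
  (forall s, a < s <= b -> (forall t, a <= t < s -> Q t) -> Q s) ->
  forall s, a <= s <= b -> Q s.
Proof.
move=> ab Qa Qr Ql.
pose E := [set s | a <= s <= b /\ forall t, a <= t <= s -> Q t].
have Ea : E a.
  by split; [rewrite lexx|move=> t ta; rewrite (_ : t = a)//; apply/eqP; rewrite eq_sym eq_le].
have supE : has_sup E by split; [exists a|exists b => s [/andP[]]].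
set m := sup E.
have am : a <= m by apply: ub_le_sup => //; case: supE.
have mb : m <= b by apply: ge_sup; [exists a|move=> s [/andP[]]].
have below t : a <= t < m -> Q t.
  move=> /andP[at_ tm].
  have [s [/andP[_ _] sQ]] := sup_adherent (ltac:(lra) : 0 < m - t) supE.
  by rewrite -/m => ?; apply: sQ; rewrite at_/=; lra.
have Qm : Q m.
  by have [<-//|ne] := eqVneq a m; apply: Ql => //; rewrite mb lt_neqAle ne am.
have Em t : a <= t <= m -> Q t.
  move=> /andP[at_]; rewrite le_eqVlt => /predU1P[->//|tm].
  by apply: below; rewrite at_.
suff mbE : m = b by move=> s; rewrite -mbE; exact: Em.
apply/eqP; rewrite eq_le mb/= leNgt; apply/negP => mltb.
have [|e e0 He] := Qr m _ Em; first by rewrite am.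
pose s := Num.min b (m + e / 2).
have ms : m < s by rewrite /s lt_min mltb/=; lra.
suff : s <= m by rewrite leNgt ms.
apply: ub_le_sup; first by case: supE.
split; first by rewrite (le_trans am (ltW ms))/= /s ge_min lexx.
move=> t /andP[at_ ts]; have [tm|mt] := leP t m; first by apply: Em; rewrite at_.
move: ts; rewrite /s le_min => /andP[tb te]; apply: He => //; [exact: ltW|lra].
Qed.

End RealLemmas.

Section FiniteSums.
Context {R : realType}.
Implicit Types (p q : R).

Lemma sum_le_inj (I J : finType) (P : pred I) (Q : pred J) (phi : I -> J)
    (F : I -> R) (G : J -> R) :
  (forall i, P i -> Q (phi i)) -> {in P &, injective phi} ->
  (forall j, Q j -> 0 <= G j) -> (forall i, P i -> F i <= G (phi i)) ->
  \sum_(i | P i) F i <= \sum_(j | Q j) G j.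
Proof.
move=> PQ inj G0 FG; apply: (@le_trans _ _ (\sum_(i | P i) G (phi i))).
  exact: ler_sum.
rewrite (partition_big phi Q)//; apply: ler_sum => j Qj.
have [[i /andP[Pi /eqP ij]]|none] := pselect (exists i, P i && (phi i == j)).
  rewrite (bigD1 i) ?Pi ?ij ?eqxx//= big1 ?addr0// => i' /andP[/andP[Pi' /eqP i'j] ne].
  by case/eqP: ne; apply: inj => //; rewrite i'j.
by rewrite big_pred0 ?G0// => i; apply/negP => h; apply: none; exists i.
Qed.

Lemma psum_ge0 p (I : finType) (P : pred I) (F : I -> R) :
  0 <= \sum_(i | P i) `|F i| `^ p.
Proof. by apply: sumr_ge0 => i _; exact: powR_ge0. Qed.

Lemma psum_normalize p (I : finType) (P : pred I) (F : I -> R) N : 0 < N ->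
  N `^ p = \sum_(i | P i) `|F i| `^ p -> \sum_(i | P i) `|F i / N| `^ p = 1.
Proof.
move=> N0 NS; have N0' := ltW N0.
under eq_bigr => i _ do rewrite normrM normfV powRM ?invr_ge0// (ger0_norm N0').
by rewrite -mulr_suml -NS -powRM ?invr_ge0// mulfV ?powR1// gt_eqF.
Qed.

(** Hölder's inequality for a functional of dual norm at most 1: divide F by its norm and apply
    Young's inequality to each term. *)
Lemma holder_le p q (I : finType) (P : pred I) (G F : I -> R) :
  1 < p -> p^-1 + q^-1 = 1 -> \sum_(i | P i) `|G i| `^ q <= 1 ->
  \sum_(i | P i) G i * F i <= (\sum_(i | P i) `|F i| `^ p) `^ p^-1.
Proof.
move=> p1 pq G1; have p0 : 0 < p by lra.
have q0 : 0 < q.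
  rewrite -invr_gt0 (_ : q^-1 = 1 - p^-1); last by lra.
  by rewrite subr_gt0 invf_lt1.
have S0 := psum_ge0 p P F; set S := \sum_(i | P i) `|F i| `^ p in S0 *.
set N := S `^ p^-1; have NS : N `^ p = S by rewrite powRVK.
have [N0|Npos] := eqVneq N 0.
  rewrite N0 big1// => i Pi.
  suff : `|F i| `^ p = 0.
    by move/powR_eq0_eq0/eqP; rewrite normr_eq0 => /eqP->; rewrite mulr0.
  apply/eqP; rewrite eq_le powR_ge0 andbT.
  have -> : 0 = S by rewrite -NS N0 powR0// gt_eqF.
  rewrite /S (bigD1 i)//= lerDl; exact: psum_ge0.
have Ngt : 0 < N by rewrite lt_neqAle eq_sym Npos powR_ge0.
rewrite -[leRHS]mul1r -ler_pdivrMr// mulr_suml.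
apply: (@le_trans _ _ (\sum_(i | P i) (`|F i / N| `^ p / p + `|G i| `^ q / q))).
  apply: ler_sum => i Pi; rewrite -mulrA mulrC.
  apply: le_trans (ler_norm _) _; rewrite normrM.
  exact: conjugate_powR.
rewrite big_split/= -!mulr_suml.
rewrite (psum_normalize Ngt NS).
rewrite mul1r -[leRHS]pq lerD2l ler_piMl// invr_ge0; exact: ltW.
Qed.

(** The functional with slopes [dual_pow] of the normalised sum has dual norm 1 and attains the norm
    of F + G; Hölder bounds its values on F and on G. *)
Lemma minkowski_le p (I : finType) (P : pred I) (F G : I -> R) : 1 < p ->
  (\sum_(i | P i) `|F i + G i| `^ p) `^ p^-1 <=
  (\sum_(i | P i) `|F i| `^ p) `^ p^-1 + (\sum_(i | P i) `|G i| `^ p) `^ p^-1.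
Proof.
move=> p1; have p0 : 0 < p by lra.
set S := \sum_(i | P i) _; set N := S `^ p^-1.
have NS : N `^ p = S by rewrite powRVK// psum_ge0.
have [N0|Npos] := eqVneq N 0.
  by rewrite N0 addr_ge0// powR_ge0.
have Ngt : 0 < N by rewrite lt_neqAle eq_sym Npos powR_ge0.
pose H i := (F i + G i) / N.
have H1 : \sum_(i | P i) `|H i| `^ p = 1 by exact: psum_normalize.
have W1 : \sum_(i | P i) `|dual_pow p (H i)| `^ (p / (p - 1)) <= 1.
  by under eq_bigr => i _ do rewrite dual_pow_norm//; rewrite H1.
have NE : N = \sum_(i | P i) dual_pow p (H i) * F i + \sum_(i | P i) dual_pow p (H i) * G i.
  rewrite -big_split/= -[LHS]mulr1 -H1 mulr_sumr; apply: eq_bigr => i _.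
  by rewrite -dual_pow_mul// -mulrDr mulrCA [N * _]mulrC divfK.
by rewrite NE; apply: lerD; exact: holder_le p1 (conjugate_exponent p1) W1.
Qed.

End FiniteSums.

(** * Coordinates on cells and their intersections *)

Section CubeCoordinates.
Context {R : realType}.
Implicit Types (a b : bool) (t s : R).

(** The two isometries of [0, 1]. They record from which end a coordinate is read, and compose by
    exclusive or. *)
Definition flip b t : R := if b then 1 - t else t.

Lemma flipK b : involutive (flip b).
Proof. by move=> t; rewrite /flip; case: b => //; rewrite subKr. Qed.

Lemma flip_inj b : injective (flip b).
Proof. exact: inv_inj (flipK b). Qed.

Lemma flip_flip a b t : flip a (flip b t) = flip (a (+) b) t.
Proof. by rewrite /flip; case: a; case: b => //=; rewrite subKr. Qed.

Lemma flip01 b t : (0 <= flip b t <= 1) = (0 <= t <= 1).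
Proof. by rewrite /flip; case: b => //; rewrite subr_ge0 gerBl andbC. Qed.

Lemma flip_int b t : (0 < flip b t < 1) = (0 < t < 1).
Proof. by rewrite /flip; case: b => //; rewrite subr_gt0 gtrBl andbC. Qed.

Lemma flipB b t s : `|flip b t - flip b s| = `|t - s|.
Proof.
by rewrite /flip; case: b => //; rewrite distrC; congr `|_|; ring.
Qed.

Lemma flip_conv b t s r : flip b ((1 - r) * t + r * s) = (1 - r) * flip b t + r * flip b s.
Proof. by rewrite /flip; case: b => //; ring. Qed.

Lemma flip_eqb a b t : flip a t = flip b t -> t != 2^-1 -> a = b.
Proof.
by rewrite /flip; case: a; case: b => // e /eqP[]; lra.
Qed.

Lemma norm_sub_vertex t (w : R) : w = 0 \/ w = 1 -> 0 <= t <= 1 ->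
  `|t - w| = flip (w == 1) t.
Proof.
move=> [->|->] /andP[t0 t1]; rewrite /flip.
  by rewrite eq_sym oner_eq0 subr0 ger0_norm.
by rewrite eqxx distrC ger0_norm// subr_ge0.
Qed.

Definition upd n (u : 'rV[R]_n) i t : 'rV[R]_n :=
  \row_j if j == i then t else u 0 j.

Lemma updE n (u : 'rV[R]_n) i t j : upd u i t 0 j = if j == i then t else u 0 j.
Proof. by rewrite mxE. Qed.

Lemma upd_id n (u : 'rV[R]_n) i : upd u i (u 0 i) = u.
Proof. by apply/rowP => j; rewrite updE; case: eqP => [->|]. Qed.

Lemma unit_cube_upd n (u : 'rV[R]_n) i t :
  unit_cube u -> 0 <= t <= 1 -> unit_cube (upd u i t).
Proof. by move=> uu tt j; rewrite updE; case: eqP. Qed.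

Lemma unit_cube_conv n (u v : 'rV[R]_n) s : unit_cube u -> unit_cube v ->
  0 <= s <= 1 -> unit_cube ((1 - s) *: u + s *: v).
Proof.
move=> uu uv /andP[s0 s1] j; rewrite !mxE.
have /andP[a0 a1] := uu j; have /andP[b0 b1] := uv j.
have s1' : 0 <= 1 - s by rewrite subr_ge0.
apply/andP; split; first by rewrite addr_ge0// mulr_ge0.
have := ler_wpM2l s1' a1; have := ler_wpM2l s0 b1; lra.
Qed.

Lemma cube_vertex_unit n (w : 'rV[R]_n) : cube_vertex w -> unit_cube w.
Proof. by move=> vw j; case: (vw j) => ->; rewrite ?lexx ?ler01. Qed.

End CubeCoordinates.

Section Cells.
Context {R : realType} {X : cube_complex R}.
Implicit Types (c E : cell X) (x y z : points X) (p s t e : R).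

Lemma carrier_coords c x : carrier c x ->
  unit_cube (coords c x) /\ chart c (coords c x) = x.
Proof.
move=> [u uu ux]; rewrite /coords.
exact: (@xgetPex _ 0 [set u | unit_cube u /\ chart c u = x] (ex_intro _ u (conj uu ux))).
Qed.

Lemma coords_unit c x : carrier c x -> unit_cube (coords c x).
Proof. by move/carrier_coords => []. Qed.

Lemma chart_coords c x : carrier c x -> chart c (coords c x) = x.
Proof. by move/carrier_coords => []. Qed.

Lemma carrier_chart c u : unit_cube u -> carrier c (chart c u).
Proof. by move=> uu; exists u. Qed.

Lemma coords_chart c u : unit_cube u -> coords c (chart c u) = u.
Proof.
move=> uu; have [vu vE] := carrier_coords (carrier_chart uu).
exact: chart_inj vE.
Qed.

Lemma coords_inj c x y : carrier c x -> carrier c y -> coords c x = coords c y -> x = y.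
Proof. by move=> /chart_coords + /chart_coords => {2}<- {2}<- ->. Qed.

(* The data provided by [cell_meet]. *)
Definition meeting c c' (w : 'rV[R]_(cell_dim c)) (w' : 'rV[R]_(cell_dim c')) (k : nat)
    (f : 'I_k -> 'I_(cell_dim c)) (g : 'I_k -> 'I_(cell_dim c')) : Prop :=
  [/\ cube_vertex w, cube_vertex w', injective f, injective g &
      forall u u', unit_cube u -> unit_cube u' ->
        (chart c u = chart c' u' <->
         [/\ cube_face w [set f l | l in 'I_k]%SET u,
             cube_face w' [set g l | l in 'I_k]%SET u' &
             forall l, `|u 0 (f l) - w 0 (f l)| = `|u' 0 (g l) - w' 0 (g l)|])].

Lemma meeting_ex c c' x : carrier c x -> carrier c' x ->
  exists w w' k (f : 'I_k -> 'I_(cell_dim c)) (g : 'I_k -> 'I_(cell_dim c')),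
    meeting w w' f g.
Proof. by move=> cx c'x; apply: cell_meet; exists x. Qed.

Section Meeting.
Variables (c c' : cell X) (w : 'rV[R]_(cell_dim c)) (w' : 'rV[R]_(cell_dim c')).
Variables (k : nat) (f : 'I_k -> 'I_(cell_dim c)) (g : 'I_k -> 'I_(cell_dim c')).
Hypothesis M : meeting w w' f g.

(** [cell_meet] measures matched coordinates from w and w'; they run in opposite directions exactly
    when these vertices have different entries there. *)
Definition meeting_flip (l : 'I_k) : bool := (w' 0 (g l) == 1) (+) (w 0 (f l) == 1).

Lemma meeting_chart x : carrier c x -> carrier c' x ->
  [/\ forall j, (forall l, j != f l) -> coords c x 0 j = w 0 j,
      forall j, (forall l, j != g l) -> coords c' x 0 j = w' 0 j &
      forall l, coords c' x 0 (g l) = flip (meeting_flip l) (coords c x 0 (f l))].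
Proof.
move=> cx c'x; case: M => vw vw' _ _ H.
have [cu cE] := carrier_coords cx; have [c'u c'E] := carrier_coords c'x.
have [|[_ fa] [_ fb] lk] := (H _ _ cu c'u).1; first by rewrite cE c'E.
split.
- by move=> j nj; apply: fa; apply/imsetP => -[l _ /eqP]; apply/negP.
- by move=> j nj; apply: fb; apply/imsetP => -[l _ /eqP]; apply/negP.
- move=> l; have := lk l.
  rewrite (norm_sub_vertex (vw _) (cu _)) (norm_sub_vertex (vw' _) (c'u _)).
  by move/(congr1 (flip (w' 0 (g l) == 1))); rewrite flipK flip_flip => <-.
Qed.

Lemma meeting_lift u : unit_cube u -> (forall j, (forall l, j != f l) -> u 0 j = w 0 j) ->
  exists2 u', unit_cube u' &
    [/\ chart c u = chart c' u', forall j, (forall l, j != g l) -> u' 0 j = w' 0 j &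
        forall l, u' 0 (g l) = flip (meeting_flip l) (u 0 (f l))].
Proof.
move=> uu uw; case: M => vw vw' injf injg H.
pose u' : 'rV[R]_(cell_dim c') := \row_j
  if [pick l | j == g l] is Some l then flip (meeting_flip l) (u 0 (f l)) else w' 0 j.
have u'g l : u' 0 (g l) = flip (meeting_flip l) (u 0 (f l)).
  rewrite mxE; case: pickP => [l' /eqP/injg -> //|/(_ l)]; by rewrite eqxx.
have u'w j : (forall l, j != g l) -> u' 0 j = w' 0 j.
  by move=> nj; rewrite mxE; case: pickP => // l; rewrite (negPf (nj l)).
have uu' : unit_cube u'.
  by move=> j; rewrite mxE; case: pickP => [l _|_]; [rewrite flip01|exact: cube_vertex_unit].
exists u' => //; split => //.
apply/H => //; split.
- by split=> // j /imsetP nj; apply: uw => l; apply/eqP => jl; apply: nj; exists l.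
- by split=> // j /imsetP nj; apply: u'w => l; apply/eqP => jl; apply: nj; exists l.
- move=> l; rewrite (norm_sub_vertex (vw _) (uu _)) (norm_sub_vertex (vw' _) (uu' _)).
  by rewrite u'g flip_flip /meeting_flip addKb.
Qed.

Lemma meeting_vertexl j : w 0 j = 0 \/ w 0 j = 1. Proof. by case: M. Qed.
Lemma meeting_interior x i : carrier c x -> carrier c' x ->
  0 < coords c x 0 i < 1 -> exists l, i = f l.
Proof.
move=> cx c'x xi; apply: contrapT => nl.
have [/(_ i) + _ _] := meeting_chart cx c'x.
move=> E; have := xi; rewrite E; last by move=> l; apply/eqP => il; apply: nl; exists l.
by case: (meeting_vertexl i) => ->; rewrite ltxx ?andbF.
Qed.

Lemma meeting_face x : carrier c x ->
  (carrier c' x <-> forall j, (forall l, j != f l) -> coords c x 0 j = w 0 j).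
Proof.
move=> cx; split=> [c'x|]; first by case: (meeting_chart cx c'x).
move=> /(meeting_lift (coords_unit cx)) [u' uu' [+ _ _]].
by rewrite chart_coords// => ->; exact: carrier_chart.
Qed.

Lemma meeting_rowP (u v : 'rV[R]_(cell_dim c')) :
  (forall l, u 0 (g l) = v 0 (g l)) ->
  (forall j, (forall l, j != g l) -> u 0 j = v 0 j) -> u = v.
Proof.
move=> ug un; apply/rowP => j.
have [[l ->//]|nj] := pselect (exists l, j = g l).
by apply: un => l; apply/eqP => jl; apply: nj; exists l.
Qed.

End Meeting.

(** A coordinate that is interior at a common point is not fixed on the common face, so it is
    matched with a coordinate of c', and the full line through x in this direction lies in both
    cells. This is how coordinates pass from cell to cell. *)
Lemma interior_match c c' x i : carrier c x -> carrier c' x ->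
  0 < coords c x 0 i < 1 ->
  exists i' b,
    (forall y, carrier c y -> carrier c' y -> coords c' y 0 i' = flip b (coords c y 0 i)) /\
    (forall t, 0 <= t <= 1 ->
       chart c (upd (coords c x) i t) = chart c' (upd (coords c' x) i' (flip b t))).
Proof.
move=> cx c'x xi; have [w [w' [k [f [g M]]]]] := meeting_ex cx c'x.
have [l il] := meeting_interior M cx c'x xi.
exists (g l), (meeting_flip w w' f g l); split.
  by move=> y cy c'y; have [_ _ ->] := meeting_chart M cy c'y; rewrite il.
move=> t t01; have cu := coords_unit cx.
have [xw xw' xg] := meeting_chart M cx c'x.
have [injf injg] : injective f /\ injective g by case: M.
have [|u' uu' [-> u'w u'g]] := meeting_lift M (unit_cube_upd i cu t01).
  by move=> j nj; rewrite updE il (negPf (nj l)) xw.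
congr chart; apply: (meeting_rowP (g := g)) => [l'|j nj].
  rewrite u'g !updE il (inj_eq injf) (inj_eq injg) xg.
  by case: eqP => [->|].
by rewrite u'w// updE (negPf (nj l)) xw'.
Qed.

Lemma vertex_match c c' x : carrier c x -> carrier c' x ->
  cube_vertex (coords c x) -> cube_vertex (coords c' x).
Proof.
move=> cx c'x v i; have /andP[+ +] := coords_unit c'x i.
rewrite !le_eqVlt => /predU1P[->|i0]; first by left.
move=> /predU1P[->|i1]; first by right.
have [|i' [b [H _]]] := interior_match c'x cx (i := i); first by rewrite i0.
have := v i'; rewrite H//.
have : 0 < flip b (coords c' x 0 i) < 1 by rewrite flip_int i0.
by move=> + [] E; rewrite E ltxx ?andbF.
Qed.

Lemma sum_image (I J : finType) (f : I -> J) (F : J -> R) : injective f ->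
  (forall j, (forall i, j != f i) -> F j = 0) -> \sum_j F j = \sum_i F (f i).
Proof.
move=> injf F0; have <- := @big_imset _ _ _ _ _ f predT F (in2W injf).
rewrite [LHS](bigID (mem (f @: predT)%SET))/= [X in _ + X]big1 ?addr0.
  exact: eq_bigl.
by move=> j /imsetP nj; apply: F0 => i; apply/eqP => ji; apply: nj; exists i.
Qed.

End Cells.

HB.lock Definition cell_mass (R : realType) (X : cube_complex R) (p : R) (c : cell X)
    (x y : points X) : R :=
  \sum_j `|coords c x 0 j - coords c y 0 j| `^ p.

HB.lock Definition cell_dist (R : realType) (X : cube_complex R) (p : R) (c : cell X)
    (x y : points X) : R :=
  cell_mass p c x y `^ p^-1.

Section CellDist.
Context {R : realType} {X : cube_complex R}.
Implicit Types (c E : cell X) (x y z : points X) (p s t e : R).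

Lemma cell_mass_ge0 p c x y : 0 <= cell_mass p c x y.
Proof. by rewrite cell_mass.unlock psum_ge0. Qed.

Lemma cell_dist_ge0 p c x y : 0 <= cell_dist p c x y.
Proof. by rewrite cell_dist.unlock powR_ge0. Qed.

Lemma cell_distK p c x y : 0 < p -> cell_dist p c x y `^ p = cell_mass p c x y.
Proof. by move=> p0; rewrite cell_dist.unlock powRVK// cell_mass_ge0. Qed.

Lemma lp_norm_coords p c x y :
  lp_norm p [set: 'I_(cell_dim c)] (coords c x - coords c y) = cell_dist p c x y.
Proof.
rewrite /lp_norm cell_dist.unlock cell_mass.unlock; congr (_ `^ _).
by apply: eq_big => [j|j _]; rewrite ?inE// !mxE.
Qed.

Lemma cell_mass_meet p c c' x y : p != 0 -> carrier c x -> carrier c' x ->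
  carrier c y -> carrier c' y -> cell_mass p c x y = cell_mass p c' x y.
Proof.
move=> p0 cx c'x cy c'y; have [w [w' [k [f [g M]]]]] := meeting_ex cx c'x.
have [xw xw' xg] := meeting_chart M cx c'x; have [yw yw' yg] := meeting_chart M cy c'y.
have [injf injg] : injective f /\ injective g by case: M.
rewrite cell_mass.unlock (sum_image injf) ?(sum_image injg).
- by apply: eq_bigr => l _; rewrite xg yg flipB.
- by move=> j nj; rewrite xw' ?yw'// subrr normr0 powR0.
- by move=> j nj; rewrite xw ?yw// subrr normr0 powR0.
Qed.

Lemma cell_dist_meet p c c' x y : p != 0 -> carrier c x -> carrier c' x ->
  carrier c y -> carrier c' y -> cell_dist p c x y = cell_dist p c' x y.
Proof. by move=> *; rewrite cell_dist.unlock (@cell_mass_meet p c c'). Qed.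

Lemma conv_meet c c' x y s : carrier c x -> carrier c' x ->
  carrier c y -> carrier c' y -> 0 <= s <= 1 ->
  chart c ((1 - s) *: coords c x + s *: coords c y) =
  chart c' ((1 - s) *: coords c' x + s *: coords c' y).
Proof.
move=> cx c'x cy c'y s01; have [w [w' [k [f [g M]]]]] := meeting_ex cx c'x.
have [xw xw' xg] := meeting_chart M cx c'x; have [yw yw' yg] := meeting_chart M cy c'y.
have [|u' uu' [-> u'w u'g]] :=
  meeting_lift M (unit_cube_conv (coords_unit cx) (coords_unit cy) s01).
  by move=> j nj; rewrite !mxE xw ?yw// -mulrDl subrK mul1r.
congr chart; apply: (meeting_rowP (g := g)) => [l|j nj].
  by rewrite u'g !mxE xg yg flip_conv.
by rewrite u'w// !mxE xw' ?yw'// -mulrDl subrK mul1r.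
Qed.

Lemma meet_face c c' x : carrier c x -> carrier c' x ->
  exists (w : 'rV[R]_(cell_dim c)) (J : {set 'I_(cell_dim c)}), cube_vertex w /\
    forall y, carrier c y -> (carrier c' y <-> forall j, j \notin J -> coords c y 0 j = w 0 j).
Proof.
move=> cx c'x; have [w [w' [k [f [g M]]]]] := meeting_ex cx c'x.
exists w, [set f l | l in 'I_k]%SET; split; first by case: M.
move=> y cy; rewrite (meeting_face M cy); split=> H j nj; apply: H.
  by move=> l; apply: contra nj => /eqP ->; apply/imsetP; exists l.
by apply/imsetP => -[l _ /eqP]; apply/negP.
Qed.

(** The intersection is a face, and the smallest face of c through x and y fixes only the
    coordinates in which both are 0 or both are 1. *)
Lemma meet_hull c c' x y z : carrier c x -> carrier c' x -> carrier c y -> carrier c' y ->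
  carrier c z ->
  (forall j, coords c x 0 j = coords c y 0 j -> coords c x 0 j = 0 \/ coords c x 0 j = 1 ->
     coords c z 0 j = coords c x 0 j) ->
  carrier c' z.
Proof.
move=> cx c'x cy c'y cz H; have [w [J [vw F]]] := meet_face cx c'x.
apply/F => // j nj; have xw := (F x cx).1 c'x j nj; have yw := (F y cy).1 c'y j nj.
by rewrite H ?xw ?yw.
Qed.

End CellDist.

(** * Strings and stars *)

Section Strings.
Context {R : realType} {X : cube_complex R}.
Implicit Types (c E : cell X) (x y z w : points X) (p s t e l : R).

Lemma cell_distC p c x y : cell_dist p c x y = cell_dist p c y x.
Proof. by rewrite cell_dist.unlock cell_mass.unlock; congr (_ `^ _); apply: eq_bigr => j _; rewrite distrC. Qed.

Lemma cell_dist_xx p c x : p != 0 -> cell_dist p c x x = 0.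
Proof.
move=> p0; rewrite cell_dist.unlock cell_mass.unlock big1 ?powR0 ?invr_eq0// => j _.
by rewrite subrr normr0 powR0.
Qed.

Lemma cell_dist_triangle p c x y z : 1 < p ->
  cell_dist p c x z <= cell_dist p c x y + cell_dist p c y z.
Proof.
move=> p1; rewrite cell_dist.unlock cell_mass.unlock.
apply: le_trans (minkowski_le _ _ _ p1).
by under [X in _ <= X `^ _]eq_bigr => i _ do rewrite addrA subrK.
Qed.

Lemma coord_le_cell_dist p c x y j : 0 < p ->
  `|coords c x 0 j - coords c y 0 j| <= cell_dist p c x y.
Proof.
move=> p0; rewrite -(ler_powR2E p0) ?cell_dist_ge0// cell_distK//.
by rewrite cell_mass.unlock (bigD1 j)//= lerDl psum_ge0.
Qed.

Lemma cell_dist_eq0 p c x y : 0 < p -> carrier c x -> carrier c y ->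
  cell_dist p c x y = 0 -> x = y.
Proof.
move=> p0 cx cy E; apply: (coords_inj cx cy); apply/rowP => j.
have := @coord_le_cell_dist p c x y j p0.
by rewrite E normr_le0 subr_eq0 => /eqP.
Qed.

Lemma cell_dist_gt0 p c x y : 0 < p -> carrier c x -> carrier c y -> x <> y ->
  0 < cell_dist p c x y.
Proof.
move=> p0 cx cy xy; rewrite lt_neqAle cell_dist_ge0 andbT eq_sym; apply/eqP.
by move/(cell_dist_eq0 p0 cx cy).
Qed.

Lemma string_step p c x y z l : carrier c x -> carrier c y ->
  string_length p y z l -> string_length p x z (cell_dist p c x y + l).
Proof.
move=> cx cy; rewrite -{1}(chart_coords cy).
move/(string_cons (coords_unit cx) (coords_unit cy)).
rewrite (chart_coords cx) lp_norm_coords; exact: id.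
Qed.

Lemma string_points_ind p (P : points X -> points X -> R -> Prop) :
  (forall x, P x x 0) ->
  (forall c x y z l, carrier c x -> carrier c y -> string_length p y z l -> P y z l ->
     P x z (cell_dist p c x y + l)) ->
  forall x y l, string_length p x y l -> P x y l.
Proof.
move=> P0 PS x y l; elim=> // c u u' z l' uu uu' s Ps.
have := PS c (chart c u) (chart c u') z l' (carrier_chart uu) (carrier_chart uu') s Ps.
by rewrite -lp_norm_coords !coords_chart.
Qed.

Lemma string_ge0 p x y l : string_length p x y l -> 0 <= l.
Proof.
by move: x y l; apply: string_points_ind => // *; rewrite addr_ge0// cell_dist_ge0.
Qed.

Lemma string_cat p x y z l l' : string_length p x y l -> string_length p y z l' ->
  string_length p x z (l + l').
Proof.
move=> s; move: x y l s z l'; apply: string_points_ind.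
  by move=> x z l'; rewrite add0r.
move=> c x y z l cx cy s IH t l' st; rewrite -addrA.
by apply: string_step => //; exact: IH.
Qed.

Lemma string_one p c x y : carrier c x -> carrier c y ->
  string_length p x y (cell_dist p c x y).
Proof.
by move=> cx cy; rewrite -[cell_dist _ _ _ _]addr0; apply: string_step => //; exact: string_nil.
Qed.

Lemma string_connected p p' x y l : string_length p x y l ->
  exists l', string_length p' x y l'.
Proof.
move: x y l; apply: string_points_ind => [x|c x y z l cx cy _ [l' s]].
  by exists 0; exact: string_nil.
by exists (cell_dist p' c x y + l'); exact: string_step.
Qed.

Hypothesis conn : forall x y, exists l, string_length 2 x y l.

Lemma string_ex p x y : exists l, string_length p x y l.
Proof. by have [l /string_connected] := conn x y. Qed.

Lemma lp_dist_le_string p x y l : string_length p x y l -> lp_dist X p x y <= l.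
Proof.
by move=> s; apply: ge_inf => //; exists 0 => ? /string_ge0.
Qed.

Lemma lp_dist_ge p x y l : (forall l', string_length p x y l' -> l <= l') ->
  l <= lp_dist X p x y.
Proof. by move=> H; apply: lb_le_inf; [exact: string_ex|move=> l' /H]. Qed.

Lemma lp_dist_lt p x y l : lp_dist X p x y < l ->
  exists2 l', string_length p x y l' & l' < l.
Proof.
move=> dl; apply: contrapT => H; move: dl; apply/negP; rewrite -leNgt.
apply: lp_dist_ge => l' s; rewrite leNgt; apply/negP => l'l; apply: H; by exists l'.
Qed.

Lemma lp_dist_le_cell p c x y : carrier c x -> carrier c y ->
  lp_dist X p x y <= cell_dist p c x y.
Proof. by move=> cx cy; exact/lp_dist_le_string/string_one. Qed.

(* Within distance e of z, every cell contains z. *)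
Definition star_radius z e : Prop :=
  0 < e <= 1 /\ forall c, carrier c z -> forall i, 0 < coords c z 0 i < 1 ->
    e <= coords c z 0 i <= 1 - e.

(** Any cell at z has the same interior coordinates at z as [c], up to reversal, so a minimum over
    the finitely many coordinates of [c] serves for all cells. *)
Lemma star_radius_ex z : exists e, star_radius z e.
Proof.
have [c [u uu uz]] := chart_cover z; have cz : carrier c z by exists u.
pose P i := 0 < coords c z 0 i < 1.
pose e := \big[Num.min/1]_(i | P i) Num.min (coords c z 0 i) (1 - coords c z 0 i).
have ei i : P i -> e <= coords c z 0 i <= 1 - e.
  move=> Pi; have : e <= Num.min (coords c z 0 i) (1 - coords c z 0 i).
    by apply/bigmin_leP; right; exists i.
  by rewrite le_min => /andP[-> ?]/=; lra.
exists e; split.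
  apply/andP; split; last by apply/bigmin_leP; left.
  apply: lt_bigmin => // i /andP[i0 i1]; rewrite lt_min i0/=; lra.
move=> c' c'z i ii; have [j [b [H _]]] := interior_match c'z cz ii.
have Hz := H z c'z cz.
have := ei j; rewrite /P Hz flip_int => /(_ ii).
by rewrite /flip; case: b {H Hz}; lra.
Qed.

(** Where y has a coordinate 0 or 1, so has z: an interior coordinate of z keeps distance e from
    both ends, and a coordinate at one end is at distance 1 >= e from the other. So z lies in the
    smallest face of E that contains y. *)
Lemma star_step z e E E' y : star_radius z e -> carrier E z -> carrier E y ->
  (forall i, `|coords E y 0 i - coords E z 0 i| < e) -> carrier E' y -> carrier E' z.
Proof.
move=> [/andP[e0 e1] H] Ez Ey lt E'y.
apply: (meet_hull Ey E'y Ey E'y Ez) => j _ yj.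
have /andP[z0 z1] := coords_unit Ez j; have /andP[] : - e < coords E y 0 j - coords E z 0 j < e.
  by rewrite -ltr_norml.
have [zi|] := boolP (0 < coords E z 0 j < 1).
  by have /andP[] := H E Ez j zi; case: yj => -> *; exfalso; lra.
rewrite negb_and -!leNgt => /orP[] zj; have {}zj : coords E z 0 j = 0 \/ coords E z 0 j = 1.
- by left; apply/eqP; rewrite eq_le zj.
- by move: zj => []; case: yj => -> -> // *; exfalso; lra.
- by right; apply/eqP; rewrite eq_le zj z1.
- by move: zj => []; case: yj => -> -> // *; exfalso; lra.
Qed.

Section Star.
Variables (p : R) (z : points X) (e : R).
Hypotheses (p1 : 1 < p) (ze : star_radius z e).

Let p0 : 0 < p. Proof. exact: lt_trans ltr01 p1. Qed.

Lemma star_cell E E' y : carrier E z -> carrier E y -> cell_dist p E z y < e ->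
  carrier E' y -> carrier E' z.
Proof.
move=> Ez Ey lt; apply: (star_step ze Ez Ey) => i.
by apply: le_lt_trans lt; rewrite distrC; exact: coord_le_cell_dist.
Qed.

(** A string that is too short to leave the star of z uses only cells at z, so a bound for D on
    these cells adds up along it. D may be signed, as it is for the increments of a function. *)
Lemma star_string (D : points X -> points X -> R) :
  (forall x, D x x <= 0) -> (forall x y w, D x w <= D x y + D y w) ->
  (forall E x y, carrier E z -> carrier E x -> carrier E y -> D x y <= cell_dist p E x y) ->
  forall x y l, string_length p x y l ->
  forall E, carrier E z -> carrier E x -> cell_dist p E z x + l < e ->
    D x y <= l /\
    exists E', [/\ carrier E' z, carrier E' y & cell_dist p E' z y <= cell_dist p E z x + l].
Proof.
move=> D0 Dt DE; apply: string_points_ind => [x E Ez Ex _|].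
  by split => //; exists E; split => //; rewrite addr0.
move=> c x y t l cx cy s IH E Ez Ex lt; have l0 := string_ge0 s.
have cxy := cell_dist_ge0 p c x y.
have cz : carrier c z by apply: (star_cell Ez Ex) => //; lra.
have Ec : cell_dist p E z x = cell_dist p c z x by apply: cell_dist_meet => //; rewrite gt_eqF.
have tri := cell_dist_triangle c z x y p1.
have [|Dl [E' [E'z E't E'l]]] := IH c cz cy; first by lra.
split; last by exists E'; split => //; lra.
by apply: le_trans (Dt x y t) _; apply: lerD => //; exact: DE.
Qed.

(** A string from x either stays in the star, where D adds up, or has length at least e minus the
    distance of x from z, which is no less than D x y. *)
Lemma star_lower (D : points X -> points X -> R) :
  (forall x, D x x <= 0) -> (forall x y w, D x w <= D x y + D y w) ->
  (forall E x y, carrier E z -> carrier E x -> carrier E y -> D x y <= cell_dist p E x y) ->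
  forall x y E, carrier E z -> carrier E x -> cell_dist p E z x + D x y <= e ->
  D x y <= lp_dist X p x y.
Proof.
move=> D0 Dt DE x y E Ez Ex le; apply: lp_dist_ge => l s.
have [lt|ge] := ltP (cell_dist p E z x + l) e; last by lra.
by have [] := star_string D0 Dt DE s Ez Ex lt.
Qed.

(** With D = 0, [star_string] still says that a short string from z ends in a cell at z, at distance
    at most its length; all cells at z that contain y give the same value for this distance. *)
Lemma star_radial y : lp_dist X p z y < e ->
  exists E, [/\ carrier E z, carrier E y & cell_dist p E z y = lp_dist X p z y].
Proof.
move=> dz; have [c [u uu uz]] := chart_cover z; have cz : carrier c z by exists u.
have pn : p != 0 by rewrite gt_eqF.
have str l : string_length p z y l -> l < e -> exists E,
    [/\ carrier E z, carrier E y & cell_dist p E z y <= l].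
  move=> s le; have [||||_ [E [Ez Ey Ed]]] :=
    @star_string (fun _ _ => 0) _ _ _ _ _ _ s c cz cz.
  - by [].
  - by move=> *; rewrite addr0.
  - by move=> *; exact: cell_dist_ge0.
  - by rewrite cell_dist_xx// add0r.
  by exists E; split => //; rewrite cell_dist_xx// add0r in Ed.
have [l s le] := lp_dist_lt dz; have [E [Ez Ey _]] := str l s le.
exists E; split => //; apply/eqP; rewrite eq_le lp_dist_le_cell// andbT.
apply: lp_dist_ge => l' s'; have [l'e|] := ltP l' e.
  have [E' [E'z E'y E'l]] := str l' s' l'e.
  by rewrite (@cell_dist_meet _ _ p E E').
apply: le_trans; apply/ltW.
by have [E' [E'z E'y E'l]] := str l s le; rewrite (@cell_dist_meet _ _ p E E')//; lra.
Qed.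

Lemma star_radial_cell E y : carrier E z -> carrier E y -> lp_dist X p z y < e ->
  cell_dist p E z y = lp_dist X p z y.
Proof.
move=> Ez Ey /star_radial[E' [E'z E'y <-]].
by apply: cell_dist_meet => //; rewrite gt_eqF.
Qed.

Lemma star_ball_cell E y : lp_dist X p z y < e -> carrier E y -> carrier E z.
Proof.
by move=> dz; have [E' [E'z E'y E'd]] := star_radial dz; apply: (star_cell E'z E'y); rewrite E'd.
Qed.

End Star.

End Strings.

(** * CAT(0) geometry *)

Section Squares.
Context {R : realType}.
Implicit Types a b : R.

Lemma sqr_leE a b : 0 <= a -> 0 <= b -> (a ^+ 2 <= b ^+ 2) = (a <= b).
Proof. by move=> a0 b0; rewrite ler_pXn2r. Qed.

Lemma sqr_ltE a b : 0 <= a -> 0 <= b -> (a ^+ 2 < b ^+ 2) = (a < b).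
Proof. by move=> a0 b0; rewrite ltr_pXn2r. Qed.

Lemma sqr_normr a : `|a| ^+ 2 = a ^+ 2.
Proof. by rewrite real_normK ?num_real. Qed.

Lemma le_of_eq a b : a = b -> a <= b. Proof. by move->. Qed.

End Squares.

Section CAT0.
Context {R : realType} {T : Type} (d : T -> T -> R).
Hypothesis HC : CAT0_space d.
Implicit Types (x y z : T) (s t r : R) (c : R -> T).

Lemma dist_ge0 x y : 0 <= d x y. Proof. by case: HC => -[]. Qed.
Lemma dist_eq0 x y : d x y = 0 -> x = y.
Proof. by case: HC => -[_ H _ _] _ _ /H. Qed.
Lemma dist_xx x : d x x = 0. Proof. by case: HC => -[_ H _ _] _ _; apply/H. Qed.
Lemma distC x y : d x y = d y x. Proof. by case: HC => -[]. Qed.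
Lemma dist_tri x y z : d x z <= d x y + d y z. Proof. by case: HC => -[]. Qed.
Lemma geod_ex x y : exists c, geodesic d x y c. Proof. by case: HC. Qed.

Lemma geod_rev x y c : geodesic d x y c -> geodesic d y x (fun s => c (1 - s)).
Proof.
move=> [c0 c1 cd]; split; rewrite ?subr0 ?subrr// => s t s01 t01.
rewrite cd; [|lra|lra].
by rewrite (distC y x) distrC; congr (`|_| * _); ring.
Qed.

Lemma geod_sub x y c r : geodesic d x y c -> 0 <= r <= 1 ->
  geodesic d x (c r) (fun s => c (r * s)).
Proof.
move=> [c0 c1 cd] r01; split; rewrite ?mulr0 ?mulr1// => s t s01 t01.
have r0 : 0 <= r by lra.
rewrite cd; [|nra|nra]; rewrite -mulrBr normrM (ger0_norm r0).
rewrite -[in d x (c r)]c0 cd ?lexx ?ler01// sub0r normrN (ger0_norm r0).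
by ring.
Qed.

Lemma geod_d0 x y c s : geodesic d x y c -> 0 <= s <= 1 -> d x (c s) = s * d x y.
Proof.
move=> [c0 c1 cd] s01; rewrite -[in LHS]c0 cd ?lexx ?ler01// sub0r normrN ger0_norm//; lra.
Qed.

Lemma geod_d1 x y c s : geodesic d x y c -> 0 <= s <= 1 -> d (c s) y = (1 - s) * d x y.
Proof.
move=> [c0 c1 cd] s01; rewrite -[in LHS]c1 cd ?lexx ?ler01// distrC ger0_norm//; lra.
Qed.

Lemma euclid_dist2 (a b : 'rV[R]_2) :
  euclid_dist a b = Num.sqrt ((a 0 0 - b 0 0) ^+ 2 + (a 0 1 - b 0 1) ^+ 2).
Proof.
rewrite /euclid_dist /lp_norm powR12_sqrt; last first.
  by apply: sumr_ge0 => *; exact: powR_ge0.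
congr Num.sqrt; transitivity (\sum_j (a 0 j - b 0 j) ^+ 2).
  apply: eq_big => [j|j _]; rewrite ?inE// !mxE (powR_mulrn 2)//.
  by rewrite real_normK ?num_real.
rewrite !big_ord_recl big_ord0 addr0.
by congr (_ + (a _ _ - b _ _) ^+ 2); apply/val_inj.
Qed.

(* Comparison for two geodesics issued from x, with the inner product of the
   comparison triangle expressed by its sides. *)
Lemma comparison x y z c c' s t : geodesic d x y c -> geodesic d x z c' ->
  0 <= s <= 1 -> 0 <= t <= 1 ->
  d (c s) (c' t) ^+ 2 <= s ^+ 2 * d x y ^+ 2 + t ^+ 2 * d x z ^+ 2
                         - s * t * (d x y ^+ 2 + d x z ^+ 2 - d y z ^+ 2).
Proof.
move=> gc gc' s01 t01; case: HC => _ _ /(_ _ _ _ _ _ gc gc') cmp.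
have A0 := dist_ge0 x y; have B0 := dist_ge0 x z; have C0 := dist_ge0 y z.
have t1 := dist_tri x y z; have t2 := dist_tri y x z; have t3 := dist_tri x z y.
rewrite (distC y x) in t2; rewrite (distC z y) in t3.
move: (d x y) (d x z) (d y z) A0 B0 C0 t1 t2 t3 cmp => A B C A0 B0 C0 t1 t2 t3 cmp.
(* The comparison triangle has x at the origin, y at (A, 0) and z at (u, v). For A = 0 the division
   defining [u] fails, but then B = C. *)
have [u [v [uv2 uAv]]] : exists u v, u ^+ 2 + v ^+ 2 = B ^+ 2 /\
    (A - u) ^+ 2 + v ^+ 2 = C ^+ 2.
  have [A00|An0] := eqVneq A 0.
    have CB : C = B by apply/eqP; rewrite eq_le; apply/andP; split; lra.
    by exists B, 0; rewrite CB A00; split; ring.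
  have Ap : 0 < A by rewrite lt_neqAle eq_sym An0.
  pose u := (A ^+ 2 + B ^+ 2 - C ^+ 2) / (2 * A).
  have uE : 2 * A * u = A ^+ 2 + B ^+ 2 - C ^+ 2.
    by rewrite /u mulrC divfK// mulf_neq0// pnatr_eq0.
  have uB : u ^+ 2 <= B ^+ 2.
    have h1 : 2 * A * u <= 2 * A * B by rewrite uE; nra.
    have h2 : - (2 * A * B) <= 2 * A * u by rewrite uE; nra.
    have A2 : 0 < 2 * A by lra.
    rewrite (ler_pM2l A2) in h1.
    rewrite -mulrN (ler_pM2l A2) in h2.
    by rewrite -[B ^+ 2]real_normK ?num_real// -[u ^+ 2]real_normK ?num_real//
       lerXn2r ?nnegrE// (ger0_norm B0) ler_norml h2.
  exists u, (Num.sqrt (B ^+ 2 - u ^+ 2)); rewrite sqr_sqrtr ?subr_ge0//.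
  by split; [ring|rewrite sqrrB -mulr_natl mulrA uE; ring].
pose vec (a b : R) : 'rV[R]_2 := \row_j if j == 0 then a else b.
have := cmp (vec 0 0) (vec A 0) (vec u v) _ _ _ s t s01 t01.
rewrite !euclid_dist2 !mxE /=.
have e1 : Num.sqrt ((0 - A) ^+ 2 + (0 - 0) ^+ 2) = A.
  by rewrite subrr expr0n addr0 sub0r sqrrN sqrtr_sqr ger0_norm.
have e2 : Num.sqrt ((0 - u) ^+ 2 + (0 - v) ^+ 2) = B.
  by rewrite !sub0r !sqrrN uv2 sqrtr_sqr ger0_norm.
have e3 : Num.sqrt ((A - u) ^+ 2 + (0 - v) ^+ 2) = C.
  by rewrite sub0r sqrrN uAv sqrtr_sqr ger0_norm.
move=> /(_ e1 e2 e3) H.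
apply: (@le_trans _ _ (((1 - s) * 0 + s * A - ((1 - t) * 0 + t * u)) ^+ 2 +
   ((1 - s) * 0 + s * 0 - ((1 - t) * 0 + t * v)) ^+ 2)).
  rewrite -[leRHS]sqr_sqrtr; last by rewrite addr_ge0 ?sqr_ge0.
  by rewrite lerXn2r ?nnegrE ?sqrtr_ge0// dist_ge0.
rewrite -subr_ge0 -uv2 -uAv.
by apply: le_of_eq; ring.
Qed.

(** The comparison of a vertex with a point of the opposite side, from [comparison] at t = 1. It is
    the form of the CAT(0) inequality used most often. *)
Lemma stewart x y z c s : geodesic d x y c -> 0 <= s <= 1 ->
  d z (c s) ^+ 2 <= (1 - s) * d z x ^+ 2 + s * d z y ^+ 2 - s * (1 - s) * d x y ^+ 2.
Proof.
move=> gc s01; have [c' gc'] := geod_ex x z; have [_ c'1 _] := gc'.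
have := comparison gc gc' s01 (ltac:(lra) : 0 <= (1 : R) <= 1).
rewrite c'1 (distC z x) (distC z y) (distC z (c s)) => H; apply: le_trans H _.
by apply: le_of_eq; ring.
Qed.

(** Uniqueness of geodesics: Stewart's inequality with vertex q has right-hand side 0. *)
Lemma geod_point x y c s q : geodesic d x y c -> 0 <= s <= 1 ->
  d x q = s * d x y -> d q y = (1 - s) * d x y -> q = c s.
Proof.
move=> gc s01 q1 q2; apply: dist_eq0.
have := stewart q gc s01; rewrite (distC q x) q1 q2 => H.
have : d q (c s) ^+ 2 <= 0 by apply: le_trans H _; apply: le_of_eq; ring.
move=> H0; apply/eqP; rewrite -sqrf_eq0 eq_le H0 sqr_ge0//.
Qed.

(** Insert the diagonal geodesic from x to y' and compare twice geodesics with a common end. *)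
Lemma geod_convex x y x' y' c c' s : geodesic d x y c -> geodesic d x' y' c' ->
  0 <= s <= 1 -> d (c s) (c' s) <= (1 - s) * d x x' + s * d y y'.
Proof.
have fan a b b' k k' r : geodesic d a b k -> geodesic d a b' k' -> 0 <= r <= 1 ->
    d (k r) (k' r) <= r * d b b'.
  move=> gk gk' r01; have H := comparison gk gk' r01 r01.
  have r0 : 0 <= r by lra.
  rewrite -sqr_leE; [|exact: dist_ge0|by rewrite mulr_ge0 ?dist_ge0].
  by apply: le_trans H _; apply: le_of_eq; ring.
move=> gc gc' s01; have [k gk] := geod_ex x y'.
have s01' : 0 <= 1 - s <= 1 by lra.
have := fan _ _ _ _ _ _ (geod_rev gk) (geod_rev gc') s01'.
rewrite subKr => H1; have H2 := fan _ _ _ _ _ _ gc gk s01.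
by have := dist_tri (c s) (k s) (c' s); lra.
Qed.

Definition unit_geodesic (e : R -> T) : Prop :=
  forall s t, 0 <= s <= 1 -> 0 <= t <= 1 -> d (e s) (e t) = `|s - t|.

Definition is_proj (e : R -> T) z t : Prop :=
  0 <= t <= 1 /\ forall t', 0 <= t' <= 1 -> d z (e t) <= d z (e t').

(** Expressed by the end points alone, so that two cells sharing the edge [v, n] define the same
    function. The points with d v q + d q n = 1 are those of the geodesic edge. *)
Definition edge_proj v n z : R :=
  xget 0 [set t : R | 0 <= t <= 1 /\ exists q, [/\ d v q = t, d q n = 1 - t &
    forall q', d v q' + d q' n = 1 -> d z q <= d z q']].

Lemma unit_geodesic_sub e a b : unit_geodesic e -> 0 <= a <= 1 -> 0 <= b <= 1 ->
  geodesic d (e a) (e b) (fun s => e (a + s * (b - a))).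
Proof.
move=> ue a01 b01; split; rewrite ?mul0r ?addr0// ?mul1r ?subrKC// => s t s01 t01.
rewrite ue; [|by apply/andP; split; nra|by apply/andP; split; nra].
rewrite ue//; rewrite opprD addrACA subrr add0r -mulrBl normrM; congr (_ * _).
by rewrite distrC.
Qed.

Lemma edge_projE e z t : unit_geodesic e -> is_proj e z t ->
  (forall t', is_proj e z t' -> t' = t) -> edge_proj (e 0) (e 1) z = t.
Proof.
move=> ue pt uniq.
have g : geodesic d (e 0) (e 1) e.
  have := unit_geodesic_sub ue (ltac:(lra) : 0 <= (0 : R) <= 1) (ltac:(lra) : 0 <= (1 : R) <= 1).
  by congr geodesic; apply/funext => s; rewrite add0r subr0 mulr1.
have L : d (e 0) (e 1) = 1 by rewrite ue ?lexx ?ler01// sub0r normrN normr1.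
have e0 s : 0 <= s <= 1 -> d (e 0) (e s) = s by move=> s01; rewrite (geod_d0 g s01) L mulr1.
have e1 s : 0 <= s <= 1 -> d (e s) (e 1) = 1 - s by move=> s01; rewrite (geod_d1 g s01) L mulr1.
have on q r : 0 <= r <= 1 -> d (e 0) q = r -> d q (e 1) = 1 - r -> q = e r.
  by move=> r01 q0 q1; apply: (geod_point g r01); rewrite L mulr1.
rewrite /edge_proj; case: xgetP => [r _ [r01 [q [q0 q1 qm]]]|/(_ t)[]].
  apply: uniq; split => // t' t'01; rewrite -(on q r r01 q0 q1).
  by apply: qm; rewrite e0// e1// subrKC.
case: pt => t01 tm; split => //; exists (e t); split; [exact: e0|exact: e1|].
move=> q' q'1; have q'0 : 0 <= d (e 0) q' <= 1.
  by have := dist_ge0 (e 0) q'; have := dist_ge0 q' (e 1); lra.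
rewrite (on q' (d (e 0) q'))//; first exact: tm.
by move: q'1; lra.
Qed.

Section Projection.
Variable e : R -> T.
Hypothesis ue : unit_geodesic e.

(** The angle at the foot is at least a right angle: Stewart's inequality between e t and a nearby
    point of the edge, for s tending to 0. *)
Lemma is_proj_obtuse z t t' : is_proj e z t -> 0 <= t' <= 1 ->
  d z (e t) ^+ 2 + (t' - t) ^+ 2 <= d z (e t') ^+ 2.
Proof.
move=> [t01 tm] t'01; have g := unit_geodesic_sub ue t01 t'01.
have key s : 0 < s <= 1 ->
    d z (e t) ^+ 2 + (1 - s) * (t' - t) ^+ 2 <= d z (e t') ^+ 2.
  move=> s01; have s0 : 0 < s by case/andP: s01.
  have s01' : 0 <= s <= 1 by lra.
  have := stewart z g s01'.
  have : d z (e t) ^+ 2 <= d z (e (t + s * (t' - t))) ^+ 2.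
    rewrite sqr_leE ?dist_ge0//; apply: tm.
    by apply/andP; split; nra.
  rewrite (ue t01 t'01) sqr_normr -(sqrrN (t - t')) opprB.
  move=> h1 h2; rewrite -(ler_pM2l s0); lra.
rewrite leNgt; apply/negP => lt.
set A := d z (e t) ^+ 2 in key lt; set B := d z (e t') ^+ 2 in key lt.
set D := (t' - t) ^+ 2 in key lt.
have D0 : 0 <= D by exact: sqr_ge0.
(* s (D + 1) is at most half of the gap A + D - B, whereas [key] makes the gap at most s D. *)
pose s := Num.min 1 ((A + D - B) / (D + 1) / 2).
have q0 : 0 < (A + D - B) / (D + 1) / 2 by rewrite divr_gt0// divr_gt0//; lra.
have s0 : 0 < s by rewrite /s lt_min ltr01 q0.
have := key s; rewrite s0 /s ge_min lexx => /(_ isT); rewrite -/s.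
have : s * (D + 1) <= (A + D - B) / 2.
  rewrite -ler_pdivlMr; last lra.
  by rewrite /s ge_min; apply/orP; right; rewrite mulrAC.
by have := mulr_ge0 (ltW s0) D0; nra.
Qed.

Lemma is_proj_uniq z t t' : is_proj e z t -> is_proj e z t' -> t = t'.
Proof.
move=> pt pt'; have := is_proj_obtuse pt (proj1 pt'); have := is_proj_obtuse pt' (proj1 pt).
move=> h1 h2; have : (t - t') ^+ 2 <= 0.
  by have := sqr_ge0 (t - t'); rewrite -(sqrrN (t' - t)) opprB in h2; lra.
move=> h; apply/eqP; rewrite -subr_eq0 -sqrf_eq0 eq_le h sqr_ge0//.
Qed.

Lemma is_proj_ex z : exists t, is_proj e z t.
Proof.
(* Clamping to [0, 1] makes the distance to z a 1-Lipschitz function on the whole line, which has a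
   minimum on the compact interval. *)
pose cl (t : R) := Num.max 0 (Num.min 1 t).
have cl01 t : 0 <= cl t <= 1.
  by rewrite /cl le_max lexx/= ge_max ler01/= ge_min lexx.
have clE t : 0 <= t <= 1 -> cl t = t.
  by move=> /andP[t0 t1]; rewrite /cl min_r// max_r.
have clL s t : `|cl s - cl t| <= `|s - t|.
  have clT u : [\/ u <= 0 /\ cl u = 0, 0 <= u <= 1 /\ cl u = u | 1 <= u /\ cl u = 1].
    have [u0|u0] := leP u 0.
      by constructor 1; split => //; rewrite /cl min_r ?max_l//; lra.
    have [u1|u1] := leP u 1; first by constructor 2; rewrite clE (ltW u0).
    by constructor 3; split; [exact: ltW|rewrite /cl min_l ?max_r//; lra].
  have h1 := ler_norm (s - t); have := ler_norm (t - s); rewrite distrC => h2.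
  by case: (clT s) => -[hs ->]; case: (clT t) => -[ht ->]; rewrite ler_norml;
    apply/andP; split; lra.
pose f t := d z (e (cl t)).
have fL s t : `|f s - f t| <= `|s - t|.
  apply: le_trans (clL s t); rewrite -(ue (cl01 s) (cl01 t)) ler_norml /f.
  have := dist_tri z (e (cl s)) (e (cl t)); have := dist_tri z (e (cl t)) (e (cl s)).
  by rewrite (distC (e (cl t))); lra.
have cf : {within `[0%R, 1%R]%classic, continuous f}.
  apply: continuous_subspaceT => s; apply/cvgrPdist_le => eps eps0.
  near=> t; apply: le_trans (fL s t) _; near: t.
  exact: (@cvgr_dist_le _ _ _ (nbhs s) _ id s).
have [t t01 tm] := @EVT_min R f 0 1 ler01 cf.
move: t01; rewrite in_itv/= => t01; exists t; split=> // t' t'01.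
have := tm t'; rewrite in_itv/= t'01 => /(_ isT); rewrite /f !clE//.
Unshelve. all: by end_near.
Qed.

Let pr := edge_proj (e 0) (e 1).

Lemma edge_proj_is_proj z : is_proj e z (pr z).
Proof.
have [t pt] := is_proj_ex z; rewrite /pr (edge_projE ue pt)// => t' pt'.
exact: is_proj_uniq pt' pt.
Qed.

Lemma edge_proj_eq z t : is_proj e z t -> pr z = t.
Proof. exact/is_proj_uniq/edge_proj_is_proj. Qed.

Lemma edge_proj01 z : 0 <= pr z <= 1. Proof. by case: (edge_proj_is_proj z). Qed.

Lemma edge_proj_obtuse z t : 0 <= t <= 1 ->
  d z (e (pr z)) ^+ 2 + (t - pr z) ^+ 2 <= d z (e t) ^+ 2.
Proof. by move=> t01; apply: is_proj_obtuse => //; exact: edge_proj_is_proj. Qed.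

Lemma edge_proj_on t : 0 <= t <= 1 -> pr (e t) = t.
Proof.
by move=> t01; apply: edge_proj_eq; split=> // t' _; rewrite dist_xx dist_ge0.
Qed.

(** The foot of z' is nearly optimal for z, and the obtuse angle at the foot of z turns this into a
    bound for the squared displacement. A modulus of order one half is enough for continuity. *)
Lemma edge_proj_modulus z z' :
  (pr z - pr z') ^+ 2 <= 4 * d z z' * (d z (e (pr z)) + d z z').
Proof.
have [_ m'] := edge_proj_is_proj z'; have := m' _ (edge_proj01 z).
have := edge_proj_obtuse z (edge_proj01 z').
have := dist_tri z z' (e (pr z')); have := dist_tri z' z (e (pr z)).
rewrite (distC z' z) -(sqrrN (_ - _)) opprB.
have := dist_ge0 z (e (pr z')).
move: (d z (e (pr z'))) (d z' (e (pr z'))) (d z' (e (pr z))) => a b c'.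
have := dist_ge0 z z'; have := dist_ge0 z (e (pr z)).
move: (d z z') (d z (e (pr z))) => u D D0 u0 a0 h1 h2 h3 h4.
have aD : a <= D + 2 * u by lra.
have : a ^+ 2 <= (D + 2 * u) ^+ 2 by rewrite sqr_leE//; lra.
by move: h3; rewrite sqrrD; lra.
Qed.

Lemma edge_proj_cont z r : 0 < r ->
  exists2 r', 0 < r' & forall z', d z z' < r' -> `|pr z - pr z'| < r.
Proof.
move=> r0; set D := d z (e (pr z)); have D0 : 0 <= D by exact: dist_ge0.
pose r' := Num.min 1 (r ^+ 2 / (8 * (D + 1))).
have rp : 0 < r ^+ 2 by rewrite exprn_gt0.
have q0 : 0 < r ^+ 2 / (8 * (D + 1)) by rewrite divr_gt0//; lra.
exists r'; first by rewrite /r' lt_min ltr01.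
move=> z'; rewrite /r' lt_min => /andP[lt1]; rewrite ltr_pdivlMr; last lra.
move=> lt2; have := edge_proj_modulus z z'; rewrite -/D.
have := dist_ge0 z z'; move: (d z z') lt1 lt2 => u u1 lt2 u0 h.
rewrite -sqr_ltE ?(ltW r0)// sqr_normr; apply: le_lt_trans h _.
have : u * (D + u) <= u * (D + 1) by rewrite ler_wpM2l// lerD2l ltW.
lra.
Qed.

(** By the triangle inequality a better foot for c s would be a better foot for z. *)
Lemma edge_proj_geodesic z c s : geodesic d (e (pr z)) z c -> 0 <= s <= 1 ->
  pr (c s) = pr z.
Proof.
move=> gc s01; apply: edge_proj_eq; split; first exact: edge_proj01.
move=> t t01; have [_ /(_ t t01)] := edge_proj_is_proj z.
have h0 : d (c s) (e (pr z)) = s * d (e (pr z)) z.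
  by rewrite (distC (c s)) (geod_d0 gc s01).
have h1 : d z (c s) = (1 - s) * d (e (pr z)) z by rewrite distC (geod_d1 gc s01).
by have := dist_tri z (c s) (e t); rewrite h0 h1 (distC z (e (pr z))); lra.
Qed.

(** The converse of the preceding fact: since c s has its foot at e t, the geodesic leaves the edge
    at an angle that is at least right, and comparison carries the resulting inequality from c s to
    q. *)
Lemma edge_proj_of_geodesic q c s t : 0 <= t <= 1 -> geodesic d (e t) q c ->
  0 < s <= 1 -> pr (c s) = t -> pr q = t.
Proof.
move=> t01 gc s01 pt; apply: edge_proj_eq; split=> // t' t'01.
have s0 : 0 < s by case/andP: s01.
have s01' : 0 <= s <= 1 by lra.
have := edge_proj_obtuse (c s) t'01; rewrite pt (distC _ (e t)) (geod_d0 gc s01').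
have g := unit_geodesic_sub ue t01 t'01.
have := comparison gc g s01' (ltac:(lra) : 0 <= (1 : R) <= 1).
rewrite mul1r subrKC (ue t01 t'01) sqr_normr.
rewrite -(sqrrN (t - t')) opprB => h1 h2.
have : 0 <= s * (d q (e t') ^+ 2 - (t' - t) ^+ 2 - d (e t) q ^+ 2).
  by move: h1 h2; rewrite exprMn; lra.
rewrite pmulr_rge0// => h3.
rewrite -sqr_leE ?dist_ge0// (distC q (e t)).
by have := sqr_ge0 (t' - t); lra.
Qed.

End Projection.

(** In a CAT(0) space local geodesics are geodesics. Past s, the point e s is the midpoint of a
    short geodesic from e (s - u) to e t, and Stewart's inequality with vertex e 0, solved for d (e
    0) (e t), gives the lower bound L (s + u). *)
Lemma local_geodesic_geodesic e L : 0 <= L ->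
  (forall t, 0 <= t <= 1 -> exists2 r, 0 < r & forall s s', 0 <= s <= 1 -> 0 <= s' <= 1 ->
     `|s - t| < r -> `|s' - t| < r -> d (e s) (e s') = L * `|s - s'|) ->
  d (e 0) (e 1) = L.
Proof.
move=> L0 loc.
suff H s : 0 <= s <= 1 -> d (e 0) (e s) = L * s by rewrite H ?mulr1//; lra.
move: s; apply: interval_ind => //; first by rewrite dist_xx mulr0.
- move=> s /andP[s0 s1] H; have s01 : 0 <= s <= 1 by lra.
  have [r r0 Hr] := loc s s01.
  have [s00|sn0] := eqVneq s 0.
    exists r => // t st tr t1; rewrite s00 in st tr Hr.
    rewrite Hr; [|lra|lra|by rewrite subrr normr0|by rewrite subr0 ger0_norm//; lra].
    by rewrite sub0r normrN ger0_norm.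
  have sp : 0 < s by rewrite lt_neqAle eq_sym sn0.
  pose m := Num.min r s; have m0 : 0 < m by rewrite /m lt_min r0.
  exists m => // t st tm t1.
  have := tm; rewrite -ltrBlDl /m lt_min => /andP[tr ts].
  pose u := t - s; have u0 : 0 <= u by rewrite /u; lra.
  have u1 : u < s by rewrite /u; lra.
  have [u00|un0] := eqVneq u 0.
    have -> : t = s by move: u00; rewrite /u; lra.
    by apply: H; lra.
  have up : 0 < u by rewrite lt_neqAle eq_sym un0.
  have ur : u < r by rewrite /u; lra.
  have nsu : `|s - u - s| = u by rewrite (_ : s - u - s = - u) ?normrN ?ger0_norm//; ring.
  have nts : `|t - s| = u by rewrite -/u ger0_norm.
  have nss : `|s - s| = 0 by rewrite subrr normr0.
  have su01 : 0 <= s - u <= 1 by lra.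
  have t01 : 0 <= t <= 1 by lra.
  have tb : d (e (s - u)) (e t) = L * (2 * u).
    rewrite Hr ?nsu ?nts//; congr (_ * _).
    by rewrite (_ : s - u - t = - (2 * u)) ?normrN ?ger0_norm//; [lra|rewrite /u; ring].
  have ts' : d (e (s - u)) (e s) = L * u by rewrite Hr ?nsu ?nss.
  have te : d (e s) (e t) = L * u by rewrite Hr ?nts ?nss// distrC nts.
  have [c gc] := geod_ex (e (s - u)) (e t).
  have h01 : 0 <= (2^-1 : R) <= 1 by lra.
  have mid : e s = c 2^-1.
    by apply: (geod_point gc h01); rewrite tb ?ts' ?te; field.
  have := stewart (e 0) gc h01; rewrite -mid tb (H s) ?(H (s - u)); [|lra|lra].
  have up1 : d (e 0) (e t) <= L * t.
    have := dist_tri (e 0) (e s) (e t); rewrite te (H s); last lra.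
    by rewrite -mulrDr /u subrKC.
  move=> h; apply/eqP; rewrite eq_le up1 andTb -sqr_leE; [|by apply: mulr_ge0 => //; lra|exact: dist_ge0].
  have -> : (L * t) ^+ 2 = 2 * (L * s) ^+ 2 + 2 * (L * u) ^+ 2 - (L * (s - u)) ^+ 2.
    by rewrite /u; ring.
  move: h; rewrite (_ : 1 - 2^-1 = 2^-1); last by lra.
  rewrite !exprMn; lra.
- move=> s /andP[s0 s1] H; have s01 : 0 <= s <= 1 by lra.
  have [r r0 Hr] := loc s s01.
  have key m : 0 < m -> m < r -> m <= s ->
      d (e 0) (e (s - m)) = L * (s - m) /\ d (e (s - m)) (e s) = L * m.
    move=> m0 mr ms; split; first by apply: H; lra.
    have nm : `|s - m - s| = m by rewrite addrAC subrr add0r normrN gtr0_norm.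
    by rewrite Hr ?subrr ?normr0 ?nm//; lra.
  apply/eqP; rewrite eq_le; apply/andP; split.
    pose m := Num.min (r / 2) s; have m0 : 0 < m by rewrite /m lt_min divr_gt0.
    have [||h1 h2] := key m m0.
    + by apply: (@le_lt_trans _ _ (r / 2)); [rewrite /m ge_min lexx|lra].
    + by rewrite /m ge_min lexx orbT.
    by have := dist_tri (e 0) (e (s - m)) (e s); rewrite h1 h2; lra.
  rewrite leNgt; apply/negP => lt.
  pose g := (L * s - d (e 0) (e s)) / (4 * (L + 1)).
  have g0 : 0 < g by rewrite divr_gt0//; lra.
  have gE : g * (4 * (L + 1)) = L * s - d (e 0) (e s) by rewrite divfK// gt_eqF//; lra.
  pose m := Num.min (Num.min (r / 2) s) g.
  have m0 : 0 < m by rewrite /m !lt_min divr_gt0// s0.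
  have mg : m <= g by rewrite /m ge_min lexx orbT.
  have [||h1 h2] := key m m0.
  + by apply: (@le_lt_trans _ _ (r / 2)); [rewrite /m !ge_min lexx|lra].
  + by rewrite /m !ge_min lexx orbT.
  have := dist_tri (e 0) (e s) (e (s - m)); rewrite h1 (distC (e s)) h2 => h.
  have := ler_wpM2r (ltac:(lra) : 0 <= 4 * (L + 1)) mg; rewrite gE.
  by have := mulr_ge0 L0 (ltW m0); lra.
Qed.

End CAT0.

(** * The zero-tension condition *)

Lemma sum_split_image (R : realType) (I J : finType) (f : I -> J) (F : J -> R) :
  injective f -> \sum_j F j = \sum_i F (f i) + \sum_(j | j \notin codom f) F j.
Proof.
move=> injf; have <- := @big_imset _ _ _ _ _ f predT F (in2W injf).
rewrite [LHS](bigID (mem (f @: predT)%SET))/=; congr (_ + _).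
apply: eq_bigl => j; congr (~~ _); apply/imsetP/codomP => [[i _ ->]|[i ->]]; by exists i.
Qed.

Section ZeroTension.
Context {R : realType} {X : cube_complex R}.
Hypothesis conn : forall x y : points X, exists l, string_length 2 x y l.
Implicit Types (c E : cell X) (x y z w : points X) (p s t e : R) (h : points X -> R).

(* Moving z to the point of the common face whose coordinates are the means of
   those of P and Q shortens the path P, z, Q, unless z already is this point. *)
Lemma zero_tension_meeting p E1 E2 (w1 : 'rV[R]_(cell_dim E1)) (w2 : 'rV[R]_(cell_dim E2))
    k (f : 'I_k -> 'I_(cell_dim E1)) (g : 'I_k -> 'I_(cell_dim E2)) z P Q (r : R) :
  1 < p -> meeting w1 w2 f g ->
  carrier E1 z -> carrier E2 z -> carrier E1 P -> carrier E2 Q ->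
  cell_dist p E1 P z = r -> cell_dist p E2 Q z = r -> 2 * r <= lp_dist X p P Q ->
  forall l, coords E1 P 0 (f l) + flip (meeting_flip w1 w2 f g l) (coords E2 Q 0 (g l)) =
            2 * coords E1 z 0 (f l).
Proof.
move=> p1 M E1z E2z E1P E2Q rP rQ dPQ; have p0 : 0 < p by lra.
have [injf injg] : injective f /\ injective g by case: M.
have [zw1 zw2 zg] := meeting_chart M E1z E2z.
set ml := meeting_flip w1 w2 f g in zg *.
pose a l := coords E1 P 0 (f l); pose b l := flip (ml l) (coords E2 Q 0 (g l)).
pose zz l := coords E1 z 0 (f l).
have a01 l : 0 <= a l <= 1 := coords_unit E1P (f l).
have b01 l : 0 <= b l <= 1 by rewrite /b flip01; exact: coords_unit.
(* The competitor for z: means in the matched coordinates, the coordinates of z in the others. *)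
pose u : 'rV[R]_(cell_dim E1) := \row_j
  if [pick l | j == f l] is Some l then (a l + b l) / 2 else coords E1 z 0 j.
have uf l : u 0 (f l) = (a l + b l) / 2.
  by rewrite mxE; case: pickP => [l' /eqP/injf -> //|/(_ l)]; rewrite eqxx.
have un j : (forall l, j != f l) -> u 0 j = coords E1 z 0 j.
  by move=> nj; rewrite mxE; case: pickP => // l; rewrite (negPf (nj l)).
have uu : unit_cube u.
  move=> j; rewrite mxE; case: pickP => [l _|_]; last exact: coords_unit.
  by have := a01 l; have := b01 l; lra.
have [|u' uu' [uE u'n u'g]] := meeting_lift M uu.
  by move=> j nj; rewrite un// zw1.
set x := chart E1 u in uE.
have E1x : carrier E1 x by exact: carrier_chart.
have E2x : carrier E2 x by rewrite uE; exact: carrier_chart.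
have cx1 : coords E1 x = u by rewrite coords_chart.
have cx2 : coords E2 x = u' by rewrite uE coords_chart.
pose al := \sum_l `|a l - zz l| `^ p; pose be := \sum_l `|b l - zz l| `^ p.
pose ka := \sum_l `|(a l - b l) / 2| `^ p.
pose c1 := \sum_(j | j \notin codom f) `|coords E1 P 0 j - coords E1 z 0 j| `^ p.
pose c2 := \sum_(j | j \notin codom g) `|coords E2 Q 0 j - coords E2 z 0 j| `^ p.
have nf j : j \notin codom f -> forall l, j != f l.
  by move=> nj l; apply: contra nj => /eqP ->; exact: codom_f.
have ng j : j \notin codom g -> forall l, j != g l.
  by move=> nj l; apply: contra nj => /eqP ->; exact: codom_f.
have mPz : cell_mass p E1 P z = al + c1.
  by rewrite cell_mass.unlock (sum_split_image _ injf).
have mQz : cell_mass p E2 Q z = be + c2.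
  rewrite cell_mass.unlock (sum_split_image _ injg); congr (_ + _).
  by apply: eq_bigr => l _; rewrite zg -(flipB (ml l)) flipK.
have mPx : cell_mass p E1 P x = ka + c1.
  rewrite cell_mass.unlock (sum_split_image _ injf) cx1; congr (_ + _).
    apply: eq_bigr => l _; rewrite uf; congr (`|_| `^ _).
    by rewrite -/(a l); lra.
  by apply: eq_bigr => j nj; rewrite un//; exact: nf.
have mQx : cell_mass p E2 Q x = ka + c2.
  rewrite cell_mass.unlock (sum_split_image _ injg) cx2; congr (_ + _).
    apply: eq_bigr => l _; rewrite u'g uf -/ml -(flipB (ml l)) flipK distrC.
    by congr (`|_| `^ _); rewrite -/(b l); lra.
  apply: eq_bigr => j nj; rewrite u'n; last exact: ng.
  by rewrite zw2//; exact: ng.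
have r0 : 0 <= r by rewrite -rP cell_dist_ge0.
have rpP : r `^ p = al + c1 by rewrite -rP cell_distK.
have rpQ : r `^ p = be + c2 by rewrite -rQ cell_distK.
set X1 := cell_dist p E1 P x; set X2 := cell_dist p E2 Q x.
have X1p : X1 `^ p = ka + c1 by rewrite cell_distK.
have X2p : X2 `^ p = ka + c2 by rewrite cell_distK.
have X10 : 0 <= X1 by exact: cell_dist_ge0.
have X20 : 0 <= X2 by exact: cell_dist_ge0.
have short : 2 * r <= X1 + X2.
  apply: le_trans dPQ _; apply: (lp_dist_le_string).
  rewrite /X2 (cell_distC p E2); apply: string_step => //; exact: string_one.
(* The unmatched coordinates contribute [c1] and [c2] to both sides, so only the matched parts [al],
   [be] and [ka] remain to be compared. *)
have key : r `^ p <= (X1 `^ p + X2 `^ p) / 2.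
  have := powR_midpoint X1 X2 p1; rewrite (ger0_norm X10) (ger0_norm X20).
  apply: le_trans; apply: ler_powR2 => //; first exact: ltW.
  by rewrite ger0_norm; [lra|apply: divr_ge0 => //; exact: addr_ge0].
have kge : (al + be) / 2 <= ka by move: key; rewrite X1p X2p; lra.
have mean l : `|(a l - b l) / 2| `^ p <= (`|a l - zz l| `^ p + `|b l - zz l| `^ p) / 2.
  have := powR_midpoint (a l - zz l) (zz l - b l) p1.
  by rewrite addrA subrK (distrC (zz l)).
move=> l; apply/eqP; apply: contraT => ne; move: kge.
suff : ka < (al + be) / 2 by lra.
rewrite /al /be -big_split/= mulr_suml /ka (bigD1 l)//= [ltRHS](bigD1 l)//=.
apply: ltr_leD; last by apply: ler_sum => i _; exact: mean.
have := powR_midpoint_lt p1 (_ : a l - zz l != zz l - b l).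
rewrite addrA subrK (distrC (zz l)); apply; apply: contra ne => /eqP h.
by apply/eqP; rewrite -/(a l) -/(b l) -/(zz l); lra.
Qed.

Definition coord_on h E (i : 'I_(cell_dim E)) (b : bool) : Prop :=
  forall x, carrier E x -> h x = flip b (coords E x 0 i).

Arguments coord_on h E i b : clear implicits.

Lemma coord_on_lip p h E i b x y : 0 < p -> coord_on h E i b -> carrier E x -> carrier E y ->
  `|h x - h y| <= cell_dist p E x y.
Proof. by move=> p0 hE Ex Ey; rewrite !hE// flipB; exact: coord_le_cell_dist. Qed.

(** The line through y in direction i lies in E' as well, in some coordinate direction; h varies
    along it, so this direction is i'. *)
Lemma coord_link h E E' i b i' b' y : coord_on h E i b -> coord_on h E' i' b' ->
  carrier E y -> carrier E' y -> 0 < h y < 1 ->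
  forall t, 0 <= t <= 1 ->
    chart E (upd (coords E y) i t) = chart E' (upd (coords E' y) i' (flip (b (+) b') t)).
Proof.
move=> hE hE' Ey E'y hy.
have [|j [a [_ H]]] := interior_match Ey E'y (i := i); first by rewrite -(flip_int b) -hE.
have val t : 0 <= t <= 1 ->
    flip b t = flip b' (upd (coords E' y) j (flip a t) 0 i').
  move=> t01; have yu := coords_unit Ey; have y'u := coords_unit E'y.
  have t'01 : 0 <= flip a t <= 1 by rewrite flip01.
  have U := unit_cube_upd i yu t01; have U' := unit_cube_upd j y'u t'01.
  have := hE _ (carrier_chart U); rewrite coords_chart// H// hE'; last exact: carrier_chart.
  by rewrite coords_chart// [upd _ i _ _ _]updE eqxx.
have ij : i' = j.
  apply/eqP; apply: contraT => ne.
  have := val 0 (ltac:(lra)); have := val 1 (ltac:(lra)).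
  rewrite !updE (negPf ne) => <- /flip_inj; lra.
move: val H; rewrite -{}ij => val H.
have ab : a = b (+) b'.
  have := val 0 (ltac:(lra)); rewrite updE eqxx flip_flip => /esym/flip_eqb.
  rewrite eq_sym invr_eq0 pnatr_eq0 => /(_ isT) <-.
  by rewrite addbC addKb.
by rewrite -ab.
Qed.

(** The point y only certifies that h is a common direction of E1 and E2. The tension is taken at z,
    where h may be 0 or 1. *)
Lemma zero_tension_coord p h E1 E2 i1 b1 i2 b2 y z P Q r :
  1 < p -> coord_on h E1 i1 b1 -> coord_on h E2 i2 b2 ->
  carrier E1 y -> carrier E2 y -> 0 < h y < 1 ->
  carrier E1 z -> carrier E2 z -> carrier E1 P -> carrier E2 Q ->
  cell_dist p E1 P z = r -> cell_dist p E2 Q z = r -> 2 * r <= lp_dist X p P Q ->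
  h P + h Q = 2 * h z.
Proof.
move=> p1 h1 h2 E1y E2y hy E1z E2z E1P E2Q rP rQ dPQ.
have [w1 [w2 [k [f [g M]]]]] := meeting_ex E1y E2y.
have [|l i1l] := meeting_interior M E1y E2y (i := i1); first by rewrite -(flip_int b1) -h1.
have := zero_tension_meeting p1 M E1z E2z E1P E2Q rP rQ dPQ l.
set ml := meeting_flip _ _ _ _ _.
have link := coord_link h1 h2 E1y E2y hy.
have val t : 0 <= t <= 1 ->
    upd (coords E2 y) i2 (flip (b1 (+) b2) t) 0 (g l) = flip ml t.
  move=> t01; have U := unit_cube_upd i1 (coords_unit E1y) t01.
  have t'01 : 0 <= flip (b1 (+) b2) t <= 1 by rewrite flip01.
  have U' := unit_cube_upd i2 (coords_unit E2y) t'01.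
  have C1 := carrier_chart U; have C2 := carrier_chart U'; rewrite -link// in C2.
  have [_ _ /(_ l)] := meeting_chart M C1 C2.
  by rewrite coords_chart// link// coords_chart// -i1l [upd _ i1 _ _ _]updE eqxx.
have gl : g l = i2.
  apply/eqP; apply: contraT => ne.
  have := val 0 (ltac:(lra)); have := val 1 (ltac:(lra)).
  rewrite !updE (negPf ne) => -> /flip_inj; lra.
have mlE : b1 (+) b2 = ml.
  have := val 0 (ltac:(lra)); rewrite updE gl eqxx => /flip_eqb; apply.
  by rewrite eq_sym invr_eq0 pnatr_eq0.
rewrite -i1l gl -mlE (h1 P)// (h1 z)// (h2 Q)//.
by rewrite /flip; case: b1 {h1 link val mlE ml}; case: b2 {h2} => /=; lra.
Qed.

(** An interior coordinate at z extends to the star: [S] relates coordinates whose lines through z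
    coincide, with orientation, and [fnl] shows that related coordinates agree on common points, so
    that they glue to one function. *)
Lemma star_coord z E i : carrier E z -> 0 < coords E z 0 i < 1 ->
  exists h, coord_on h E i false /\
    forall E', carrier E' z -> exists i' b, coord_on h E' i' b.
Proof.
move=> Ez zi.
pose S E' i' b := carrier E' z /\ (forall t, 0 <= t <= 1 ->
   chart E (upd (coords E z) i t) = chart E' (upd (coords E' z) i' (flip b t))).
have fnl E1 E2 i1 i2 b1 b2 x : S E1 i1 b1 -> S E2 i2 b2 -> carrier E1 x -> carrier E2 x ->
    flip b1 (coords E1 x 0 i1) = flip b2 (coords E2 x 0 i2).
  move=> [E1z S1] [E2z S2] E1x E2x.
  have U1 t : 0 <= t <= 1 -> unit_cube (upd (coords E1 z) i1 (flip b1 t)).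
    by move=> t01; apply: unit_cube_upd; [exact: coords_unit|rewrite flip01].
  have U2 t : 0 <= t <= 1 -> unit_cube (upd (coords E2 z) i2 (flip b2 t)).
    by move=> t01; apply: unit_cube_upd; [exact: coords_unit|rewrite flip01].
  have z1 : coords E1 z 0 i1 = flip b1 (coords E z 0 i).
    have := S1 _ (coords_unit Ez i); rewrite upd_id chart_coords// => {1}->.
    by rewrite coords_chart ?updE ?eqxx//; apply: U1; exact: coords_unit.
  have [|j [a [H _]]] := interior_match E1z E2z (i := i1); first by rewrite z1 flip_int.
  have val t : 0 <= t <= 1 ->
      upd (coords E2 z) i2 (flip b2 t) 0 j = flip (a (+) b1) t.
    move=> t01; rewrite -(coords_chart (U2 t t01)) H.
    - by rewrite -S2// S1// (coords_chart (U1 t t01)) updE eqxx flip_flip.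
    - by rewrite -S2// S1//; exact/carrier_chart/U1.
    - exact/carrier_chart/U2.
  have ij : j = i2.
    apply/eqP; apply: contraT => ne.
    have := val 0 (ltac:(lra)); have := val 1 (ltac:(lra)).
    rewrite !updE (negPf ne) => -> /flip_inj; lra.
  have b2E : b2 = a (+) b1.
    have := val 0 (ltac:(lra)); rewrite updE ij eqxx => /flip_eqb; apply.
    by rewrite eq_sym invr_eq0 pnatr_eq0.
  by rewrite -ij H// b2E flip_flip addbAC addbb.
have SE : S E i false by split.
pose h x := xget 0 [set t | exists E' i' b,
  [/\ S E' i' b, carrier E' x & t = flip b (coords E' x 0 i')]].
have hE E' i' b : S E' i' b -> coord_on h E' i' b.
  move=> S' x E'x; rewrite /h; case: xgetP => [t _ [E2 [i2 [b2 [S2 E2x ->]]]]|].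
    exact: fnl S2 S' E2x E'x.
  by move=> /(_ (flip b (coords E' x 0 i')))[]; exists E', i', b.
exists h; split; first exact: hE.
move=> E' E'z; have [i' [b [_ H]]] := interior_match Ez E'z zi.
by exists i', b; apply: hE.
Qed.

(** Both functions vary along the same line through y, which determines the coordinate and the
    orientation on E'. *)
Lemma coord_on_unique h h' E E' i b i1 b1 i2 b2 y :
  coord_on h E i b -> coord_on h' E i b ->
  coord_on h E' i1 b1 -> coord_on h' E' i2 b2 ->
  carrier E y -> carrier E' y -> 0 < h y < 1 ->
  forall x, carrier E' x -> h x = h' x.
Proof.
move=> hE h'E hE' h'E' Ey E'y hy x E'x.
have h'y : 0 < h' y < 1 by rewrite h'E// -hE.
have link := coord_link hE hE' Ey E'y hy; have link' := coord_link h'E h'E' Ey E'y h'y.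
have val t : 0 <= t <= 1 -> upd (coords E' y) i1 (flip (b (+) b1) t) =
    upd (coords E' y) i2 (flip (b (+) b2) t).
  move=> t01; apply: (@chart_inj _ _ E').
  - by apply: unit_cube_upd; [exact: coords_unit|rewrite flip01].
  - by apply: unit_cube_upd; [exact: coords_unit|rewrite flip01].
  - by rewrite -link// -link'.
have ii : i1 = i2.
  apply/eqP; apply: contraT => ne.
  have := val 0 (ltac:(lra)); have := val 1 (ltac:(lra)).
  move=> /rowP/(_ i1) + /rowP/(_ i1).
  rewrite !updE eqxx (negPf ne) => <- /flip_inj; lra.
have bb : b1 = b2.
  have := val 0 (ltac:(lra)) => /rowP/(_ i1); rewrite !updE ii eqxx => /flip_eqb.
  rewrite eq_sym invr_eq0 pnatr_eq0 => /(_ isT) /(congr1 (addb b)).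
  by rewrite !addKb.
by rewrite hE'// h'E'// ii bb.
Qed.

End ZeroTension.

(** * Edges are geodesics *)

Arguments coord_on {R X} h E i b.

Section Edges.
Context {R : realType} {X : cube_complex R}.
Hypothesis conn : forall x y : points X, exists l, string_length 2 x y l.
Implicit Types (c E : cell X) (x y z w q : points X) (p s t e : R) (h : points X -> R).

(** As q lies in all cells at z, the distance to q inside a cell is a well-defined function on the
    star, and its increments are a lower bound to which [star_lower] applies. *)
Lemma star_dist p z e q E x : 1 < p -> star_radius z e ->
  (forall E', carrier E' z -> carrier E' q) -> carrier E z -> carrier E x ->
  cell_dist p E z x + cell_dist p E x q <= e -> lp_dist X p x q = cell_dist p E x q.
Proof.
move=> p1 ze zq Ez Ex le; have pn : p != 0 by rewrite gt_eqF//; lra.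
(* The value 0 outside the star is arbitrary. *)
pose rho a := match pselect (exists E', carrier E' z /\ carrier E' a) with
  | left H => cell_dist p (projT1 (cid H)) a q | right _ => 0 end.
have rhoE E' a : carrier E' z -> carrier E' a -> rho a = cell_dist p E' a q.
  move=> E'z E'a; rewrite /rho; case: pselect => [H|[]]; last by exists E'.
  case: (cid H) => /= E2 [E2z E2a]; apply: cell_dist_meet => //; exact: zq.
have rq : rho q = 0 by rewrite (rhoE E)// ?cell_dist_xx//; exact: zq.
apply/eqP; rewrite eq_le lp_dist_le_cell//=; last exact: zq.
rewrite -(rhoE _ _ Ez Ex) -[rho x]subr0 -rq.
apply: (@star_lower _ _ conn p z e p1 ze (fun a b => rho a - rho b) _ _ _ x q E) => //.
- by move=> a; rewrite subrr.
- by move=> a b a'; rewrite addrA subrK.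
- move=> E' a b E'z E'a E'b; rewrite !(rhoE E')// lerBlDr.
  exact: cell_dist_triangle.
- by rewrite rq subr0 (rhoE E).
Qed.

Definition cell_seg c x y t : points X := chart c ((1 - t) *: coords c x + t *: coords c y).

Lemma cell_seg_unit c x y t : carrier c x -> carrier c y -> 0 <= t <= 1 ->
  unit_cube ((1 - t) *: coords c x + t *: coords c y).
Proof. by move=> cx cy t01; apply: unit_cube_conv => //; exact: coords_unit. Qed.

Lemma carrier_seg c x y t : carrier c x -> carrier c y -> 0 <= t <= 1 ->
  carrier c (cell_seg c x y t).
Proof. by move=> *; apply/carrier_chart/cell_seg_unit. Qed.

Lemma coords_seg c x y t j : carrier c x -> carrier c y -> 0 <= t <= 1 ->
  coords c (cell_seg c x y t) 0 j = (1 - t) * coords c x 0 j + t * coords c y 0 j.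
Proof. by move=> *; rewrite coords_chart; [rewrite !mxE|exact: cell_seg_unit]. Qed.

Lemma cell_seg0 c x y : carrier c x -> cell_seg c x y 0 = x.
Proof. by move=> cx; rewrite /cell_seg subr0 scale1r scale0r addr0 chart_coords. Qed.

Lemma cell_seg1 c x y : carrier c y -> cell_seg c x y 1 = y.
Proof. by move=> cy; rewrite /cell_seg subrr scale1r scale0r add0r chart_coords. Qed.

Lemma cell_dist_seg p c x y s t : 0 < p -> carrier c x -> carrier c y ->
  0 <= s <= 1 -> 0 <= t <= 1 ->
  cell_dist p c (cell_seg c x y s) (cell_seg c x y t) = `|s - t| * cell_dist p c x y.
Proof.
move=> p0 cx cy s01 t01; rewrite !cell_dist.unlock !cell_mass.unlock.
rewrite -[X in X * _](@powRK _ p)// -powRM ?powR_ge0 ?psum_ge0// mulr_sumr.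
congr (_ `^ _); apply: eq_bigr => j _; rewrite !coords_seg// -powRM//.
by rewrite -normrM -[in RHS]normrN; congr (`|_| `^ _); ring.
Qed.

Definition edge c (u : 'rV[R]_(cell_dim c)) j (b : bool) t : points X :=
  chart c (upd u j (flip b t)).

Section Edge.
Variables (c : cell X) (u : 'rV[R]_(cell_dim c)) (j : 'I_(cell_dim c)) (b : bool).
Hypothesis uu : unit_cube u.
Let ed := edge u j b.

Lemma edge_unit t : 0 <= t <= 1 -> unit_cube (upd u j (flip b t)).
Proof. by move=> t01; apply: unit_cube_upd; rewrite ?flip01. Qed.

Lemma carrier_edge t : 0 <= t <= 1 -> carrier c (ed t).
Proof. by move=> t01; exact/carrier_chart/edge_unit. Qed.

Lemma coords_edge t : 0 <= t <= 1 -> coords c (ed t) = upd u j (flip b t).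
Proof. by move=> t01; rewrite coords_chart//; exact: edge_unit. Qed.

Lemma cell_dist_edge p s t : 0 < p -> 0 <= s <= 1 -> 0 <= t <= 1 ->
  cell_dist p c (ed s) (ed t) = `|s - t|.
Proof.
move=> p0 s01 t01; rewrite cell_dist.unlock cell_mass.unlock !coords_edge//.
rewrite (bigD1 j)//= big1 ?addr0 => [|i ij].
  by rewrite !updE eqxx flipB powRK.
by rewrite !updE (negPf ij) subrr normr0 powR0// gt_eqF.
Qed.

Lemma edge_match E t : 0 < t < 1 -> carrier E (ed t) ->
  exists i a, [/\ forall s, 0 <= s <= 1 -> ed s = chart E (upd (coords E (ed t)) i (flip a s)),
    forall s, 0 <= s <= 1 -> carrier E (ed s) &
    forall x, carrier c x -> carrier E x -> flip b (coords c x 0 j) = flip a (coords E x 0 i)].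
Proof.
move=> ti Et; have t01 : 0 <= t <= 1 by lra.
have ct := carrier_edge t01.
have [|i [a [H1 H2]]] := interior_match ct Et (i := j).
  by rewrite coords_edge// updE eqxx flip_int.
have H s : 0 <= s <= 1 -> ed s = chart E (upd (coords E (ed t)) i (flip (a (+) b) s)).
  move=> s01; have /H2 : 0 <= flip b s <= 1 by rewrite flip01.
  rewrite flip_flip => <-; congr (chart c _); rewrite coords_edge//.
  by apply/rowP => k; rewrite !updE; case: eqP.
exists i, (a (+) b); split => //.
  move=> s s01; rewrite H//; apply/carrier_chart/unit_cube_upd; last by rewrite flip01.
  exact: coords_unit.
by move=> x cx Ex; rewrite H1// flip_flip addbAC addbb.
Qed.

Hypothesis HC : CAT0_space (lp_dist X 2).

(** Around an interior point every cell of the star contains the whole edge, and [star_dist]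
    applies. At an end point the distances to that end point are known; the edge lies on one side of
    it, so the triangle inequality gives the rest. *)
Lemma edge_local_geodesic t : 0 <= t <= 1 -> exists2 r, 0 < r &
  forall s s', 0 <= s <= 1 -> 0 <= s' <= 1 ->
    `|s - t| < r -> `|s' - t| < r -> lp_dist X 2 (ed s) (ed s') = 1 * `|s - s'|.
Proof.
move=> t01; have [e ze] := star_radius_ex (ed t).
have e0 : 0 < e by case: ze => /andP[].
have p1 : 1 < 2 :> R by lra.
have p0 : 0 < 2 :> R by lra.
have ct := carrier_edge t01.
exists (e / 3); first by apply: divr_gt0.
move=> s s' s01 s'01 hs hs'; rewrite mul1r.
have cs := carrier_edge s01; have cs' := carrier_edge s'01.
have [ti|nti] := boolP (0 < t < 1).
  rewrite -(cell_dist_edge p0)//; apply: (star_dist p1 ze _ ct cs).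
    by move=> E Et; have [i [a [_ H _]]] := edge_match ti Et; exact: H.
  rewrite !cell_dist_edge// (distrC t).
  have : `|s - s'| <= `|s - t| + `|s' - t|.
    by rewrite (distrC s') -[leLHS](_ : `|(s - t) + (t - s')| = _) ?ler_normD// addrA subrK.
  lra.
have rad r : 0 <= r <= 1 -> `|r - t| < e / 3 -> lp_dist X 2 (ed t) (ed r) = `|r - t|.
  move=> r01 hr; have cr := carrier_edge r01.
  rewrite (distrC r) -(cell_dist_edge p0 t01 r01).
  apply/esym/(star_radial_cell conn p1 ze ct cr).
  apply: le_lt_trans (lp_dist_le_cell 2 ct cr) _; rewrite cell_dist_edge// distrC; lra.
apply/eqP; rewrite eq_le -{1}(cell_dist_edge p0 s01 s'01) lp_dist_le_cell//=.
have := dist_tri HC (ed t) (ed s) (ed s'); have := dist_tri HC (ed t) (ed s') (ed s).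
rewrite (distC HC (ed s') (ed s)) !rad//.
have [t0|t1] : t = 0 \/ t = 1.
  by move: nti; rewrite negb_and -!leNgt => /orP[h|h]; [left|right]; apply/eqP; rewrite eq_le h;
    by case/andP: t01 => h1 h2; rewrite ?h1 ?h2.
- have s0 : 0 <= s by lra.
  have s'0 : 0 <= s' by lra.
  by rewrite t0 !subr0 (ger0_norm s0) (ger0_norm s'0) => h1 h2; rewrite ler_norml; lra.
- have s1 : s - 1 <= 0 by lra.
  have s'1 : s' - 1 <= 0 by lra.
  by rewrite t1 (ler0_norm s1) (ler0_norm s'1) => h1 h2; rewrite ler_norml; lra.
Qed.

(** The whole edge has length 1 between its ends, and the three parts cut off by s and t are at most
    their parameter lengths, so none of them is shorter. *)
Lemma edge_unit_geodesic : unit_geodesic (lp_dist X 2) ed.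
Proof.
have L : lp_dist X 2 (ed 0) (ed 1) = 1.
  by apply: (local_geodesic_geodesic HC ler01) => t; exact: edge_local_geodesic.
have p0 : 0 < 2 :> R by lra.
have up s t : 0 <= s <= 1 -> 0 <= t <= 1 -> lp_dist X 2 (ed s) (ed t) <= `|s - t|.
  move=> s01 t01; rewrite -(cell_dist_edge p0 s01 t01).
  by apply: lp_dist_le_cell; exact: carrier_edge.
have le01 s t : 0 <= s -> s <= t -> t <= 1 -> lp_dist X 2 (ed s) (ed t) = t - s.
  move=> s0 st t1; have s01 : 0 <= s <= 1 by lra.
  have t01 : 0 <= t <= 1 by lra.
  have z01 : 0 <= (0 : R) <= 1 by lra.
  have o01 : 0 <= (1 : R) <= 1 by lra.
  have h1 := up _ _ s01 t01; have h2 := up _ _ z01 s01; have h3 := up _ _ t01 o01.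
  rewrite distrC ger0_norm ?subr_ge0// in h1.
  rewrite distrC subr0 ger0_norm// in h2; rewrite distrC ger0_norm ?subr_ge0// in h3.
  have := dist_tri HC (ed 0) (ed s) (ed 1); have := dist_tri HC (ed s) (ed t) (ed 1).
  by rewrite L => h4 h5; apply/eqP; rewrite eq_le; apply/andP; split; lra.
move=> s t /andP[s0 s1] /andP[t0 t1]; have [st|/ltW ts] := leP s t.
  by rewrite le01// distrC ger0_norm// subr_ge0.
by rewrite (distC HC) le01// ger0_norm// subr_ge0.
Qed.

End Edge.
End Edges.

(** * Projection to an edge *)

Lemma norm_le_small (R : realType) (x L r : R) : 0 <= L -> 0 < r ->
  (forall m, 0 < m -> m < r -> `|x| <= m * L) -> x = 0.
Proof.
move=> L0 r0 H; apply/eqP; rewrite -normr_eq0; apply/negPn/negP => xn.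
have x0 : 0 < `|x| by rewrite lt_neqAle eq_sym xn normr_ge0.
pose m := Num.min (r / 2) (`|x| / (2 * (L + 1))).
have L1 : 0 < 2 * (L + 1) by lra.
have m0 : 0 < m by rewrite /m lt_min !divr_gt0.
have mr : m < r by apply: (@le_lt_trans _ _ (r / 2)); [rewrite /m ge_min lexx|lra].
have := H m m0 mr; have : m * (2 * (L + 1)) <= `|x|.
  by rewrite -ler_pdivlMr// /m ge_min lexx orbT.
by have := mulr_ge0 (ltW m0) L0; lra.
Qed.

Section LocalCoordinate.
Context {R : realType} {X : cube_complex R}.
Hypothesis X_CAT0 : CAT0_cube_complex X.
Implicit Types (c E : cell X) (x y z w q : points X) (p s t e : R) (h f : points X -> R).

Let conn : forall x y : points X, exists l, string_length 2 x y l := proj1 X_CAT0.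
Let HC : CAT0_space (lp_dist X 2) := proj2 X_CAT0.
Local Notation d := (lp_dist X 2).
Let p1 : 1 < 2 :> R. Proof. by rewrite ltr1n. Qed.
Let p0 : 0 < 2 :> R. Proof. by rewrite ltr0n. Qed.

Definition star_coord_on h z : Prop :=
  forall E, carrier E z -> exists i b, coord_on h E i b.

(** The property that spreads from the edge along the geodesic to a point. h is a coordinate on all
    cells at z, while f is compared with it only in a ball. *)
Definition locally_coord f z : Prop :=
  exists h, [/\ star_coord_on h z, 0 < h z < 1 &
    exists2 r, 0 < r & forall x, d z x < r -> f x = h x].

Lemma star_coord_lip h z e x : star_radius z e -> star_coord_on h z -> d z x < e ->
  `|h z - h x| <= d z x.
Proof.
move=> ze hz /(star_radial conn p1 ze)[E [Ez Ex <-]].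
by have [i [b hE]] := hz E Ez; exact: coord_on_lip hE Ez Ex.
Qed.

(* h is affine along geodesics that stay near z, by the zero-tension condition. *)
Lemma star_coord_constant z e h a u g s1 r t' : star_radius z e -> star_coord_on h z ->
  geodesic d a u g -> 0 <= s1 < 1 -> 0 < r ->
  (forall s, s1 <= s <= 1 -> d z (g s) < e) -> 0 < t' < 1 ->
  (forall s, s1 <= s <= 1 -> s < s1 + r -> h (g s) = t') -> h u = t'.
Proof.
move=> ze hz [g0 g1 gd] /andP[s10 s11] r0 near t'01 init.
have L0 := dist_ge0 HC a u.
have sub y E : d z y < e -> carrier E y -> carrier E z.
  by move=> yd; exact: (star_ball_cell conn p1 ze yd).
rewrite -g1.
suff H s : s1 <= s <= 1 -> h (g s) = t' by apply: H; rewrite lexx ltW.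
move: s; apply: interval_ind; first exact: ltW.
- by apply: init; rewrite ?lexx ?(ltW s11)//; lra.
- move=> s /andP[s1s ss1] H; have [<-|ne] := eqVneq s1 s.
    by exists r => // t st ts t1; apply: init; rewrite ?st.
  have s1s' : s1 < s by rewrite lt_neqAle ne.
  have [e' ye] := star_radius_ex (g s).
  have e'0 : 0 < e' by case: ye => /andP[].
  have dy : d z (g s) < e by apply: near; lra.
  have L1 : 0 < d a u + 1 by lra.
  exists (Num.min (s - s1) (Num.min (1 - s) (e' / (d a u + 1)))).
    by rewrite !lt_min !subr_gt0 s1s' ss1 divr_gt0.
  move=> t st; rewrite -ltrBlDl !lt_min => /and3P[m1 m2 m3] t1.
  rewrite ltr_pdivlMr// in m3.
  pose m := t - s; have m0 : 0 <= m by rewrite subr_ge0.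
  have mL : m * d a u < e'.
    by apply: le_lt_trans m3; rewrite -/m ler_wpM2l//; lra.
  have dP : d (g s) (g (s - m)) = m * d a u.
    by rewrite gd ?subKr ?(ger0_norm m0)//; rewrite /m; lra.
  have dQ : d (g s) (g t) = m * d a u.
    by rewrite gd; [rewrite distrC -/m (ger0_norm m0)|lra|lra].
  have dPQ : d (g (s - m)) (g t) = 2 * (m * d a u).
    rewrite gd; [|rewrite /m; lra|lra]; rewrite mulrA; congr (_ * _).
    by rewrite (_ : s - m - t = - (2 * m)) ?normrN ?ger0_norm//; [lra|rewrite /m; ring].
  have [E1 [E1y E1P E1d]] := star_radial conn p1 ye (ltac:(rewrite dP//) : d (g s) (g (s - m)) < e').
  have [E2 [E2y E2Q E2d]] := star_radial conn p1 ye (ltac:(rewrite dQ//) : d (g s) (g t) < e').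
  have [i1 [b1 h1]] := hz _ (sub _ _ dy E1y).
  have [i2 [b2 h2]] := hz _ (sub _ _ dy E2y).
  have hy : h (g s) = t' by apply: H; rewrite lexx ltW.
  have hP : h (g (s - m)) = t' by apply: H; rewrite /m; lra.
  have c1 : cell_dist 2 E1 (g (s - m)) (g s) = m * d a u by rewrite cell_distC E1d.
  have c2 : cell_dist 2 E2 (g t) (g s) = m * d a u by rewrite cell_distC E2d.
  have hy01 : 0 < h (g s) < 1 by rewrite hy.
  have dle : 2 * (m * d a u) <= d (g (s - m)) (g t) by rewrite dPQ.
  (* h equals t' at g s and at g (s - m), hence also at g t, which lies at the same distance on the
     other side of g s. *)
  have := zero_tension_coord p1 h1 h2 E1y E2y hy01 E1y E2y E1P E2Q c1 c2 dle.
  by rewrite hy hP; lra.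
- move=> s /andP[s1s ss1] H.
  have [e' ye] := star_radius_ex (g s).
  have e'0 : 0 < e' by case: ye => /andP[].
  have dy : d z (g s) < e by apply: near; lra.
  have L1 : 0 < d a u + 1 by lra.
  apply/eqP; rewrite -subr_eq0; apply/eqP.
  apply: (@norm_le_small _ _ (d a u) (Num.min (s - s1) (e' / (d a u + 1)))) => //.
    by rewrite lt_min subr_gt0 s1s divr_gt0.
  move=> m m0; rewrite lt_min => /andP[ms]; rewrite ltr_pdivlMr// => me.
  have <- : h (g (s - m)) = t' by apply: H; lra.
  have dP : d (g s) (g (s - m)) = m * d a u.
    by rewrite gd ?subKr ?gtr0_norm//; lra.
  rewrite -dP; apply: (star_coord_lip ye).
    by move=> E /(sub _ _ dy); exact: hz.
  by rewrite dP; apply: le_lt_trans me; rewrite ler_wpM2l//; lra.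
Qed.

Lemma locally_coord_open f z : locally_coord f z ->
  exists2 r, 0 < r & forall y, d z y < r -> locally_coord f y.
Proof.
move=> [h [hz hz01 [r r0 fh]]]; have [e ze] := star_radius_ex z.
have e0 : 0 < e by case: ze => /andP[].
pose m := Num.min (Num.min e r) (Num.min (h z) (1 - h z)).
exists m; first by rewrite !lt_min e0 r0; lra.
move=> y; rewrite !lt_min => /andP[/andP[ye yr] /andP[yh yh']].
exists h; split.
- by move=> E Ey; apply: hz; exact: (star_ball_cell conn p1 ze ye Ey).
- by have := star_coord_lip ze hz ye; rewrite ler_norml; lra.
- exists (r - d z y); first by rewrite subr_gt0.
  by move=> x yx; apply: fh; have := dist_tri HC z y x; lra.
Qed.

Section ProjectionToEdge.
Variables (c : cell X) (u : 'rV[R]_(cell_dim c)) (j : 'I_(cell_dim c)) (b : bool).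
Hypothesis uu : unit_cube u.
Let ed := edge u j b.
Let f := edge_proj d (ed 0) (ed 1).
Let ue : unit_geodesic d ed := edge_unit_geodesic conn j b uu HC.

Lemma cell_mass_upd E x z i t : carrier E x -> carrier E z -> 0 <= t <= 1 ->
  cell_mass 2 E x (chart E (upd (coords E z) i t)) =
  \sum_(k | k != i) `|coords E x 0 k - coords E z 0 k| `^ 2 + (coords E x 0 i - t) ^+ 2.
Proof.
move=> Ex Ez t01; rewrite cell_mass.unlock coords_chart; last first.
  by apply: unit_cube_upd => //; exact: coords_unit.
rewrite (bigD1 i)//= updE eqxx addrC (powR_mulrn 2)// sqr_normr; congr (_ + _).
by apply: eq_bigr => k ki; rewrite updE (negPf ki).
Qed.

(** Near z the squared distance from x to the point of the edge with parameter s is a constant plus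
    (h x - s)^2, so the foot of x has parameter h x. *)
Lemma locally_coord_on_edge t : 0 < t < 1 -> locally_coord f (ed t).
Proof.
move=> ti; have t01 : 0 <= t <= 1 by lra.
set z := ed t; have cz : carrier c z := carrier_edge j b uu t01.
have [e ze] := star_radius_ex z; have e0 : 0 < e by case: ze => /andP[].
have zj : 0 < coords c z 0 j < 1 by rewrite (coords_edge j b uu t01) updE eqxx flip_int.
have [h0 [h0c h0z]] := star_coord cz zj.
pose h x := flip b (h0 x).
have hE E : carrier E z -> exists i a, [/\ coord_on h E i a,
    forall s, 0 <= s <= 1 -> ed s = chart E (upd (coords E z) i (flip a s)) &
    forall s, 0 <= s <= 1 -> carrier E (ed s)].
  move=> Ez; have [i [a [ha1 ha2 ha3]]] := edge_match uu ti Ez.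
  have [i' [b' hE]] := h0z E Ez.
  have hE' : coord_on h E i' (b (+) b') by move=> x Ex; rewrite /h hE// flip_flip.
  have hc : coord_on h c j b by move=> x cx; rewrite /h h0c.
  have hz : 0 < h z < 1 by rewrite hc// flip_int.
  exists i, a; split => // x Ex; rewrite hE'//.
  have link := coord_link hc hE' cz Ez hz.
  have val s : 0 <= s <= 1 ->
      upd (coords E z) i (flip a s) = upd (coords E z) i' (flip (b (+) (b (+) b')) (flip b s)).
    move=> s01; have s'01 : 0 <= flip b s <= 1 by rewrite flip01.
    apply: (@chart_inj _ _ E).
    - by apply: unit_cube_upd; [exact: coords_unit|rewrite flip01].
    - by apply: unit_cube_upd; [exact: coords_unit|rewrite flip01].
    - rewrite -ha1// -link//; congr (chart c _); rewrite (coords_edge j b uu t01).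
      by apply/rowP => k; rewrite !updE; case: eqP.
  have ii : i = i'.
    apply/eqP; apply: contraT => ne.
    have := val 0 (ltac:(lra)); have := val 1 (ltac:(lra)).
    move=> /rowP/(_ i) + /rowP/(_ i).
    rewrite !updE eqxx (negPf ne) => <- /flip_inj; lra.
  have := val 0 (ltac:(lra)) => /rowP/(_ i).
  rewrite !updE -ii eqxx flip_flip => /flip_eqb.
  rewrite eq_sym invr_eq0 pnatr_eq0 => /(_ isT) ->.
  by rewrite addKb addbC.
have hst : star_coord_on h z by move=> E /hE[i [a [? _ _]]]; exists i, a.
have hz : h z = t.
  have [i [a [hc _ _]]] := hE c cz; rewrite /h h0c// (coords_edge j b uu t01).
  by rewrite updE eqxx flipK.
exists h; split; rewrite ?hz//.
(* The distance of x and the displacement of its foot are both kept below e / 4, which leaves room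
   for the condition of [star_dist]. *)
have [r' r'0 fr'] := edge_proj_cont HC ue z (ltac:(apply: divr_gt0 => //) : 0 < e / 4).
pose m := Num.min (Num.min (e / 4) r') (Num.min t (1 - t)).
exists m; first by rewrite !lt_min divr_gt0// r'0; lra.
move=> x; rewrite !lt_min => /andP[/andP[x1 x2] /andP[x3 x4]].
have xe : d z x < e by lra.
have [E [Ez Ex Ed]] := star_radial conn p1 ze xe.
have [i [a [hEi eE Ee]]] := hE E Ez.
have hx := star_coord_lip ze hst xe; rewrite hz ler_norml in hx.
have hx01 : 0 <= h x <= 1 by lra.
have f01 := edge_proj01 HC ue x; rewrite -/f in f01.
have fz : f z = t by rewrite /f edge_proj_on.
have fx := fr' x x2; rewrite -/f fz in fx.
have zc E' : carrier E' z -> carrier E' (ed (f x)).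
  by move=> E'z; have [? [? [_ _ H]]] := hE E' E'z; exact: H.
have fh : cell_dist 2 E x (ed (f x)) <= cell_dist 2 E x z + `|t - f x|.
  apply: le_trans (cell_dist_triangle E _ z _ p1) _; rewrite lerD2l.
  rewrite -(cell_dist_edge j b uu p0 t01 f01) (@cell_dist_meet _ _ 2 c E)//.
  - by rewrite gt_eqF.
  - exact: carrier_edge.
  - exact: zc.
have dxf : d x (ed (f x)) = cell_dist 2 E x (ed (f x)).
  apply: (star_dist conn p1 ze zc Ez Ex).
  by move: fh; rewrite (cell_distC 2 E x z) Ed; lra.
have dxh : d x (ed (h x)) <= cell_dist 2 E x (ed (h x)) by apply: lp_dist_le_cell => //; exact: Ee.
have [_ /(_ (h x) hx01)] := edge_proj_is_proj HC ue x; rewrite -/f dxf.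
move=> /le_trans/(_ dxh).
rewrite -(ler_powR2E p0) ?cell_dist_ge0// !cell_distK// !eE//.
have fa01 : 0 <= flip a (f x) <= 1 by rewrite flip01.
have ha01 : 0 <= flip a (h x) <= 1 by rewrite flip01.
rewrite (cell_mass_upd i Ex Ez fa01) (cell_mass_upd i Ex Ez ha01) lerD2l.
rewrite (_ : coords E x 0 i = flip a (h x)); last by rewrite hEi// flipK.
rewrite subrr expr0n/= -sqr_normr flipB sqr_normr => h2.
by apply/esym/eqP; rewrite -subr_eq0 -sqrf_eq0 eq_le h2 sqr_ge0.
Qed.

(** The geodesic g' from the foot of x to x stays close to g. Beyond s1 it first runs through the
    ball where f = h, and f is constant along it; [star_coord_constant] then keeps h at this
    constant up to x. *)
Lemma edge_proj_near_geodesic y0 e h g a x g' s1 r : star_radius y0 e ->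
  star_coord_on h y0 -> geodesic d a y0 g -> geodesic d (ed (f x)) x g' ->
  0 <= s1 < 1 -> 0 < r <= e / 2 -> 0 < f x < 1 ->
  (forall t, s1 <= t <= 1 -> d y0 (g t) <= e / 2) ->
  (forall t, 0 <= t <= 1 -> d (g t) (g' t) < r / 2) ->
  (forall w, d (g s1) w < r -> f w = h w) -> f x = h x.
Proof.
move=> ye hs [_ _ gd] g'x /andP[s10 s11] /andP[r0 re] fx near close fh.
have L0 := dist_ge0 HC a y0; set L := d a y0 in gd L0.
have L1 : 0 < 2 * (L + 1) by lra.
have rL : 0 < r / (2 * (L + 1)) by rewrite divr_gt0.
have s1b : 0 <= s1 < 1 by rewrite s10.
symmetry; apply: (star_coord_constant ye hs g'x s1b rL) => //.
  move=> t t1; have t01 : 0 <= t <= 1 by lra.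
  have := close t t01; have := near _ t1; have := dist_tri HC y0 (g t) (g' t).
  by move=> {near close fh gd fx}; lra.
move=> t /andP[t1 t2] t3; have t0 : 0 <= t by exact: le_trans t1.
have t01 : 0 <= t <= 1 by rewrite t0.
rewrite -fh; first by apply: (edge_proj_geodesic HC ue g'x).
have := close t t01; have := dist_tri HC (g s1) (g t) (g' t).
rewrite gd ?s10 ?(ltW s11)// distrC ger0_norm ?subr_ge0//.
move: t3; rewrite -ltrBlDl ltr_pdivlMr//.
have : 0 <= t - s1 by rewrite subr_ge0.
by move=> {near close fh gd fx}; lra.
Qed.

(** The closed step of the induction. At a point y of g close to z, f is a coordinate of the star of
    y. This coordinate extends to the star of z, and for x near z the geodesic from its foot enters
    the region near y where f is known. *)
Lemma edge_proj_coord_limit z g : 0 < f z < 1 -> geodesic d (ed (f z)) z g ->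
  (forall t, 0 <= t < 1 -> locally_coord f (g t)) -> locally_coord f z.
Proof.
move=> fz gz H; have [g0 g1 gd] := gz; set L := d (ed (f z)) z in gd.
have L0 : 0 <= L by exact: dist_ge0.
have [e ze] := star_radius_ex z; have e0 : 0 < e by case: ze => /andP[].
pose k := Num.min (Num.min (e / 2) (f z)) (1 - f z).
have k0 : 0 < k by rewrite !lt_min divr_gt0//; lra.
have [ke kf kf'] : [/\ k <= e / 2, k <= f z & k <= 1 - f z].
  by rewrite /k !ge_min !lexx !orbT.
have L1 : 0 < 2 * (L + 1) by lra.
pose m := Num.min 1 (k / (2 * (L + 1))).
have m0 : 0 < m by rewrite lt_min ltr01 divr_gt0.
have m1 : m <= 1 by rewrite /m ge_min lexx.
have mL : m * L < k.
  have : m * (2 * (L + 1)) <= k by rewrite -ler_pdivlMr// /m ge_min lexx orbT.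
  by have := mulr_ge0 (ltW m0) L0; lra.
pose s := 1 - m; set y := g s.
have s01 : 0 <= s < 1 by rewrite /s; lra.
have s01' : 0 <= s <= 1 by rewrite /s; lra.
have near t : s <= t <= 1 -> d z (g t) <= m * L.
  move=> /andP[t1 t2]; rewrite -g1 gd; [|by rewrite ler01 lexx|rewrite /s in t1; lra].
  by rewrite ler_wpM2r// ger0_norm ?subr_ge0//; rewrite /s in t1; lra.
have dzy : d z y <= m * L by apply: near; rewrite lexx; case/andP: s01' => _ ->.
have dze : d z y < e by lra.
have [h2 [h2s h2y [r2 r20 fh2]]] := H s s01; rewrite -/y in h2s h2y fh2.
have h2y2 : h2 y = f z.
  by rewrite -fh2 ?dist_xx//; exact: (edge_proj_geodesic HC ue gz).
have [E [Ez Ey Ed]] := star_radial conn p1 ze dze.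
have [i [a hEi]] := h2s E Ey.
(* At y this coordinate has the value f z, up to reversal, and z is within k of y, where k is at
   most f z and 1 - f z. *)
have zi : 0 < coords E z 0 i < 1.
  have := @coord_le_cell_dist _ _ 2 E z y i p0; rewrite Ed.
  have := hEi _ Ey; rewrite h2y2 ler_norml.
  by rewrite /flip; case: a {hEi} => {near gd H fh2}; lra.
have [h0 [h0E h0s]] := star_coord Ez zi.
pose h x := flip a (h0 x).
have hE : coord_on h E i a by move=> x Ex; rewrite /h h0E.
have hs : star_coord_on h z.
  by move=> E' /h0s[i' [b' H']]; exists i', (a (+) b') => x Ex; rewrite /h H'// flip_flip.
have hh2 E' x : carrier E' y -> carrier E' x -> h2 x = h x.
  move=> E'y E'x; have [i1 [b1 h1]] := h2s E' E'y.
  have [i3 [b3 h3]] := hs E' (star_ball_cell conn p1 ze dze E'y).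
  by apply: (coord_on_unique hEi hE h1 h3 Ey E'y) => //; rewrite h2y2.
exists h; split; [by []|by rewrite hE// flip_int|].
have [e2 ye] := star_radius_ex y; have e20 : 0 < e2 by case: ye => /andP[].
have {}near t : s <= t <= 1 -> d z (g t) <= e / 2 by move=> /near; lra.
clear mL m0 k0 kf kf' ke h2y zi Ed dzy dze L1 m1.
pose r := Num.min (Num.min r2 e2) (e / 2).
have r0 : 0 < r by rewrite !lt_min r20 e20 divr_gt0.
have [rr2 re2 re] : [/\ r <= r2, r <= e2 & r <= e / 2] by rewrite /r !ge_min !lexx !orbT.
pose w := Num.min (r / 2) (Num.min (f z) (1 - f z)).
have [w1 w2 w3] : [/\ w <= r / 2, w <= f z & w <= 1 - f z].
  by rewrite /w !ge_min !lexx !orbT.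
have w0 : 0 < w by rewrite !lt_min divr_gt0//; case/andP: fz => -> ?; rewrite subr_gt0.
have [r4 r40 fr4] := edge_proj_cont HC ue z w0.
exists (Num.min (r / 2) r4); first by rewrite lt_min divr_gt0.
move=> x; rewrite lt_min => /andP[x1 x2].
have fx := fr4 x x2; rewrite -/f in fx.
have [g' g'x] := geod_ex HC (ed (f x)) x.
have f01x := edge_proj01 HC ue x; have f01z := edge_proj01 HC ue z.
have fz_fx : d (ed (f z)) (ed (f x)) < r / 2 by rewrite ue//; exact: lt_le_trans fx w1.
have r0e : 0 < r <= e / 2 by rewrite r0.
apply: (edge_proj_near_geodesic ze hs gz g'x s01 r0e _ near).
- by move: fx; rewrite ltr_norml => {near gd H fh2}; lra.
- move=> t /andP[t0 t1]; have t01 : 0 <= t <= 1 by rewrite t0.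
  have t1' : 0 <= 1 - t by rewrite subr_ge0.
  have := geod_convex HC gz g'x t01.
  have := ler_wpM2l t0 (ltW x1); have := ler_wpM2l t1' (ltW fz_fx).
  have [->|tn0] := eqVneq t 0; first by rewrite !mul0r !subr0 !mul1r => *; lra.
  have tp : 0 < t by rewrite lt_neqAle eq_sym tn0.
  by have := x1; rewrite -(ltr_pM2l tp) => {near gd H fh2}; lra.
- move=> q yq; have [E' [E'y E'q _]] := star_radial conn p1 ye (lt_le_trans yq re2).
  by rewrite -(hh2 E')// fh2//; exact: lt_le_trans yq rr2.
Qed.

Lemma edge_proj_locally_coord z : 0 < f z < 1 -> locally_coord f z.
Proof.
move=> fz; have [g gz] := geod_ex HC (ed (f z)) z.
have [g0 g1 gd] := gz; set L := d (ed (f z)) z in gd.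
have L0 : 0 <= L by exact: dist_ge0.
have fg s : 0 <= s <= 1 -> f (g s) = f z by exact: edge_proj_geodesic.
rewrite -g1; suff H s : 0 <= s <= 1 -> locally_coord f (g s) by apply: H; rewrite lexx ler01.
move: s; apply: interval_ind => //.
- by rewrite g0; exact: locally_coord_on_edge.
- move=> s /andP[s0 s1] H; have [|r r0 Hr] := @locally_coord_open f (g s).
    by apply: H; rewrite s0 lexx.
  have L1 : 0 < L + 1 by lra.
  exists (r / (L + 1)); first by rewrite divr_gt0.
  move=> t st tr t1; apply: Hr; rewrite gd; [|lra|lra].
  rewrite -ltrBlDl ltr_pdivlMr// in tr; rewrite distrC ger0_norm ?subr_ge0//.
  by apply: le_lt_trans tr; rewrite ler_wpM2l ?subr_ge0//; lra.
- move=> s /andP[s0 s1] H; have s01 : 0 <= s <= 1 by rewrite (ltW s0).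
  apply: (@edge_proj_coord_limit (g s) (fun t => g (s * t))).
  + by rewrite fg.
  + by rewrite fg//; exact: (geod_sub gz s01).
  + move=> t /andP[t0 t1]; apply: H; rewrite mulr_ge0 ?(ltW s0)//=.
    by rewrite gtr_pMr// t1.
Qed.

End ProjectionToEdge.
End LocalCoordinate.

(** * Edge projections on whole cells *)

Section Hyperplanes.
Context {R : realType} {X : cube_complex R}.
Hypothesis X_CAT0 : CAT0_cube_complex X.
Implicit Types (c E : cell X) (v x y z w q : points X) (p s t e : R) (h f : points X -> R).

Let conn : forall x y : points X, exists l, string_length 2 x y l := proj1 X_CAT0.
Let HC : CAT0_space (lp_dist X 2) := proj2 X_CAT0.
Local Notation d := (lp_dist X 2).
Let p1 : 1 < 2 :> R. Proof. by rewrite ltr1n. Qed.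
Let i01 : 0 <= (0 : R) <= 1. Proof. by rewrite lexx ler01. Qed.
Let i11 : 0 <= (1 : R) <= 1. Proof. by rewrite lexx ler01. Qed.
Let ihh : 0 <= (2^-1 : R) <= 1. Proof. by lra. Qed.

(** Moving the i-th coordinate alone reveals both the index and the orientation. *)
Lemma coord_formula_unique E x r i j a b : carrier E x -> 0 < coords E x 0 i < 1 -> 0 < r ->
  (forall y, carrier E y -> cell_dist 2 E x y < r ->
     flip a (coords E y 0 i) = flip b (coords E y 0 j)) -> i = j /\ a = b.
Proof.
move=> Ex /andP[xi0 xi1] r0 H.
pose m := Num.min (r / 2) ((1 - coords E x 0 i) / 2).
have m0 : 0 < m by rewrite lt_min !divr_gt0// subr_gt0.
have [mr mx] : m < r /\ coords E x 0 i + m < 1.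
  have [m1 m2] : m <= r / 2 /\ m <= (1 - coords E x 0 i) / 2.
    by rewrite /m !ge_min !lexx !orbT.
  by split; lra.
pose ed := edge (coords E x) i false.
have xu := coords_unit Ex.
have x01 : 0 <= coords E x 0 i <= 1 by exact: xu.
have y01 : 0 <= coords E x 0 i + m <= 1 by lra.
have xE : x = ed (coords E x 0 i) by rewrite /ed /edge upd_id chart_coords.
have Ey := carrier_edge i false xu y01; rewrite -/ed in Ey.
have Cy := coords_edge i false xu y01; rewrite -/ed in Cy.
have := H x Ex; rewrite cell_dist_xx ?gt_eqF// => /(_ r0) Hx.
have := H _ Ey; rewrite {1}xE cell_dist_edge// opprD addrA subrr sub0r normrN gtr0_norm//.
move=> /(_ mr); rewrite Cy !updE eqxx => Hy.
have [ij|ne] := eqVneq i j; last first.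
  by exfalso; move: Hx Hy; rewrite eq_sym (negPf ne) /flip; case: (a); case: (b); lra.
split => //; move: Hx Hy; rewrite ij eqxx /flip.
by case: (a); case: (b) => //; lra.
Qed.

Section ProjectionOnCells.
Variables (c : cell X) (u : 'rV[R]_(cell_dim c)) (j : 'I_(cell_dim c)) (b : bool).
Hypothesis uu : unit_cube u.
Let ed := edge u j b.
Let f := edge_proj d (ed 0) (ed 1).
Let ue : unit_geodesic d ed := edge_unit_geodesic conn j b uu HC.

Lemma edge_proj_cell_cont E x r : carrier E x -> 0 < r -> exists2 r', 0 < r' &
  forall y, carrier E y -> cell_dist 2 E x y < r' -> `|f x - f y| < r.
Proof.
move=> Ex r0; have [r' r'0 H] := edge_proj_cont HC ue x r0.
exists r' => // y Ey xy; apply: H; apply: le_lt_trans xy; exact: lp_dist_le_cell.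
Qed.

Lemma edge_proj_cell_local E x : carrier E x -> 0 < f x < 1 -> exists i a,
  exists2 r, 0 < r & forall y, carrier E y -> cell_dist 2 E x y < r ->
    f y = flip a (coords E y 0 i).
Proof.
move=> Ex fx; have [h [hs _ [r r0 fh]]] := edge_proj_locally_coord X_CAT0 uu fx.
have [i [a hE]] := hs E Ex; exists i, a, r => // y Ey xy.
by rewrite -hE//; apply: fh; apply: le_lt_trans xy; exact: lp_dist_le_cell.
Qed.

Let seg_near E x y s r : carrier E x -> carrier E y -> 0 <= s <= 1 -> 0 < r ->
  exists2 m, 0 < m & forall t, 0 <= t <= 1 -> `|s - t| < m ->
    cell_dist 2 E (cell_seg E x y s) (cell_seg E x y t) < r.
Proof.
move=> Ex Ey s01 r0; have D0 := cell_dist_ge0 2 E x y.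
have D1 : 0 < cell_dist 2 E x y + 1 by lra.
exists (r / (cell_dist 2 E x y + 1)); first by rewrite divr_gt0.
move=> t t01; rewrite cell_dist_seg// ltr_pdivlMr// => H.
by apply: le_lt_trans H; rewrite ler_wpM2l// lerDl.
Qed.

Let seg_left E x y s r : carrier E x -> carrier E y -> 0 < s <= 1 -> 0 < r ->
  exists2 t, 0 <= t < s & cell_dist 2 E (cell_seg E x y s) (cell_seg E x y t) < r.
Proof.
move=> Ex Ey /andP[s0 s1] r0; have s01 : 0 <= s <= 1 by rewrite (ltW s0).
have [m m0 near] := seg_near Ex Ey s01 r0; have [t ts tm] := left_near s0 m0.
exists t => //; apply: near; first by case/andP: ts => -> /ltW/le_trans ->.
by rewrite ger0_norm// subr_ge0 ltW//; case/andP: ts.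
Qed.

Lemma edge_proj_coord_closed E y i a : carrier E y ->
  (forall r, 0 < r -> exists z, [/\ carrier E z, cell_dist 2 E y z < r &
     f z = flip a (coords E z 0 i)]) -> f y = flip a (coords E y 0 i).
Proof.
move=> Ey H; apply/eqP; rewrite -subr_eq0 -normr_eq0; apply/negPn/negP => ne.
set D := `|_| in ne; have D0 : 0 < D by rewrite lt_neqAle eq_sym ne normr_ge0.
have D2 : 0 < D / 2 by rewrite divr_gt0.
have [r' r'0 fc] := edge_proj_cell_cont Ey D2.
have [|z [Ez + fz]] := H (Num.min r' (D / 2)); first by rewrite lt_min r'0 D2.
rewrite lt_min => /andP[n1 n2]; have n3 := fc _ Ez n1; rewrite fz in n3.
have n4 : `|flip a (coords E y 0 i) - flip a (coords E z 0 i)| < D / 2.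
  by rewrite flipB; apply: le_lt_trans n2; exact: coord_le_cell_dist.
have := ler_distD (flip a (coords E z 0 i)) (f y) (flip a (coords E y 0 i)).
by rewrite -/D; move: n3 n4; rewrite [X in _ -> X < _ -> _]distrC {fc H fz}; lra.
Qed.

(* If f is a coordinate near x, it remains so along any segment on which this
   coordinate is interior. *)
Lemma edge_proj_coord E x : carrier E x -> 0 < f x < 1 -> exists i a, coord_on f E i a.
Proof.
move=> Ex fx; have [i [a [r r0 fr]]] := edge_proj_cell_local Ex fx.
have fxE : f x = flip a (coords E x 0 i) by apply: fr => //; rewrite cell_dist_xx ?gt_eqF.
have /andP[x0 x1] : 0 < coords E x 0 i < 1 by rewrite -(flip_int a) -fxE.
have seg_int y t : carrier E y -> 0 <= t < 1 -> 0 < coords E (cell_seg E x y t) 0 i < 1.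
  move=> Ey /andP[t0 t1]; rewrite coords_seg ?t0 ?(ltW t1)//.
  have t1' : 0 < 1 - t by rewrite subr_gt0.
  have /andP[y0 y1] := coords_unit Ey i; have := mulr_gt0 t1' x0.
  have := mulr_ge0 t0 y0; have := ler_wpM2l t0 y1.
  have : (1 - t) * coords E x 0 i < (1 - t) * 1 by rewrite ltr_pM2l.
  by move=> {fr fxE fx}; lra.
exists i, a.
have inner y : carrier E y -> 0 < coords E y 0 i < 1 -> f y = flip a (coords E y 0 i).
  move=> Ey yi; pose sg := cell_seg E x y.
  have Es t : 0 <= t <= 1 -> carrier E (sg t) by exact: carrier_seg.
  have si t : 0 <= t <= 1 -> 0 < coords E (sg t) 0 i < 1.
    move=> /andP[t0]; rewrite le_eqVlt => /predU1P[->|t1]; first by rewrite /sg cell_seg1.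
    by apply: seg_int; rewrite ?t0.
  pose Q t := exists2 r, 0 < r & forall y', carrier E y' -> cell_dist 2 E (sg t) y' < r ->
    f y' = flip a (coords E y' 0 i).
  have Qval t : 0 <= t <= 1 -> Q t -> f (sg t) = flip a (coords E (sg t) 0 i).
    by move=> t01 [r' r'0 H]; apply: H; [exact: Es|rewrite cell_dist_xx ?gt_eqF].
  suff H t : 0 <= t <= 1 -> Q t.
    by have := Qval 1 i11 (H 1 i11); rewrite /sg cell_seg1.
  move: t; apply: interval_ind => //; first by rewrite /Q /sg cell_seg0//; exists r.
  - move=> s /andP[s0 s1] /(_ s); rewrite s0 lexx => /(_ isT)[r' r'0 H].
    have s01 : 0 <= s <= 1 by rewrite s0 ltW.
    have [m m0 near] := seg_near Ex Ey s01 (ltac:(apply: divr_gt0 => //) : 0 < r' / 2).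
    exists m => // t st tm t1; have t01 : 0 <= t <= 1 by rewrite (le_trans s0 st).
    exists (r' / 2); first by rewrite divr_gt0.
    move=> y' Ey' y'r; apply: H => //.
    apply: le_lt_trans (cell_dist_triangle E _ (sg t) _ p1) _.
    have := near t t01; rewrite ler0_norm ?subr_le0// opprB.
    by rewrite ltrBlDl => /(_ tm) N; rewrite (splitr r') ltrD.
  - move=> s ss H; have /andP[s0 s1] := ss; have s01 : 0 <= s <= 1 by rewrite (ltW s0).
    have t01 t : 0 <= t < s -> 0 <= t <= 1 by case/andP=> -> /ltW/le_trans ->.
    have fs : f (sg s) = flip a (coords E (sg s) 0 i).
      apply: edge_proj_coord_closed (Es s s01) _ => e /(seg_left Ex Ey ss)[t ts te].
      by exists (sg t); split; [exact/Es/t01|exact: te|apply: Qval (t01 _ ts) (H _ ts)].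
    have [|i' [a' [r' r'0 fr']]] := @edge_proj_cell_local E (sg s) (Es s s01).
      by rewrite fs flip_int si.
    have [t ts n1] := seg_left Ex Ey ss (ltac:(apply: divr_gt0 => //) : 0 < r' / 2).
    have [rt rt0 frt] := H t ts.
    have [||ei ea] := @coord_formula_unique E (sg t) (Num.min rt (r' / 2)) i i' a a'
        (Es t (t01 t ts)) (si t (t01 t ts)).
    + by rewrite lt_min rt0 divr_gt0.
    + move=> y' Ey'; rewrite lt_min => /andP[y1 y2]; rewrite -frt//; apply: fr' => //.
      apply: le_lt_trans (cell_dist_triangle E _ (sg t) _ p1) _.
      by rewrite (splitr r') ltrD.
    by exists r' => // y' Ey' h; rewrite fr'// ei ea.
(* An arbitrary y is the limit of the segment from x, whose points before y have an interior i-th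
   coordinate. *)
move=> y Ey; apply: edge_proj_coord_closed (Ey) _ => e e0.
have [|t ts te] := seg_left Ex Ey (s := 1) _ e0; first by rewrite ltr01 lexx.
have Et : carrier E (cell_seg E x y t).
  by apply: carrier_seg => //; case/andP: ts => -> /ltW.
exists (cell_seg E x y t); split => //; first by rewrite -{1}(cell_seg1 x Ey).
by apply: inner => //; exact: seg_int.
Qed.

(** If f takes no interior value on E, its values are 0 and 1, and continuity along segments makes
    it constant. *)
Lemma edge_proj_cell E : (exists i a, coord_on f E i a) \/
  (forall x y, carrier E x -> carrier E y -> f x = f y).
Proof.
have [[x [Ex fx]]|nint] := pselect (exists x, carrier E x /\ 0 < f x < 1).
  by left; exact: edge_proj_coord Ex fx.
right; have f01 x : carrier E x -> f x = 0 \/ f x = 1.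
  move=> Ex; have /andP[] := edge_proj01 HC ue x; rewrite -/f !le_eqVlt.
  move=> /predU1P[<-|x0]; first by left.
  move=> /predU1P[->|x1]; first by right.
  by case: nint; exists x; rewrite x0 x1.
move=> x y Ex Ey; pose sg := cell_seg E x y.
have Es t : 0 <= t <= 1 -> carrier E (sg t) by exact: carrier_seg.
suff H t : 0 <= t <= 1 -> f (sg t) = f x by rewrite -(H 1 i11) /sg cell_seg1.
have near s : 0 <= s <= 1 -> exists2 m, 0 < m & forall t, 0 <= t <= 1 -> `|s - t| < m ->
    f (sg s) = f (sg t).
  move=> s01; have [r' r'0 fc] := edge_proj_cell_cont (Es s s01) ltr01.
  have [m m0 near] := seg_near Ex Ey s01 r'0; exists m => // r t01 /(near r t01).
  move=> /(fc _ (Es r t01)).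
  case: (f01 _ (Es s s01)) => ->; case: (f01 _ (Es r t01)) => -> //.
  - by rewrite sub0r normrN normr1 ltxx.
  - by rewrite subr0 normr1 ltxx.
move: t; apply: interval_ind => //; first by rewrite /sg cell_seg0.
- move=> s /andP[s0 s1] /(_ s); rewrite s0 lexx => /(_ isT) fs.
  have s01 : 0 <= s <= 1 by rewrite s0 ltW.
  have [m m0 H] := near s s01; exists m => // t st tm t1; rewrite -fs; symmetry; apply: H.
    by rewrite (le_trans s0 st).
  by rewrite distrC ger0_norm ?subr_ge0// ltrBlDl.
- move=> s /andP[s0 s1] fs; have s01 : 0 <= s <= 1 by rewrite (ltW s0).
  have [m m0 H] := near s s01; have [t /andP[t0 ts] tm] := left_near s0 m0.
  rewrite (H t); [by apply: fs; rewrite t0| |by rewrite gtr0_norm// subr_gt0].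
  by rewrite t0 (le_trans (ltW ts)).
Qed.

(** On its own edge f is the parameter, which identifies the coordinate and its orientation. *)
Lemma edge_proj_own_cell : coord_on f c j b.
Proof.
have cm := carrier_edge j b uu ihh.
have fe t : 0 <= t <= 1 -> f (ed t) = t by move=> t01; rewrite /f edge_proj_on.
have [|i [a H]] := edge_proj_coord cm; first by rewrite -/ed fe//; lra.
have val t : 0 <= t <= 1 -> t = flip a (upd u j (flip b t) 0 i).
  move=> t01; rewrite -{1}(fe t t01) H; last exact: carrier_edge.
  by rewrite coords_edge.
have ij : i = j.
  apply/eqP; apply: contraT => ne.
  have := val 0 i01; have := val 1 i11.
  by rewrite !updE (negPf ne) => <-; lra.
have := val 0 i01; rewrite ij updE eqxx flip_flip -{1}[0](flipK false 0) /=.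
move=> /(@flip_eqb _ false); rewrite eq_sym invr_eq0 pnatr_eq0 => /(_ isT).
by move: H; rewrite ij => H; case: (a) H; case: (b).
Qed.

End ProjectionOnCells.
End Hyperplanes.

(** * Coordinates at a vertex *)

Section VertexCoordinates.
Context {R : realType} {X : cube_complex R}.
Implicit Types (c E : cell X) (v x y z w q n : points X) (t : R).

Definition is_vertex c v : Prop := carrier c v /\ cube_vertex (coords c v).

(* The coordinates of x in c, measured from v. *)
Definition ocoord c v x (j : 'I_(cell_dim c)) : R :=
  flip (coords c v 0 j == 1) (coords c x 0 j).

(* The point at distance t from v on the edge of c that leaves v in direction j. *)
Definition vdir c v (j : 'I_(cell_dim c)) t : points X :=
  edge (coords c v) j (coords c v 0 j == 1) t.

(** The neighbour of v serves as a name, common to all cells, of the direction j at v. *)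
Definition nb c v j : points X := vdir (c := c) v j 1.

End VertexCoordinates.

Arguments ocoord {R X} c v x j.
Arguments vdir {R X} c v j t.
Arguments nb {R X} c v j.

Section Hyp.
Context {R : realType} {X : cube_complex R}.
Hypothesis X_CAT0 : CAT0_cube_complex X.
Implicit Types (c E : cell X) (v x y z w q n : points X) (p s t e : R) (h f : points X -> R).

Let conn : forall x y : points X, exists l, string_length 2 x y l := proj1 X_CAT0.
Let HC : CAT0_space (lp_dist X 2) := proj2 X_CAT0.
Local Notation d := (lp_dist X 2).
Let p1 : 1 < 2 :> R. Proof. by rewrite ltr1n. Qed.
Let i01 : 0 <= (0 : R) <= 1. Proof. by rewrite lexx ler01. Qed.
Let i11 : 0 <= (1 : R) <= 1. Proof. by rewrite lexx ler01. Qed.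
Let ih1 : 0 < (2^-1 : R) < 1. Proof. by lra. Qed.
Let ihh : 0 <= (2^-1 : R) <= 1. Proof. by lra. Qed.

Let flip_half b : flip b (2^-1 : R) = 2^-1.
Proof. by rewrite /flip; case: b => //; lra. Qed.

(** Let z and q be the midpoints of the edge of E and of the edge of c. Then f = 1/2 along the
    geodesic from z to its foot q. Near z, f and g agree up to reversal, so g = 1/2 on an initial
    piece, and [edge_proj_of_geodesic] gives g q = 1/2. On c, g is thus a coordinate that is
    interior at q, and j is the only one. *)
Lemma edge_proj_sym c (u : 'rV[R]_(cell_dim c)) j b E i a (u' : 'rV[R]_(cell_dim E)) b' :
  cube_vertex u -> unit_cube u' ->
  coord_on (edge_proj d (edge u j b 0) (edge u j b 1)) E i a ->
  exists a', coord_on (edge_proj d (edge u' i b' 0) (edge u' i b' 1)) c j a'.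
Proof.
move=> vu uu'; have uu := cube_vertex_unit vu.
have ue := edge_unit_geodesic conn j b uu HC.
have ue' := edge_unit_geodesic conn i b' uu' HC.
pose f := edge_proj d (edge u j b 0) (edge u j b 1).
pose g := edge_proj d (edge u' i b' 0) (edge u' i b' 1).
rewrite -/f -/g => fE.
have gE : coord_on g E i b' by exact: edge_proj_own_cell.
pose z := edge u' i b' 2^-1; pose q := edge u j b 2^-1.
have Ez : carrier E z by exact: carrier_edge.
have cq : carrier c q by exact: carrier_edge.
have gz : g z = 2^-1 by rewrite /g edge_proj_on.
have zi : coords E z 0 i = 2^-1 by rewrite coords_edge// updE eqxx flip_half.
have fz : f z = 2^-1 by rewrite fE// zi flip_half.
suff gq : g q = 2^-1.
  have [|j' [a' gc]] := @edge_proj_coord _ _ X_CAT0 _ _ i b' uu' c q cq; first by rewrite -/g gq.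
  have := gc q cq; rewrite -/g gq => /(congr1 (flip a')); rewrite flipK flip_half.
  rewrite coords_edge// updE; have [<- _|_ e] := eqVneq j' j; first by exists a'.
  by case: (vu j') => h; move: e; rewrite h; lra.
have [k kz] := geod_ex HC z q; have [k0 k1 kd] := kz.
have fk s : 0 <= s <= 1 -> f (k s) = 2^-1.
  move=> s01; have := geod_rev HC kz; rewrite -[q]/(edge u j b 2^-1) -fz => kz'.
  have := edge_proj_geodesic HC ue kz' (s := 1 - s).
  by rewrite subKr -/f fz; apply; lra.
have [e ze] := star_radius_ex z; have e0 : 0 < e by case: ze => /andP[].
have L0 := dist_ge0 HC z q.
have L1 : 0 < d z q + 1 by lra.
pose s := Num.min 1 (e / (d z q + 1)).
have s0 : 0 < s by rewrite lt_min ltr01 divr_gt0.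
have s1 : s <= 1 by rewrite ge_min lexx.
have sL : s * (d z q + 1) <= e by rewrite -ler_pdivlMr// /s ge_min lexx orbT.
have zks : d z (k s) < e.
  rewrite (geod_d0 kz); last by rewrite ltW.
  by apply: lt_le_trans sL; rewrite ltr_pM2l//; lra.
have [E1 [E1z E1k _]] := star_radial conn p1 ze zks.
have [|i1 [a1 f1]] := @edge_proj_coord _ _ X_CAT0 _ _ j b uu E1 z E1z; first by rewrite -/f fz.
have [|i2 [a2 g2]] := @edge_proj_coord _ _ X_CAT0 _ _ i b' uu' E1 z E1z; first by rewrite -/g gz.
rewrite -/f in f1; rewrite -/g in g2.
pose g' x := flip (a (+) b') (g x).
have g'E : coord_on g' E i a.
  by move=> x Ex; rewrite /g' gE// flip_flip -addbA addbb addbF.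
have g'E1 : coord_on g' E1 i2 ((a (+) b') (+) a2).
  by move=> x Ex; rewrite /g' g2// flip_flip.
have fz01 : 0 < f z < 1 by rewrite fz.
have := coord_on_unique fE g'E f1 g'E1 Ez E1z fz01 E1k.
rewrite fk; last by rewrite ltW.
move=> /(congr1 (flip (a (+) b'))); rewrite /g' flipK flip_half => gk.
apply: (edge_proj_of_geodesic HC ue' ihh kz (s := s)); first by rewrite s0.
by rewrite -/g gk.
Qed.

Lemma vdir01 c v j t : 0 <= t <= 1 -> carrier c v -> carrier c (vdir c v j t).
Proof. by move=> t01 cv; apply: carrier_edge => //; exact: coords_unit. Qed.

Lemma vdir0 c v j : is_vertex c v -> vdir c v j 0 = v.
Proof.
move=> [cv vv]; rewrite /vdir /edge -[RHS](chart_coords cv); congr chart.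
apply/rowP => i; rewrite updE; case: eqP => // ->; rewrite /flip.
by case: (vv j) => ->; rewrite ?eqxx ?subr0// eq_sym oner_eq0.
Qed.

Lemma carrier_nb c v j : carrier c v -> carrier c (nb c v j).
Proof. exact: vdir01. Qed.

Lemma ocoord01 c v x j : carrier c x -> 0 <= ocoord c v x j <= 1.
Proof. by move=> cx; rewrite flip01; exact: coords_unit. Qed.

Lemma ocoord_vdir c v j t k : is_vertex c v -> 0 <= t <= 1 ->
  ocoord c v (vdir c v j t) k = if k == j then t else 0.
Proof.
move=> [cv vv] t01; rewrite /ocoord coords_edge//; last exact: coords_unit.
rewrite updE; case: (k =P j) => [->|_] /=; first by rewrite flipK.
by rewrite /flip; case: (vv k) => ->; rewrite ?eqxx ?subrr// eq_sym oner_eq0.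
Qed.

Lemma ocoord_vertex c v j : is_vertex c v -> ocoord c v v j = 0.
Proof. by move=> cv; rewrite -{2}(vdir0 j cv) ocoord_vdir// eqxx. Qed.

Lemma ocoord_inj c v x y : carrier c x -> carrier c y ->
  (forall j, ocoord c v x j = ocoord c v y j) -> x = y.
Proof.
move=> cx cy H; apply: (coords_inj cx cy); apply/rowP => j.
exact: flip_inj (H j).
Qed.

Lemma cell_mass_ocoord p c v x y :
  cell_mass p c x y = \sum_j `|ocoord c v x j - ocoord c v y j| `^ p.
Proof. by rewrite cell_mass.unlock; apply: eq_bigr => j _; rewrite flipB. Qed.

Local Notation hyp := (edge_proj d).

Section Vertex.
Variables (c : cell X) (v : points X).
Hypothesis cv : is_vertex c v.

Let vc : carrier c v. Proof. by case: cv. Qed.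

Lemma hyp_vdir j : hyp v (nb c v j) = hyp (vdir c v j 0) (vdir c v j 1).
Proof. by rewrite vdir0. Qed.

Lemma hyp_coord_on j : coord_on (hyp v (nb c v j)) c j (coords c v 0 j == 1).
Proof. by rewrite hyp_vdir; apply: edge_proj_own_cell => //; exact: coords_unit. Qed.

Lemma hyp_own j x : carrier c x -> hyp v (nb c v j) x = ocoord c v x j.
Proof. exact: hyp_coord_on. Qed.

Lemma hyp_base j : hyp v (nb c v j) v = 0.
Proof. by rewrite hyp_own// ocoord_vertex. Qed.

Lemma nb_inj : injective (nb c v).
Proof.
move=> j k e; have := ocoord_vdir j j cv i11; rewrite -/(nb c v j) e /nb ocoord_vdir//.
by rewrite eqxx; case: (j =P k) => // _ /esym/eqP; rewrite oner_eq0.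
Qed.

Lemma hyp_cell j E : (exists i a, coord_on (hyp v (nb c v j)) E i a) \/
  (forall x y, carrier E x -> carrier E y -> hyp v (nb c v j) x = hyp v (nb c v j) y).
Proof. by rewrite hyp_vdir; apply: edge_proj_cell => //; exact: coords_unit. Qed.

(** By symmetry the projection to an edge of E in direction i would be both the j-th and the k-th
    coordinate of c. *)
Lemma hyp_distinct j k E i a a' : coord_on (hyp v (nb c v j)) E i a ->
  coord_on (hyp v (nb c v k)) E i a' -> j = k.
Proof.
rewrite !hyp_vdir => hj hk; case: (cv) => _ vv.
have u0 : unit_cube (0 : 'rV[R]_(cell_dim E)) by move=> l; rewrite mxE.
have [aj gj] := edge_proj_sym false vv u0 hj; have [ak gk] := edge_proj_sym false vv u0 hk.
set g := edge_proj _ _ _ in gj gk.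
apply/eqP; apply: contraT => ne.
have val t : 0 <= t <= 1 -> flip aj (flip (coords c v 0 j == 1) t) = flip ak (coords c v 0 k).
  move=> t01; have ct := vdir01 j t01 vc.
  have := gj _ ct; rewrite gk// coords_edge//; last exact: coords_unit.
  by rewrite !updE eqxx eq_sym (negPf ne) => ->.
have := val 0 i01; rewrite -(val 1 i11) => /flip_inj/flip_inj; lra.
Qed.

(** If the function is the coordinate i of E, the midpoint m of the edge i at v has value 1/2 and
    distance at most 1/2 from v. The obtuse angle at its foot leaves no room: m is the midpoint of
    the edge [v, nb c v j], so the two edges coincide. *)
Lemma hyp_star E j : carrier E v -> (exists i, nb E v i = nb c v j) \/
  (forall x, carrier E x -> hyp v (nb c v j) x = 0).
Proof.
move=> Ev; have [[i [a hE]]|hc] := hyp_cell j E; last first.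
  by right=> x Ex; rewrite (hc x v)// hyp_base.
left; exists i; case: (cv) => _ vv.
have Evx : is_vertex E v by split => //; exact: vertex_match vc Ev vv.
have cu := coords_unit vc; have Eu := coords_unit Ev.
have ue : unit_geodesic d (vdir c v j).
  exact: (edge_unit_geodesic conn j (coords c v 0 j == 1) cu HC).
set m := vdir E v i 2^-1; have Em : carrier E m by exact: vdir01.
have hm : hyp v (nb c v j) m = 2^-1.
  by rewrite hE// /m coords_edge// updE eqxx !flip_half.
have := edge_proj_obtuse HC ue m i01; rewrite -hyp_vdir hm vdir0//.
have dmv : d m v <= 2^-1.
  apply: le_trans (lp_dist_le_cell 2 Em Ev) _.
  rewrite -{1}(vdir0 i Evx) /m cell_dist_edge// subr0 ger0_norm//; lra.
have := dist_ge0 HC m v; have := dist_ge0 HC m (vdir c v j 2^-1).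
set D := d m (vdir c v j 2^-1) => D0 e0.
have : d m v ^+ 2 <= 2^-1 ^+ 2 by rewrite sqr_leE//; lra.
move=> h1 h2; have D2 : D ^+ 2 <= 0 by move: h1 h2; rewrite sub0r sqrrN; lra.
have /(dist_eq0 HC) mE : D = 0 by apply/eqP; rewrite -sqrf_eq0 eq_le D2 sqr_ge0.
have Em' := Em; rewrite mE in Em'.
have [i' [a' [ed0 _ _]]] := edge_match cu ih1 Em'.
have ed s : 0 <= s <= 1 -> vdir c v j s = chart E (upd (coords E m) i' (flip a' s)).
  by move=> s01; rewrite mE; exact: ed0.
have Cm : coords E m = upd (coords E v) i 2^-1.
  by rewrite /m coords_edge// flip_half.
have U t : 0 <= t <= 1 -> unit_cube (upd (coords E m) i' (flip a' t)).
  by move=> t01; apply: unit_cube_upd; [rewrite Cm; exact: unit_cube_upd|rewrite flip01].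
have E0 : coords E v = upd (coords E m) i' (flip a' 0).
  by rewrite -{1}(vdir0 j cv) (ed 0 i01) coords_chart//; exact: U.
have ii : i' = i.
  apply/eqP; apply: contraT => ne; case: Evx => _ /(_ i).
  rewrite E0 updE eq_sym (negPf ne) Cm updE eqxx; lra.
rewrite /nb (ed 1 i11) /vdir /edge; congr chart; apply/rowP => l.
rewrite !updE ii Cm updE; case: eqP => // _.
have := congr1 (fun u : 'rV[R]__ => u 0 i) E0; rewrite updE ii eqxx => ->.
by rewrite /flip; case: (a'); rewrite ?subr0 ?eqxx// eq_sym oner_eq0.
Qed.

End Vertex.

(** Distinct functions use distinct coordinates of E, so the sum is part of the mass. *)
Lemma family_mass p (I : finType) (P : pred I) (phi : I -> points X -> R) E x y :
  0 < p -> carrier E x -> carrier E y ->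
  (forall t : I, P t -> (exists i a, coord_on (phi t) E i a) \/ phi t x = phi t y) ->
  (forall (t t' : I) i a a', P t -> P t' -> coord_on (phi t) E i a -> coord_on (phi t') E i a' ->
     t = t') ->
  \sum_(t | P t) `|phi t x - phi t y| `^ p <= cell_mass p E x y.
Proof.
move=> pp Ex Ey H D; pose act (t : I) := `[< exists i a, coord_on (phi t) E i a >].
have [[t0 [_ /asboolP[i0 _]]]|none] := pselect (exists t : I, P t /\ act t); last first.
  rewrite big1 ?cell_mass_ge0// => t Pt.
  case: (H t Pt) => [Ht|->]; last by rewrite subrr normr0 powR0// gt_eqF.
  by case: none; exists t; split => //; exact/asboolP.
pose F (t : I) := match pselect (exists i a, coord_on (phi t) E i a) with
  | left K => projT1 (cid K) | right _ => i0 end.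
have FE (t : I) : act t -> exists a, coord_on (phi t) E (F t) a.
  by move=> /asboolP K; rewrite /F; case: pselect => // K'; case: (cid K').
rewrite (bigID act)/= [X in _ + X]big1 ?addr0 => [|t /andP[Pt nt]]; last first.
  case: (H t Pt) => [Ht|->]; last by rewrite subrr normr0 powR0// gt_eqF.
  by case/negP: nt; exact/asboolP.
rewrite cell_mass.unlock.
apply: (@sum_le_inj _ _ _ _ xpredT F) => //.
- move=> t t' /andP[Pt /FE[a at_]] /andP[Pt' /FE[a' at']] e; rewrite -e in at'.
  exact: D at_ at'.
- by move=> i _; exact: powR_ge0.
- by move=> t /andP[_ /FE[a at_]]; rewrite !at_// flipB.
Qed.

(** The map with components phi is 1-Lipschitz on every cell, hence along strings, for every
    exponent p. *)
Lemma family_lower p (I : finType) (P : pred I) (phi : I -> points X -> R) x y : 1 < p ->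
  (forall E x y (t : I), carrier E x -> carrier E y -> P t ->
     (exists i a, coord_on (phi t) E i a) \/ phi t x = phi t y) ->
  (forall E (t t' : I) i a a', P t -> P t' -> coord_on (phi t) E i a -> coord_on (phi t') E i a' ->
     t = t') ->
  (\sum_(t | P t) `|phi t x - phi t y| `^ p) `^ p^-1 <= lp_dist X p x y.
Proof.
move=> pp H D; have pp0 : 0 < p by lra.
apply: (lp_dist_ge conn) => l; move: x y l; apply: string_points_ind => [x|].
  rewrite big1 ?powR0 ?invr_eq0 ?gt_eqF// => t _.
  by rewrite subrr normr0 powR0// gt_eqF.
move=> E x y z l Ex Ey _ IH.
apply: (@le_trans _ _ ((\sum_(t | P t) `|phi t x - phi t y| `^ p) `^ p^-1 +
                       (\sum_(t | P t) `|phi t y - phi t z| `^ p) `^ p^-1)).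
  apply: le_trans (minkowski_le P _ _ pp); apply: le_of_eq.
  by congr (_ `^ _); apply: eq_bigr => t _; rewrite addrA subrK.
apply: lerD => //.
rewrite -(@ler_powR2E _ p) ?cell_dist_ge0 ?powR_ge0// cell_distK// powRVK ?psum_ge0//.
by apply: family_mass => // [t Pt|t t' i a a']; [exact: H|exact: D].
Qed.

(** The projections to the edges of c at one of its vertices recover all coordinates of c. *)
Lemma cell_isometric p c x y : 1 < p -> carrier c x -> carrier c y ->
  lp_dist X p x y = cell_dist p c x y.
Proof.
move=> pp cx cy; apply/eqP; rewrite eq_le lp_dist_le_cell//=.
have [v cv] : exists v, is_vertex c v.
  exists (chart c 0); have u0 : unit_cube (0 : 'rV[R]_(cell_dim c)) by move=> l; rewrite mxE.
  by split; [exact: carrier_chart|rewrite coords_chart// => l; left; rewrite mxE].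
rewrite cell_dist.unlock (cell_mass_ocoord _ _ v).
under eq_bigr => j _ do rewrite -!(hyp_own cv)//.
apply: (family_lower (phi := fun j => hyp v (nb c v j))) => //.
- by move=> E x' y' j Ex Ey _; case: (hyp_cell cv j E) => [|H]; [left|right; exact: H].
- by move=> E j k i a a' _ _; exact: hyp_distinct.
Qed.

End Hyp.

Lemma sum_le_rel (R : realType) (I J : finType) (P : pred I) (Q : pred J)
    (r : I -> J -> Prop) (F : I -> R) (G : J -> R) :
  (forall i, P i -> exists2 j, Q j & r i j) ->
  (forall i i' j, P i -> P i' -> r i j -> r i' j -> i = i') ->
  (forall j, Q j -> 0 <= G j) ->
  (forall i j, P i -> Q j -> r i j -> F i <= G j) ->
  \sum_(i | P i) F i <= \sum_(j | Q j) G j.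
Proof.
move=> ex inj G0 FG.
have [[i0 Pi0]|none] := pselect (exists i, P i); last first.
  by rewrite big_pred0 ?sumr_ge0// => i; apply/negP => Pi; apply: none; exists i.
have [j0 _ _] := ex i0 Pi0.
pose phi i := xget j0 [set j | Q j /\ r i j].
have phiP i : P i -> Q (phi i) /\ r i (phi i).
  move=> Pi; apply: (@xgetPex _ j0 [set j | Q j /\ r i j]).
  by have [j Qj rij] := ex i Pi; exists j.
apply: (sum_le_inj (phi := phi)) => //.
- by move=> i /phiP[].
- move=> i i' Pi Pi' e; have [_ ri] := phiP i Pi; have [_ ri'] := phiP i' Pi'.
  by rewrite -e in ri'; exact: inj Pi Pi' ri ri'.
- by move=> i Pi; have [? ?] := phiP i Pi; exact: FG.
Qed.

(* The first-order terms of the lengths of the three pieces of the shortcut. *)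
Lemma shortcut_real (R : realType) (p dl s t : R) : 1 < p -> 0 <= dl -> 0 <= s -> 0 <= t ->
  dl + s <= 1 -> dl + t <= 1 ->
  (forall e, 0 < e -> e <= 4^-1 ->
    2 <= (1 - dl - s + (1 - e) `^ p * dl + (1 - 2 * e) `^ p * s) `^ p^-1 +
         2 * e * (dl + s + t) `^ p^-1 +
         (1 - dl - t + (1 - e) `^ p * dl + (1 - 2 * e) `^ p * t) `^ p^-1) ->
  dl + s + t <= 1.
Proof.
move=> p1 d0 s0 t0 ds dt H; rewrite leNgt; apply/negP => M1.
set M := dl + s + t in M1 H; have p0 : 0 < p by lra.
have N0 := powR_ge0 M p^-1; set N := M `^ p^-1 in H N0.
have NM : N < M.
  rewrite ltNge; apply/negP => MN.
  have : M `^ p <= N `^ p by apply: ler_powR2 => //; lra.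
  rewrite powRVK//; last lra.
  rewrite leNgt => /negP; apply; rewrite -mulr_powRB1//; last lra.
  rewrite ltr_pMr//; last lra.
  by have := @ltr_powR2 R (p - 1) 1 M; rewrite powR1; apply; lra.
(* Up to terms of order e^2 the two end pieces save 2 e M, while the crossing costs 2 e N. *)
have key e : 0 < e -> e <= 4^-1 -> M * (1 - 2 * p * e) <= N.
  move=> e0 e4; have := H e e0 e4.
  have e1 : 0 <= e < 1 by lra.
  have e2 : 0 <= 2 * e < 1 by lra.
  have B1 := powR_sub_le p1 e1; have B2 := powR_sub_le p1 e2.
  have Y1 := powR_ge0 (1 - e) p; have Y2 := powR_ge0 (1 - 2 * e) p.
  move: (_ `^ p) B1 Y1 => y1 B1 Y1; move: ((1 - 2 * e) `^ p) B2 Y2 => y2 B2 Y2.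
  have b1 : y1 - 1 <= p * (- e + p * e ^+ 2) by move: B1; rewrite exprMn; lra.
  have b2 : y2 - 1 <= p * (- 2 * e + 4 * p * e ^+ 2).
    by move: B2; rewrite !exprMn; lra.
  have root u : 0 <= u -> dl + u <= 1 ->
      (1 - dl - u + y1 * dl + y2 * u) `^ p^-1 <=
      1 + (dl * (- e + p * e ^+ 2) + u * (- 2 * e + 4 * p * e ^+ 2)).
    move=> u0 du; apply: le_trans (powR_root_le p1 _) _.
      by have := mulr_ge0 Y1 d0; have := mulr_ge0 Y2 u0; lra.
    rewrite lerD2l ler_pdivrMr//.
    by have := ler_wpM2l d0 b1; have := ler_wpM2l u0 b2; lra.
  have r1 := root s s0 ds; have r2 := root t t0 dt => K.
  have pe : 0 <= p * e by rewrite mulr_ge0// ltW.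
  rewrite -(ler_pM2l (mulr_gt0 (ltr0n R 2) e0)).
  have := mulr_ge0 d0 (mulr_ge0 pe (ltW e0)); rewrite /M.
  by move: K r1 r2; rewrite !expr2; lra.
(* This makes 2 p e M at most half of M - N, which contradicts [key]. *)
pose e := Num.min 4^-1 ((M - N) / (4 * p * M)).
have den : 0 < 4 * p * M by rewrite !mulr_gt0//; lra.
have e0 : 0 < e by rewrite lt_min invr_gt0 ltr0n/= divr_gt0// subr_gt0.
have e4 : e <= 4^-1 by rewrite /e ge_min lexx.
have eD : e * (4 * p * M) <= M - N by rewrite -ler_pdivlMr// /e ge_min lexx orbT.
by have := key e e0 e4; lra.
Qed.

(** * The link of a vertex *)

Lemma sqr_inj (R : realType) (a b : R) : 0 <= a -> 0 <= b -> a ^+ 2 = b ^+ 2 -> a = b.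
Proof.
by move=> a0 b0 e; apply/eqP; rewrite eq_le -(sqr_leE a0 b0) -(sqr_leE b0 a0) e lexx.
Qed.

Section VertexStar.
Context {R : realType} {X : cube_complex R}.
Hypothesis X_CAT0 : CAT0_cube_complex X.
Implicit Types (c E : cell X) (v x y z w q n : points X) (p s t e : R) (h f : points X -> R).

Let conn : forall x y : points X, exists l, string_length 2 x y l := proj1 X_CAT0.
Let HC : CAT0_space (lp_dist X 2) := proj2 X_CAT0.
Local Notation d := (lp_dist X 2).
Local Notation hyp := (edge_proj d).
Let p1 : 1 < 2 :> R. Proof. by rewrite ltr1n. Qed.
Let i01 : 0 <= (0 : R) <= 1. Proof. by rewrite lexx ler01. Qed.
Let i11 : 0 <= (1 : R) <= 1. Proof. by rewrite lexx ler01. Qed.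
Let ihh : 0 <= (2^-1 : R) <= 1. Proof. by lra. Qed.

Definition in_nb E v n : Prop := exists i, nb E v i = n.

Lemma is_vertex_in c E v : is_vertex c v -> carrier E v -> is_vertex E v.
Proof. by move=> [cv vv] Ev; split => //; exact: vertex_match cv Ev vv. Qed.

Lemma hyp_out c E v j x : is_vertex c v -> carrier E v -> carrier E x ->
  ~ in_nb E v (nb c v j) -> hyp v (nb c v j) x = 0.
Proof. by move=> cv Ev Ex; have [//|H _] := hyp_star X_CAT0 cv j Ev; exact: H. Qed.

Lemma hyp_in c E v i j x : is_vertex c v -> carrier E v -> carrier E x ->
  nb E v i = nb c v j -> hyp v (nb c v j) x = ocoord E v x i.
Proof.
by move=> cv Ev Ex <-; apply: hyp_own => //; exact: is_vertex_in cv Ev.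
Qed.

Lemma hyp_neq0_in c E v j x : is_vertex c v -> carrier E v -> carrier E x ->
  hyp v (nb c v j) x <> 0 -> in_nb E v (nb c v j).
Proof. by move=> cv Ev Ex; apply: contra_notP; exact: hyp_out. Qed.

Lemma ocoord_eq0 c v x j : is_vertex c v -> ocoord c v x j = 0 ->
  coords c x 0 j = coords c v 0 j.
Proof. by move=> cv; rewrite -(ocoord_vertex j cv) => /flip_inj. Qed.

(** The intersection of c and c' is a face through v; a coordinate that it fixes has there the value
    of v, so no neighbour of v in c' can change it. *)
Lemma face_sub c c' v z : is_vertex c v -> carrier c' v -> carrier c z ->
  (forall j, ocoord c v z j <> 0 -> in_nb c' v (nb c v j)) -> carrier c' z.
Proof.
move=> cv c'v cz H; have vc : carrier c v by case: cv.
have [w [J [vw F]]] := meet_face vc c'v; apply/(F z cz) => j nj.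
have vj := (F v vc).1 c'v j nj.
have [z0|zn] := eqVneq (ocoord c v z j) 0; first by rewrite (ocoord_eq0 cv z0).
have [i e] := H j (elimN eqP zn).
have c'n : carrier c' (nb c v j) by rewrite -e; exact: carrier_nb.
have nj' := (F _ (carrier_nb j vc)).1 c'n j nj.
have := ocoord_vdir j j cv i11; rewrite eqxx -/(nb c v j) /ocoord nj' -vj.
by rewrite -/(ocoord c v v j) ocoord_vertex// => /esym/eqP; rewrite oner_eq0.
Qed.

Lemma nb_carrier_in c c' v j : is_vertex c v -> carrier c' v -> carrier c' (nb c v j) ->
  in_nb c' v (nb c v j).
Proof.
move=> cv c'v H; apply: (hyp_neq0_in cv c'v H); rewrite hyp_own//; last first.
  by apply: carrier_nb; case: cv.
by rewrite ocoord_vdir// eqxx; apply/eqP; rewrite oner_eq0.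
Qed.

Definition vpt c v (w : 'I_(cell_dim c) -> R) : points X :=
  chart c (\row_j flip (coords c v 0 j == 1) (w j)).

Lemma vpt_unit c v (w : 'I_(cell_dim c) -> R) : (forall j, 0 <= w j <= 1) ->
  unit_cube (\row_j flip (coords c v 0 j == 1) (w j)).
Proof. by move=> w01 j; rewrite mxE flip01. Qed.

Lemma carrier_vpt c v (w : 'I_(cell_dim c) -> R) : (forall j, 0 <= w j <= 1) ->
  carrier c (vpt v w).
Proof. by move=> w01; exact/carrier_chart/vpt_unit. Qed.

Lemma ocoord_vpt c v (w : 'I_(cell_dim c) -> R) j : (forall j, 0 <= w j <= 1) ->
  ocoord c v (vpt v w) j = w j.
Proof. by move=> w01; rewrite /ocoord coords_chart ?mxE ?flipK//; exact: vpt_unit. Qed.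

(** The coordinates of m that differ from those of v are interior, so v lies in the smallest face of
    c that contains m. *)
Lemma star_contains_vertex c E v m : is_vertex c v -> carrier c m -> carrier E m ->
  (forall j, ocoord c v m j <> 0 -> 0 < coords c m 0 j < 1) -> carrier E v.
Proof.
move=> cv cm Em H; apply: (meet_hull cm Em cm Em); first by case: cv.
move=> j _ mj; have [z0|zn] := eqVneq (ocoord c v m j) 0; first by rewrite (ocoord_eq0 cv z0).
by have := H j (elimN eqP zn); case: mj => ->; rewrite ltxx ?andbF.
Qed.

Lemma cell_mass2_sq c v x y :
  cell_mass 2 c x y = \sum_j (ocoord c v x j - ocoord c v y j) ^+ 2.
Proof.
rewrite (cell_mass_ocoord _ _ v); apply: eq_bigr => j _.
by rewrite (powR_mulrn 2)// sqr_normr.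
Qed.

Lemma dist2_mass c x y : carrier c x -> carrier c y -> d x y ^+ 2 = cell_mass 2 c x y.
Proof.
move=> cx cy; rewrite (cell_isometric X_CAT0 p1 cx cy) -(powR_mulrn 2) ?cell_dist_ge0//.
exact: cell_distK.
Qed.

Lemma dist2_vpt c v (w w' : 'I_(cell_dim c) -> R) : (forall j, 0 <= w j <= 1) ->
  (forall j, 0 <= w' j <= 1) -> d (vpt v w) (vpt v w') ^+ 2 = \sum_j (w j - w' j) ^+ 2.
Proof.
move=> w01 w'01; rewrite (dist2_mass (carrier_vpt v w01) (carrier_vpt v w'01)).
by rewrite (cell_mass2_sq _ v); apply: eq_bigr => j _; rewrite !ocoord_vpt.
Qed.

Lemma dist2_vpt_vertex c v (w : 'I_(cell_dim c) -> R) : is_vertex c v ->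
  (forall j, 0 <= w j <= 1) -> d (vpt v w) v ^+ 2 = \sum_j w j ^+ 2.
Proof.
move=> cv w01; rewrite (dist2_mass (carrier_vpt v w01)); last by case: cv.
rewrite (cell_mass2_sq _ v); apply: eq_bigr => j _.
by rewrite ocoord_vpt// ocoord_vertex// subr0.
Qed.

(** Coordinates measured from v are nonnegative, so the mixed terms can only reduce the squared
    distance. *)
Lemma dist2_right_angle E v x y : is_vertex E v -> carrier E x -> carrier E y ->
  d x y ^+ 2 <= d x v ^+ 2 + d y v ^+ 2.
Proof.
move=> Ev Ex Ey; have vE : carrier E v by case: Ev.
rewrite (dist2_mass Ex Ey) (dist2_mass Ex vE) (dist2_mass Ey vE) !(cell_mass2_sq _ v).
rewrite -big_split/=; apply: ler_sum => i _; rewrite (ocoord_vertex i Ev) !subr0.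
have /andP[a0 _] := ocoord01 v i Ex; have /andP[b0 _] := ocoord01 v i Ey.
by have := mulr_ge0 a0 b0; rewrite !expr2; lra.
Qed.

(* The link of v is flag: if the faces sigma, tau of c and rho of c' pairwise
   span a cube, all three do. With s = v + 1_sigma, t = v + 1_tau,
   r = v + 1_rho and m the midpoint of s and t, the CAT(0) inequality and the
   hyperplane coordinates give opposite bounds for d(m, r); by equality the
   geodesic from m to r moves into all the directions of rho at once. *)
Lemma flag_cell c c' E v (S : pred 'I_(cell_dim c)) (T : pred 'I_(cell_dim c')) :
  is_vertex c v -> is_vertex c' v -> carrier E v ->
  (forall j, S j -> in_nb c' v (nb c v j) \/ in_nb E v (nb c v j)) ->
  (forall k, T k -> in_nb E v (nb c' v k) /\ ~ in_nb c v (nb c' v k)) ->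
  exists E', [/\ carrier E' v, forall j, S j -> in_nb E' v (nb c v j) &
    forall k, T k -> in_nb E' v (nb c' v k)].
Proof.
move=> cv c'v Ev HS HT.
have vc : carrier c v by case: cv.
have vc' : carrier c' v by case: c'v.
have vE : is_vertex E v := is_vertex_in cv Ev.
(* [sg] splits S into sigma, the directions shared with c', and tau, whose directions lie in E by
   hypothesis. So [ps] and [pr] share the cell c', and [pt] and [pr] the cell E. *)
pose sg j := `[< in_nb c' v (nb c v j) >].
pose ws j : R := if S j && sg j then 1 else 0.
pose wt j : R := if S j && ~~ sg j then 1 else 0.
pose wm j : R := if S j then 2^-1 else 0.
pose wr k : R := if T k then 1 else 0.
have ws01 j : 0 <= ws j <= 1 by rewrite /ws; case: ifP.
have wt01 j : 0 <= wt j <= 1 by rewrite /wt; case: ifP.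
have wm01 j : 0 <= wm j <= 1 by rewrite /wm; case: ifP.
have wr01 k : 0 <= wr k <= 1 by rewrite /wr; case: ifP.
pose ps := vpt v ws; pose pt := vpt v wt; pose pm := vpt v wm; pose pr := vpt v wr.
have cs : carrier c ps by exact: carrier_vpt.
have ct : carrier c pt by exact: carrier_vpt.
have cm : carrier c pm by exact: carrier_vpt.
have c'r : carrier c' pr by exact: carrier_vpt.
have c's : carrier c' ps.
  apply: (face_sub cv vc' cs) => j; rewrite ocoord_vpt// /ws.
  by case: ifP => // /andP[_ /asboolP].
have Et : carrier E pt.
  apply: (face_sub cv Ev ct) => j; rewrite ocoord_vpt// /wt.
  case: ifP => // /andP[/HS[]// + nj _]; by move/asboolP; rewrite -/(sg j) (negPf nj).
have Er : carrier E pr.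
  apply: (face_sub c'v Ev c'r) => k; rewrite ocoord_vpt// /wr.
  by case: ifP => // /HT[].
pose ns : R := \sum_j ws j ^+ 2; pose nt : R := \sum_j wt j ^+ 2.
pose nr : R := \sum_k wr k ^+ 2.
have dsv : d ps v ^+ 2 = ns := dist2_vpt_vertex cv ws01.
have dtv : d pt v ^+ 2 = nt := dist2_vpt_vertex cv wt01.
have drv : d pr v ^+ 2 = nr := dist2_vpt_vertex c'v wr01.
have dst : d ps pt ^+ 2 = ns + nt.
  rewrite dist2_vpt// -big_split/=; apply: eq_bigr => j _.
  by rewrite /ws /wt; case: (S j); case: (sg j) => /=; ring.
have half x y z w : d x y ^+ 2 = 4^-1 * d z w ^+ 2 -> d x y = 2^-1 * d z w.
  move=> e; apply: sqr_inj; [exact: (dist_ge0 HC)| |by rewrite e exprMn; congr (_ * _); lra].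
  by rewrite mulr_ge0 ?invr_ge0//; exact: (dist_ge0 HC).
have dsm : d ps pm = 2^-1 * d ps pt.
  apply: half; rewrite !dist2_vpt// mulr_sumr; apply: eq_bigr => j _.
  by rewrite /ws /wt /wm; case: (S j); case: (sg j) => /=; field.
have dmt : d pm pt = (1 - 2^-1) * d ps pt.
  rewrite (_ : 1 - 2^-1 = 2^-1 :> R); last by lra.
  apply: half; rewrite !dist2_vpt// mulr_sumr; apply: eq_bigr => j _.
  by rewrite /ws /wt /wm; case: (S j); case: (sg j) => /=; field.
have upper : d pr pm ^+ 2 <= 4^-1 * (ns + nt) + nr.
  have [g gst] := geod_ex HC ps pt.
  have -> : pm = g 2^-1 by exact: (geod_point HC gst ihh).
  have := stewart HC pr gst ihh; rewrite dst (distC HC pr ps) (distC HC pr pt).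
  have := dist2_right_angle c'v c's c'r; have := dist2_right_angle vE Et Er.
  rewrite dsv dtv drv; lra.
pose phi (i : 'I_(cell_dim c) + 'I_(cell_dim c')) :=
  match i with inl j => hyp v (nb c v j) | inr k => hyp v (nb c' v k) end.
pose P (i : 'I_(cell_dim c) + 'I_(cell_dim c')) :=
  match i with inl j => S j | inr k => T k end.
have TS j k : S j -> T k -> nb c v j <> nb c' v k.
  by move=> Sj /HT[_ H] e; apply: H; exists j.
have phi_in D i (x y : points X) : carrier D x -> carrier D y -> P i ->
    (exists k a, coord_on (phi i) D k a) \/ phi i x = phi i y.
  case: i => [j|k] Dx Dy _ /=.
    by case: (hyp_cell X_CAT0 cv j D) => [|H]; [left|right; exact: H].
  by case: (hyp_cell X_CAT0 c'v k D) => [|H]; [left|right; exact: H].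
have cross D j k i a a' : S j -> T k -> coord_on (hyp v (nb c v j)) D i a ->
    coord_on (hyp v (nb c' v k)) D i a' -> False.
  move=> Sj Tk hj hk; have [[k0 e]|[i0 e]] := HS j Sj.
    rewrite -e in hj; have kk := hyp_distinct X_CAT0 c'v hj hk.
    by apply: (TS j k Sj Tk); rewrite -e kk.
  have [[i1 e'] _] := HT k Tk; rewrite -e in hj; rewrite -e' in hk.
  have kk := hyp_distinct X_CAT0 vE hj hk.
  by apply: (TS j k Sj Tk); rewrite -e -e' kk.
have phi_dist D (i i' : 'I_(cell_dim c) + 'I_(cell_dim c')) l a a' : P i -> P i' ->
    coord_on (phi i) D l a -> coord_on (phi i') D l a' -> i = i'.
  case: i => [j|k]; case: i' => [j'|k'] /= Pi Pi' hi hi'.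
  - by congr inl; exact: (hyp_distinct X_CAT0 cv hi hi').
  - by case: (cross D j k' l a a').
  - by case: (cross D j' k l a' a).
  - by congr inr; exact: (hyp_distinct X_CAT0 c'v hi hi').
have lower x y : \sum_(i | P i) (phi i x - phi i y) ^+ 2 <= d x y ^+ 2.
  have := @family_lower _ _ X_CAT0 2 _ P phi x y p1 (fun D x y i => @phi_in D i x y) phi_dist.
  rewrite -(@ler_powR2E _ 2)// ?powR_ge0 ?(dist_ge0 HC)// powRVK ?psum_ge0//.
  rewrite (powR_mulrn 2) ?(dist_ge0 HC)//; apply: le_trans; apply: le_of_eq.
  by apply: eq_bigr => i _; rewrite (powR_mulrn 2)// sqr_normr.
have phim i : P i -> phi i pm = match i with inl _ => 2^-1 | inr _ => 0 end.
  case: i => [j|k] /= Pi.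
    by rewrite hyp_own// ocoord_vpt// /wm Pi.
  by apply: (hyp_out c'v vc cm); case: (HT k Pi).
have phir i : P i -> phi i pr = match i with inl _ => 0 | inr _ => 1 end.
  case: i => [j|k] /= Pi; last by rewrite hyp_own// ocoord_vpt// /wr Pi.
  have [[k e]|out] := pselect (in_nb c' v (nb c v j)); last exact: (hyp_out cv vc' c'r out).
  rewrite (hyp_in cv vc' c'r e) ocoord_vpt// /wr; case: ifP => // Tk.
  by case: (TS j k Pi Tk).
have split_sum (F : 'I_(cell_dim c) + 'I_(cell_dim c') -> R) :
    \sum_(i | P i) F i = \sum_(j | S j) F (inl j) + \sum_(k | T k) F (inr k).
  exact: big_sumType.
have sumS : \sum_(j | S j) (2^-1 : R) ^+ 2 = 4^-1 * (ns + nt).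
  rewrite -big_split/= mulr_sumr big_mkcond/=; apply: eq_bigr => j _.
  by rewrite /ws /wt; case: (S j); case: (sg j) => /=; field.
have sumT : \sum_(k | T k) (1 : R) ^+ 2 = nr.
  by rewrite big_mkcond/=; apply: eq_bigr => k _; rewrite /wr; case: (T k); ring.
have total : \sum_(i | P i) (phi i pr - phi i pm) ^+ 2 = 4^-1 * (ns + nt) + nr.
  rewrite split_sum -sumS -sumT; congr (_ + _); apply: eq_bigr => i Pi.
    by rewrite (phir (inl i))// (phim (inl i))// sub0r sqrrN.
  by rewrite (phir (inr i))// (phim (inr i))// subr0.
set L := d pm pr; have LE : L ^+ 2 <= 4^-1 * (ns + nt) + nr.
  by rewrite /L (distC HC pm).
have [g gmr] := geod_ex HC pm pr.
have [e me] := star_radius_ex pm; have e0 : 0 < e by case: me => /andP[].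
have L0 : 0 <= L by exact: dist_ge0.
have L1 : 0 < L + 1 by lra.
pose s := Num.min 1 (e / (L + 1)).
have s0 : 0 < s by rewrite lt_min ltr01 divr_gt0.
have s01 : 0 <= s <= 1 by rewrite (ltW s0) ge_min lexx.
have sL : s * (L + 1) <= e by rewrite -ler_pdivlMr// /s ge_min lexx orbT.
have dms : d pm (g s) = s * L by rewrite (geod_d0 gmr).
have dsr : d (g s) pr = (1 - s) * L by rewrite (geod_d1 gmr).
(* s is small enough for g s to share a cell with [pm]; this cell will contain all the
   directions. *)
have [|E' [E'm E's _]] := @star_radial _ _ conn 2 pm e p1 me (g s).
  by rewrite dms; apply: lt_le_trans sL; rewrite ltr_pM2l//; lra.
have E'v : carrier E' v.
  apply: (star_contains_vertex cv cm E'm) => j; rewrite ocoord_vpt// /wm => wj.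
  rewrite -(flip_int (coords c v 0 j == 1)) -/(ocoord c v pm j) ocoord_vpt// /wm.
  by move: wj; case: (S j) => // _; lra.
exists E'; split => //.
  move=> j Sj; apply: (hyp_neq0_in cv E'v E'm).
  have /= -> := phim (inl j) Sj.
  by apply/eqP; rewrite invr_eq0 pnatr_eq0.
move=> k Tk; apply: (hyp_neq0_in c'v E'v E's).
(* Equality in the upper bound: by the Euclidean Stewart identity the sum of the squared defects is
   at most 0, so each coordinate is affine along g. In direction k it grows from 0 to 1, so it is
   not 0 at g s. *)
have moves : (1 - s) * (phi (inr k) (g s) - phi (inr k) pm) =
             s * (phi (inr k) pr - phi (inr k) (g s)).
  have F0 : \sum_(i | P i) ((1 - s) * (phi i (g s) - phi i pm) -
       s * (phi i pr - phi i (g s))) ^+ 2 <= 0.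
    have -> : \sum_(i | P i) ((1 - s) * (phi i (g s) - phi i pm) -
         s * (phi i pr - phi i (g s))) ^+ 2 =
       (1 - s) * \sum_(i | P i) (phi i (g s) - phi i pm) ^+ 2 +
       s * \sum_(i | P i) (phi i pr - phi i (g s)) ^+ 2 -
       s * (1 - s) * \sum_(i | P i) (phi i pr - phi i pm) ^+ 2.
      rewrite !mulr_sumr -big_split -sumrB/=; apply: eq_bigr => i _; ring.
    have a1 := lower (g s) pm; have a2 := lower pr (g s).
    rewrite (distC HC (g s)) dms in a1; rewrite (distC HC pr) dsr in a2.
    rewrite total.
    have t0 : 0 <= s by exact: ltW.
    have t1 : 0 <= 1 - s by case/andP: s01 => _ ?; rewrite subr_ge0.
    have := ler_wpM2l t1 a1; have := ler_wpM2l t0 a2.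
    have := ler_wpM2l (mulr_ge0 t0 t1) LE; rewrite !exprMn; lra.
  apply/eqP; rewrite -subr_eq0 -sqrf_eq0; apply/eqP.
  apply/eqP; rewrite eq_le sqr_ge0 andbT; apply: le_trans F0.
  rewrite [leRHS](bigD1 (inr k))//= lerDl; apply: sumr_ge0 => i _; exact: sqr_ge0.
move: moves; rewrite (phim (inr k) Tk) (phir (inr k) Tk) /= subr0 => moves hk0.
by move: moves; rewrite hk0; lra.
Qed.

End VertexStar.

(** * Break points *)

Section Retract.
Context {R : realType} {X : cube_complex R}.
Variables (p r e : R) (c : cell X) (v m P : points X) (al : 'I_(cell_dim c) -> R).
Variables K S : pred 'I_(cell_dim c).
Hypotheses (p0 : 0 < p) (cm : carrier c m) (cP : carrier c P) (r0 : 0 < r).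
Hypotheses (e0 : 0 < e) (e4 : e <= 4^-1) (al1 : \sum_j `|al j| `^ p = 1).
Hypothesis Pm : forall j, ocoord c v P j - ocoord c v m j = r * al j.

(** K holds the shared directions, in which P and Q lie on opposite sides of m: retracting both to e
    leaves a gap 2 e. In the other directions only one of the points moves, so it is left at 2 e.
    All gaps of the crossing are then 2 e r times a direction entry. *)
Definition level j : R := if K j then e else if S j then 2 * e else 0.

(* P' is obtained from P by retracting its coordinates to those of m, up to the
   fractions given by level. *)
Lemma retract : exists P', [/\ carrier c P',
  forall j, ocoord c v P' j = ocoord c v m j + r * level j * al j &
  let dl := \sum_(j | K j) `|al j| `^ p in
  let sm := \sum_(j | S j && ~~ K j) `|al j| `^ p in
  cell_dist p c P P' = r * (1 - dl - sm + (1 - e) `^ p * dl + (1 - 2 * e) `^ p * sm) `^ p^-1].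
Proof.
have l01 j : 0 <= level j <= 1.
  by move: e0 e4; rewrite /level; case: ifP => _; [lra|case: ifP => _; lra].
pose w j := ocoord c v m j + r * level j * al j.
have w01 j : 0 <= w j <= 1.
  have -> : w j = (1 - level j) * ocoord c v m j + level j * ocoord c v P j.
    by rewrite /w mulrAC -Pm; ring.
  have /andP[a0 a1] := ocoord01 v j cm; have /andP[b0 b1] := ocoord01 v j cP.
  have /andP[l0 l1] := l01 j; have l1' : 0 <= 1 - level j by rewrite subr_ge0.
  rewrite addr_ge0 ?mulr_ge0//=.
  by have := ler_wpM2l l1' a1; have := ler_wpM2l l0 b1; lra.
have oP j : ocoord c v (vpt v w) j = w j by exact: ocoord_vpt.
exists (vpt v w); split => //; first exact: carrier_vpt.
move=> dl sm.
have mass : cell_mass p c P (vpt v w) =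
    r `^ p * (1 - dl - sm + (1 - e) `^ p * dl + (1 - 2 * e) `^ p * sm).
  rewrite (cell_mass_ocoord _ _ v) -[X in X - dl]al1 /dl /sm (big_mkcond K).
  rewrite (big_mkcond (fun j => S j && ~~ K j)) !mulr_sumr -!sumrB -!big_split/= mulr_sumr.
  apply: eq_bigr => j _; rewrite oP /w.
  have -> : ocoord c v P j - (ocoord c v m j + r * level j * al j) = r * ((1 - level j) * al j).
    by rewrite opprD addrA Pm; ring.
  rewrite normrM powRM// (ger0_norm (ltW r0)) normrM powRM// (ger0_norm (x := 1 - level j)); last first.
    by rewrite subr_ge0; case/andP: (l01 j).
  congr (_ * _); rewrite /level; case: (boolP (K j)) => Kj /=; rewrite ?andbF ?andbT /=.
    by ring.
  by case: (S j); rewrite ?subr0 ?powR1; ring.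
rewrite cell_dist.unlock mass powRM ?powR_ge0 ?powRK ?(ltW r0)//.
by rewrite -(pmulr_rge0 _ (powR_gt0 p r0)) -mass cell_mass_ge0.
Qed.

End Retract.

Section Break.
Context {R : realType} {X : cube_complex R}.
Hypothesis X_CAT0 : CAT0_cube_complex X.
Implicit Types (E : cell X) (x y z w q n : points X) (s t e : R).

Let conn : forall x y : points X, exists l, string_length 2 x y l := proj1 X_CAT0.
Local Notation d := (lp_dist X 2).
Local Notation hyp := (edge_proj d).

Variables (p : R) (c c' : cell X) (v m : points X).
Variables (al : 'I_(cell_dim c) -> R) (be : 'I_(cell_dim c') -> R).
Hypotheses (p1 : 1 < p) (cv : is_vertex c v) (c'v : is_vertex c' v).
Hypotheses (cm : carrier c m) (c'm : carrier c' m).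
Hypothesis al1 : \sum_j `|al j| `^ p = 1.
Hypothesis be1 : \sum_k `|be k| `^ p = 1.
Hypothesis opposite : forall j k, nb c v j = nb c' v k -> al j + be k = 0.

Let p0 : 0 < p. Proof. exact: lt_trans ltr01 p1. Qed.
Let vc : carrier c v. Proof. by case: cv. Qed.
Let vc' : carrier c' v. Proof. by case: c'v. Qed.

Definition commonl j := `[< in_nb c' v (nb c v j) >].
Definition commonr k := `[< in_nb c v (nb c' v k) >].

Lemma sum_common :
  \sum_(j | commonl j) `|al j| `^ p = \sum_(k | commonr k) `|be k| `^ p.
Proof.
have ab j k : nb c v j = nb c' v k -> `|al j| `^ p = `|be k| `^ p.
  by move=> /opposite/eqP; rewrite addr_eq0 => /eqP ->; rewrite normrN.
apply/eqP; rewrite eq_le; apply/andP; split.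
  apply: (@sum_le_rel _ _ _ _ _ (fun j k => nb c v j = nb c' v k)).
  - by move=> j /asboolP[k e]; exists k => //; apply/asboolP; exists j.
  - by move=> j j' k _ _ e e'; apply: (nb_inj cv); rewrite e e'.
  - by move=> *; exact: powR_ge0.
  - by move=> j k _ _ /ab ->.
apply: (@sum_le_rel _ _ _ _ _ (fun k j => nb c v j = nb c' v k)).
- by move=> k /asboolP[j e]; exists j => //; apply/asboolP; exists k.
- by move=> k k' j _ _ e e'; apply: (nb_inj c'v); rewrite -e -e'.
- by move=> *; exact: powR_ge0.
- by move=> k j _ _ /ab ->.
Qed.

Lemma ocoord_commonl j k x : carrier c x -> carrier c' x -> nb c v j = nb c' v k ->
  ocoord c v x j = ocoord c' v x k.
Proof. by move=> cx c'x e; rewrite -!(hyp_own X_CAT0)// e. Qed.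

(* The affine function with slopes dual_pow al and dual_pow be is 1-Lipschitz on
   every cell containing m, and grows at unit speed along the broken path. *)
Lemma break_lower P Q r r' e : carrier c P -> carrier c' Q -> 0 <= r -> 0 <= r' ->
  (forall j, ocoord c v P j - ocoord c v m j = r * al j) ->
  (forall k, ocoord c' v Q k - ocoord c' v m k = r' * be k) ->
  (forall j, commonl j -> 0 < coords c m 0 j < 1) ->
  (forall E, carrier E m -> carrier E v ->
     \sum_(j | ~~ commonl j && `[< in_nb E v (nb c v j) >]) `|al j| `^ p +
     \sum_(k | `[< in_nb E v (nb c' v k) >]) `|be k| `^ p <= 1) ->
  star_radius m e -> r + (r + r') <= e -> r + r' <= lp_dist X p P Q.
Proof.
move=> cP c'Q r0 r'0 Pm Qm inner mass me le.
pose nbi (i : 'I_(cell_dim c) + 'I_(cell_dim c')) :=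
  match i with inl j => nb c v j | inr k => nb c' v k end.
pose phi i := hyp v (nbi i).
(* A shared direction is counted once, through c'. By [opposite] its slope there is also the one
   required on c, where the path runs from P to m and the sign in [G] is reversed. *)
pose A (i : 'I_(cell_dim c) + 'I_(cell_dim c')) :=
  match i with inl j => ~~ commonl j | inr _ => true end.
pose G (i : 'I_(cell_dim c) + 'I_(cell_dim c')) :=
  match i with inl j => - dual_pow p (al j) | inr k => dual_pow p (be k) end.
pose act E (i : 'I_(cell_dim c) + 'I_(cell_dim c')) :=
  `[< in_nb E v (nbi i) >].
pose F x := \sum_(i | A i) G i * phi i x.
have FB x y : F x - F y = \sum_(i | A i) G i * (phi i x - phi i y).
  by rewrite /F -sumrB; apply: eq_bigr => i _; rewrite mulrBr.
have sumE (H : 'I_(cell_dim c) + 'I_(cell_dim c') -> R) :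
    \sum_(i | A i) H i = \sum_(j | ~~ commonl j) H (inl j) + \sum_k H (inr k).
  exact: big_sumType.
have zero j x : ~~ commonl j -> carrier c' x -> hyp v (nb c v j) x = 0.
  by move=> /asboolP nj c'x; exact: (hyp_out X_CAT0 cv vc' c'x nj).
(* Unshared coordinates of m vanish since m lies in c', and shared ones are interior by [inner], so
   every cell at m contains v. *)
have vE E : carrier E m -> carrier E v.
  move=> Em; apply: (star_contains_vertex cv cm Em) => j mj; apply: inner.
  apply: contraT => nj; case: mj; rewrite -(hyp_own X_CAT0 cv j cm).
  exact: zero.
have FQ : F Q - F m = r'.
  rewrite FB sumE big1 => [|j nj]; last by rewrite /phi/= !zero// subrr mulr0.
  rewrite add0r -[RHS]mulr1 -be1 mulr_sumr; apply: eq_bigr => k _.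
  by rewrite /phi/= !(hyp_own X_CAT0 c'v)// Qm mulrCA dual_pow_mul.
have FP : F P - F m = - r.
  have -> : - r = - (r * \sum_(j | commonl j) `|al j| `^ p) -
      r * \sum_(j | ~~ commonl j) `|al j| `^ p.
    by rewrite -opprD -mulrDr -[in LHS](mulr1 r) -al1 [in LHS](bigID commonl).
  rewrite FB sumE addrC; congr (_ + _).
    rewrite (bigID commonr)/= [X in _ + X]big1 ?addr0 => [|k /asboolP nk]; last first.
      by rewrite /phi/= !(hyp_out X_CAT0 c'v vc _ nk)// subrr mulr0.
    rewrite sum_common mulr_sumr -sumrN; apply: eq_bigr => k /asboolP[j jk].
    rewrite /phi/= -jk !(hyp_own X_CAT0 cv)// Pm.
    have -> : al j = - be k by apply/eqP; rewrite -addr_eq0 opposite.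
    by rewrite !mulrN mulrCA dual_pow_mul.
  rewrite mulr_sumr -sumrN; apply: eq_bigr => j _.
  by rewrite /phi/= !(hyp_own X_CAT0 cv)// Pm mulNr mulrCA dual_pow_mul.
have dQ : F Q - F P = r + r' by rewrite -(subrKA (F m)) FQ -opprB FP; lra.
have dmP : cell_dist p c m P = r.
  rewrite cell_dist.unlock (cell_mass_ocoord _ _ v) -[RHS](powRK p0 r0); congr (_ `^ _).
  rewrite -[RHS]mulr1 -al1 mulr_sumr; apply: eq_bigr => j _.
  by rewrite distrC Pm normrM powRM// (ger0_norm r0).
rewrite -dQ; apply: (star_lower conn p1 me (D := fun a b => F b - F a) _ _ _ cm cP).
- by move=> x; rewrite subrr.
- by move=> x y w; lra.
- move=> E x y Em Ex Ey; have Ev := vE E Em.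
  have EV := is_vertex_in cv Ev.
  rewrite FB (bigID (act E))/= [X in _ + X]big1 ?addr0 => [|i /andP[_ /asboolP ni]]; last first.
    case: i ni => [j|k] /= ni; rewrite /phi/=.
      by rewrite !(hyp_out X_CAT0 cv Ev _ ni)// subrr mulr0.
    by rewrite !(hyp_out X_CAT0 c'v Ev _ ni)// subrr mulr0.
  apply: le_trans (holder_le _ p1 (conjugate_exponent p1) _) _.
    have -> : \sum_(i | A i && act E i) `|G i| `^ (p / (p - 1)) =
        \sum_(j | ~~ commonl j && act E (inl j)) `|al j| `^ p +
        \sum_(k | act E (inr k)) `|be k| `^ p.
      rewrite (@big_sumType _ _ _ _ _ (fun i => A i && act E i))/=; congr (_ + _).
        by apply: eq_bigr => j _; rewrite normrN dual_pow_norm.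
      by apply: eq_bigr => k _; rewrite dual_pow_norm.
    exact: mass.
  rewrite cell_distC -(@ler_powR2E _ p) ?cell_dist_ge0 ?powR_ge0// cell_distK// powRVK ?psum_ge0//.
  apply: (family_mass p0 Ey Ex) => [i _|i i' l a a' /andP[Ai /asboolP[l1 e1]]].
    case: i => [j|k]; rewrite /phi /=.
      by case: (hyp_cell X_CAT0 cv j E) => [|H]; [left|right; exact: H].
    by case: (hyp_cell X_CAT0 c'v k E) => [|H]; [left|right; exact: H].
  move=> /andP[Ai' /asboolP[l2 e2]]; rewrite /phi -e1 -e2 => H1 H2.
  have := hyp_distinct X_CAT0 EV H1 H2 => ll; rewrite ll e2 in e1.
  case: i i' Ai Ai' e1 {e2 H1 H2} => [i|i] [i'|i'] /= Ai Ai' e1.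
  - by congr inl; apply: (nb_inj cv).
  - by move/asboolP: Ai; case; exists i'.
  - by move/asboolP: Ai'; case; exists i.
  - by congr inr; apply: (nb_inj c'v).
- by rewrite dmP dQ.
Qed.

(** Retract P to P' and Q to Q' so that both lie in E. The path P, P', Q', Q is at least 2 r long
    for every small e, and its three lengths, divided by r, are bounded by the terms of
    [shortcut_real]. *)
Lemma break_mass P Q r E (S : pred 'I_(cell_dim c)) (T : pred 'I_(cell_dim c')) :
  carrier c P -> carrier c' Q -> 0 < r ->
  (forall j, ocoord c v P j - ocoord c v m j = r * al j) ->
  (forall k, ocoord c' v Q k - ocoord c' v m k = r * be k) ->
  2 * r <= lp_dist X p P Q -> carrier E v ->
  (forall j, commonl j -> S j) -> (forall k, T k -> ~~ commonr k) ->
  (forall j, S j -> in_nb E v (nb c v j)) -> (forall k, T k -> in_nb E v (nb c' v k)) ->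
  \sum_(j | S j) `|al j| `^ p + \sum_(k | T k) `|be k| `^ p <= 1.
Proof.
move=> cP c'Q r0 Pm Qm dPQ Ev CS TC SE TE.
pose dl := \sum_(j | commonl j) `|al j| `^ p.
pose sm := \sum_(j | S j && ~~ commonl j) `|al j| `^ p.
pose tm := \sum_(k | T k) `|be k| `^ p.
have SE' : \sum_(j | S j) `|al j| `^ p = dl + sm.
  rewrite (bigID commonl)/=; congr (_ + _); apply: eq_bigl => j.
  by case: (boolP (commonl j)) => [/CS ->|]; rewrite ?andbT ?andbF.
rewrite SE'; apply: (shortcut_real p1); rewrite ?psum_ge0//.
- by rewrite -SE' -al1 [leRHS](bigID S)/= lerDl psum_ge0.
- rewrite /dl sum_common -be1 [leRHS](bigID commonr)/= lerD2l.
  rewrite [leRHS](bigID T)/= (eq_bigl (fun k => ~~ commonr k && T k)) ?lerDl ?psum_ge0//.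
  by move=> k; case: (boolP (T k)) => [/TC ->|]; rewrite ?andbF.
move=> e e0 e4.
pose la := level e commonl S; pose mu := level e commonr T.
have [P' [cP' oP /=]] := retract commonl S p0 cm cP r0 e0 e4 al1 Pm.
rewrite -/la -/dl -/sm in oP * => dP.
have [Q' [c'Q' oQ /=]] := retract commonr T p0 c'm c'Q r0 e0 e4 be1 Qm.
rewrite -/mu in oQ; rewrite -sum_common -/dl (eq_bigl T) -/tm => [dQ|k]; last first.
  by apply: andb_idr => /TC.
have mc j : ~~ commonl j -> ocoord c v m j = 0.
  by move=> /asboolP nj; rewrite -(hyp_own X_CAT0 cv)// (hyp_out X_CAT0 cv vc' c'm nj).
have mc' k : ~~ commonr k -> ocoord c' v m k = 0.
  by move=> /asboolP nk; rewrite -(hyp_own X_CAT0 c'v)// (hyp_out X_CAT0 c'v vc cm nk).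
have EP' : carrier E P'.
  apply: (face_sub cv Ev cP') => j; rewrite oP /la /level => H.
  apply: SE; case: ifPn H => [/CS//|nj]; case: ifPn => // _.
  by rewrite mc// mulr0 mul0r addr0.
have EQ' : carrier E Q'.
  apply: (face_sub c'v Ev c'Q') => k; rewrite oQ /mu /level => H.
  case: ifPn H => [/asboolP[j e']|nk].
    by rewrite -e' => _; apply: SE; apply: CS; apply/asboolP; exists k.
  by case: ifPn => [/TE//|_]; rewrite mc'// mulr0 mul0r addr0.
have re0 : 0 <= 2 * e * r by rewrite !mulr_ge0 ?(ltW r0) ?(ltW e0)//.
have massE : cell_mass p E P' Q' <= (2 * e * r) `^ p * (dl + sm + tm).
  have EV := is_vertex_in cv Ev.
  rewrite (cell_mass_ocoord _ _ v) -SE' mulrDr !mulr_sumr.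
  pose nbi (i : 'I_(cell_dim c) + 'I_(cell_dim c')) :=
    match i with inl j => nb c v j | inr k => nb c' v k end.
  pose B (i : 'I_(cell_dim c) + 'I_(cell_dim c')) := match i with inl j => S j | inr k => T k end.
  pose H (i : 'I_(cell_dim c) + 'I_(cell_dim c')) :=
    (2 * e * r) `^ p * match i with inl j => `|al j| `^ p | inr k => `|be k| `^ p end.
  have -> : \sum_(j | S j) (2 * e * r) `^ p * `|al j| `^ p +
      \sum_(k | T k) (2 * e * r) `^ p * `|be k| `^ p = \sum_(i | B i) H i.
    by rewrite big_sumType.
  rewrite (bigID (fun i => ocoord E v P' i != ocoord E v Q' i))/= [X in _ + X]big1 ?addr0; last first.
    by move=> i /negPn/eqP ->; rewrite subrr normr0 powR0// gt_eqF.
  (* A coordinate in which P' and Q' differ comes from a direction in S or T, a shared one being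
     attributed to c; the difference is then the gap prepared by [level]. *)
  have val i : ocoord E v P' i != ocoord E v Q' i -> exists2 t, B t & nb E v i = nbi t /\
      `|ocoord E v P' i - ocoord E v Q' i| `^ p <= H t.
    move=> ne.
    have inc x j : carrier E x -> carrier c x -> nb c v j = nb E v i ->
        ocoord E v x i = ocoord c v x j.
      by move=> Ex cx e'; rewrite -(hyp_own X_CAT0 EV)// -(hyp_own X_CAT0 cv)// e'.
    have inc' x k : carrier E x -> carrier c' x -> nb c' v k = nb E v i ->
        ocoord E v x i = ocoord c' v x k.
      by move=> Ex cx e'; rewrite -(hyp_own X_CAT0 EV)// -(hyp_own X_CAT0 c'v)// e'.
    have bound a : `|2 * e * r * a| `^ p = (2 * e * r) `^ p * `|a| `^ p.
      by rewrite normrM powRM// (ger0_norm re0).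
    have [[j ej]|nc] := pselect (in_nb c v (nb E v i)).
      have [[k ek]|nc'] := pselect (in_nb c' v (nb E v i)).
        have Cj : commonl j by apply/asboolP; exists k; rewrite ek.
        have Ck : commonr k by apply/asboolP; exists j; rewrite ek.
        have jk : nb c v j = nb c' v k by rewrite ej ek.
        exists (inl j); [exact: CS|split; first by rewrite /= ej].
        rewrite (inc P' j)// (inc' Q' k)// oP oQ /la /mu /level Cj Ck (ocoord_commonl cm c'm jk).
        have -> : be k = - al j by apply/eqP; rewrite -addr_eq0 addrC; apply/eqP/opposite.
        rewrite /H -bound; apply: le_of_eq; congr (`|_| `^ _); ring.
      have Cj : ~~ commonl j by apply/asboolP; rewrite ej.
      move: ne; rewrite (inc P' j)// -(hyp_own X_CAT0 EV i EQ') (hyp_out X_CAT0 EV vc' c'Q' nc').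
      rewrite oP /la /level (negPf Cj) mc// add0r subr0.
      case: ifPn => [Sj _|_]; last by rewrite mulr0 mul0r eqxx.
      exists (inl j) => //; split; first by rewrite /= ej.
      by rewrite /H -bound; apply: le_of_eq; congr (`|_| `^ _); ring.
    move: ne; rewrite -(hyp_own X_CAT0 EV i EP') (hyp_out X_CAT0 EV vc cP' nc).
    have [[k ek]|nc'] := pselect (in_nb c' v (nb E v i)); last first.
      by rewrite -(hyp_own X_CAT0 EV i EQ') (hyp_out X_CAT0 EV vc' c'Q' nc') eqxx.
    have Ck : ~~ commonr k by apply/asboolP; rewrite ek.
    rewrite (inc' Q' k)// oQ /mu /level (negPf Ck) mc'// add0r sub0r normrN.
    case: ifPn => [Tk _|_]; last by rewrite mulr0 mul0r eqxx.
    exists (inr k) => //; split; first by rewrite /= ek.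
    by rewrite /H -bound; apply: le_of_eq; congr (`|_| `^ _); ring.
  apply: (sum_le_rel val).
  - by move=> i i' t _ _ [e1 _] [e2 _]; apply: (nb_inj EV); rewrite e1.
  - by move=> [j|k] _; rewrite mulr_ge0// powR_ge0.
  - by move=> i t _ _ [].
have d3 : lp_dist X p P Q <= cell_dist p c P P' + (cell_dist p E P' Q' + cell_dist p c' Q' Q).
  apply: lp_dist_le_string; do 2 apply: string_step => //; exact: string_one.
have M0 : 0 <= dl + sm + tm by rewrite !addr_ge0 ?psum_ge0.
have dE : cell_dist p E P' Q' <= 2 * e * r * (dl + sm + tm) `^ p^-1.
  have q0 : 0 <= 2 * e * r * (dl + sm + tm) `^ p^-1 by apply: mulr_ge0 => //; exact: powR_ge0.
  rewrite -(@ler_powR2E _ p) ?cell_dist_ge0//.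
  by rewrite cell_distK// powRM ?powR_ge0// powRVK.
rewrite -(ler_pM2l r0); move: dPQ d3; rewrite dP (cell_distC p c' Q') dQ; move: dE.
lra.
Qed.

End Break.

(** * The two conditions in terms of unit directions *)

Lemma row_combE (R : realType) n (a b : R) (A B C D : 'rV[R]_n) l :
  (a *: (A - B) + b *: (C - D)) 0 l = a * (A 0 l - B 0 l) + b * (C 0 l - D 0 l).
Proof. by rewrite !mxE. Qed.

Section Conditions.
Context {R : realType} {X : cube_complex R}.
Hypothesis X_CAT0 : CAT0_cube_complex X.
Implicit Types (E D c : cell X) (x y z w q n v : points X) (s t e : R).

Let i01 : 0 <= (0 : R) <= 1. Proof. by rewrite lexx ler01. Qed.
Local Notation d := (lp_dist X 2).
Local Notation hyp := (edge_proj d).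

Lemma face_atP c v (J : {set 'I_(cell_dim c)}) z : is_vertex c v ->
  face_at v J z <-> carrier c z /\ forall j, j \notin J -> ocoord c v z j = 0.
Proof.
move=> cv; split=> [[u [uu uJ] <-]|[cz zJ]].
  split=> [|j /uJ e]; first exact: carrier_chart.
  by rewrite /ocoord coords_chart// e -/(ocoord c v v j) ocoord_vertex.
exists (coords c z); last exact: chart_coords.
by split=> [|j /zJ/(ocoord_eq0 cv)//]; exact: coords_unit.
Qed.

Lemma ocoord_nb c v i j : is_vertex c v -> ocoord c v (nb c v j) i = if i == j then 1 else 0.
Proof. by move=> cv; rewrite ocoord_vdir ?lexx ?ler01. Qed.

Lemma nb_face_at c v (J : {set 'I_(cell_dim c)}) j : is_vertex c v ->
  face_at v J (nb c v j) <-> j \in J.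
Proof.
move=> cv; rewrite (face_atP _ _ cv); split=> [[_ H]|jJ].
  by apply: contraT => /H; rewrite ocoord_nb// eqxx => /eqP; rewrite oner_eq0.
split=> [|i iJ]; first by apply: carrier_nb; case: cv.
by rewrite ocoord_nb//; case: eqP => // ij; rewrite ij jJ in iJ.
Qed.

Lemma face_at_sub c c' v (S : {set 'I_(cell_dim c)}) (S' : {set 'I_(cell_dim c')}) :
  is_vertex c v -> is_vertex c' v ->
  (forall j, j \in S -> exists2 k, k \in S' & nb c' v k = nb c v j) ->
  face_at v S `<=` face_at v S'.
Proof.
move=> cv c'v H z /(face_atP _ _ cv)[cz zS].
have vc' : carrier c' v by case: c'v.
have inS j : ocoord c v z j <> 0 -> j \in S.
  by move=> zj; apply: contraT => /zS.
have c'z : carrier c' z.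
  by apply: (face_sub cv vc' cz) => j /inS/H[k _ e]; exists k.
apply/(face_atP _ _ c'v); split => // k kS'.
rewrite -(hyp_own X_CAT0 c'v)//; have vc : carrier c v by case: cv.
have [[j e]|nj] := pselect (in_nb c v (nb c' v k)); last exact: (hyp_out X_CAT0 c'v vc cz nj).
rewrite -e (hyp_own X_CAT0 cv)//; apply: zS; apply/negP => /H[k' k'S' e'].
by move: kS'; rewrite (_ : k = k') ?k'S'//; apply: (nb_inj c'v); rewrite e'.
Qed.

(** A cell E at v yields the largest product that it allows. Since [product_belongs] asks for a cube
    that is exactly the product, one passes to the face of E spanned by the directions of A and
    B. *)
Lemma product_from_cell c c' E v : is_vertex c v -> is_vertex c' v -> carrier E v ->
  product_belongs v [set k | `[< in_nb E v (nb c' v k) >]]%SET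
    [set j | ~~ commonl c' v j && `[< in_nb E v (nb c v j) >]]%SET.
Proof.
move=> cv c'v Ev; set B := [set k | _]%SET; set A := [set j | _]%SET.
have vc : carrier c v by case: cv.
have vc' : carrier c' v by case: c'v.
have EV : is_vertex E v := is_vertex_in cv Ev.
split.
  apply/seteqP; split=> [z [/(face_atP _ _ c'v)[c'z _] /(face_atP _ _ cv)[cz zA]]|z ->].
    apply: (ocoord_inj (v := v) cz vc) => j; rewrite ocoord_vertex//.
    have [jA|/zA//] := boolP (j \in A).
    move: jA; rewrite inE => /andP[/asboolP nj _].
    by rewrite -(hyp_own X_CAT0 cv)// (hyp_out X_CAT0 cv vc' c'z nj).
  by split; apply/face_atP => //; split => // j _; rewrite ocoord_vertex.
pose inJ n := (exists2 j, j \in A & nb c v j = n) \/ (exists2 k, k \in B & nb c' v k = n).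
pose J : {set 'I_(cell_dim E)} := [set i | `[< inJ (nb E v i) >]]%SET.
have [E' E'E] := cell_face J (proj2 EV).
have E'P z : carrier E' z <-> face_at v J z by rewrite /carrier E'E.
have E'v : carrier E' v.
  by apply/E'P/face_atP => //; split => // j _; rewrite ocoord_vertex.
have E'V := is_vertex_in cv E'v.
have nbE' n : inJ n -> exists i', nb E' v i' = n.
  move=> Jn; have [i ei] : in_nb E v n.
    by case: (Jn) => [[j + <-]|[k + <-]]; rewrite inE; [move=> /andP[_ /asboolP]|move/asboolP].
  have E'n : carrier E' (nb E v i).
    by apply/E'P/nb_face_at => //; rewrite inE; apply/asboolP; rewrite ei.
  have := nb_carrier_in X_CAT0 EV E'v E'n; by rewrite ei.
have inE' i' : inJ (nb E' v i').
  have E'n := carrier_nb i' E'v.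
  have En : carrier E (nb E' v i') by have /E'P/face_atP[] := E'n.
  have [i ei] := nb_carrier_in X_CAT0 E'V Ev En.
  have : face_at v J (nb E v i) by rewrite ei; exact/E'P.
  by rewrite nb_face_at// inE ei => /asboolP.
exists E' => //; pose K : {set 'I_(cell_dim E')} :=
  [set i' | `[< exists2 k, k \in B & nb c' v k = nb E' v i' >]]%SET.
exists K; split; apply/seteqP; split.
- by apply: face_at_sub => // i'; rewrite inE => /asboolP.
- apply: face_at_sub => // k kB; have [|i' e] := nbE' (nb c' v k); first by right; exists k.
  by exists i' => //; rewrite inE; apply/asboolP; exists k.
- apply: face_at_sub => // i'; rewrite !inE => /asboolP nk.
  by case: (inE' i') => // -[j jA e]; exists j.
- apply: face_at_sub => // j jA; have [|i' e] := nbE' (nb c v j); first by left; exists j.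
  exists i' => //; rewrite !inE; apply/asboolP => -[k _ e'].
  move: jA; rewrite inE => /andP[/asboolP[]]; exists k; by rewrite e' e.
Qed.

Lemma product_cell c c' v (B : {set 'I_(cell_dim c')}) (A : {set 'I_(cell_dim c)}) :
  is_vertex c v -> is_vertex c' v -> product_belongs v B A ->
  exists E, [/\ carrier E v, forall k, k \in B -> in_nb E v (nb c' v k),
    forall j, j \in A -> in_nb E v (nb c v j) &
    forall j k, j \in A -> k \in B -> nb c v j <> nb c' v k].
Proof.
move=> cv c'v [_ [E Ev [K [KB KA]]]].
have EV : is_vertex E v := is_vertex_in cv Ev.
have inB k : k \in B -> exists2 i, i \in K & nb E v i = nb c' v k.
  move=> kB; have : face_at v K (nb c' v k) by rewrite KB; apply/nb_face_at.
  move=> H; have /face_atP[//|En _] := H.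
  have [i e] := nb_carrier_in X_CAT0 c'v Ev En.
  by exists i => //; rewrite -e in H; exact/(nb_face_at _ _ EV).
have inA j : j \in A -> exists2 i, i \in (~: K)%SET & nb E v i = nb c v j.
  move=> jA; have : face_at v (~: K)%SET (nb c v j) by rewrite KA; apply/nb_face_at.
  move=> H; have /face_atP[//|En _] := H.
  have [i e] := nb_carrier_in X_CAT0 cv Ev En.
  by exists i => //; rewrite -e in H; exact/(nb_face_at _ _ EV).
exists E; split => //.
- by move=> k /inB[i _ e]; exists i.
- by move=> j /inA[i _ e]; exists i.
- move=> j k /inA[i iK ei] /inB[i' i'K ei'] e.
  move: iK; rewrite inE (_ : i = i') ?i'K//; apply: (nb_inj EV).
  by rewrite ei ei'.
Qed.

Lemma ratio_geE (a b a' b' : R) : 0 <= a -> 0 <= b -> 0 <= a' -> 0 <= b' ->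
  ratio_ge a b a' b' <-> b * a' <= a * b'.
Proof.
move=> a0 b0 a'0 b'0; rewrite /ratio_ge.
have [->|bn] := eqVneq b 0; first by rewrite /= .
have [->|b'n] := eqVneq b' 0; first by rewrite /= .
have bp : 0 < b by rewrite lt_neqAle eq_sym bn.
have b'p : 0 < b' by rewrite lt_neqAle eq_sym b'n.
by rewrite /= ler_pdivrMr// mulrAC ler_pdivlMr// mulrC.
Qed.

(** The squared distance from a to a point of the face D is the sum over the directions of D plus
    the constant [Kst], so the projection keeps the coordinates in D. Read through [hyp] they no
    longer depend on c. *)
Lemma proj_hyp c D v a l : is_vertex c v -> carrier D v -> carrier D `<=` carrier c ->
  carrier c a -> flip (coords D v 0 l == 1) (proj c D a 0 l) = hyp v (nb D v l) a.
Proof.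
move=> cv Dv Dc ca; have DV : is_vertex D v := is_vertex_in cv Dv.
have vc : carrier c v by case: cv.
have exf l' : exists j, nb c v j = nb D v l'.
  exact: (nb_carrier_in X_CAT0 DV vc (Dc _ (carrier_nb l' Dv))).
pose f l' := projT1 (cid (exf l')).
have fE l' : nb c v (f l') = nb D v l' by exact: projT2 (cid (exf l')).
have injf : injective f by move=> l1 l2 e; apply: (nb_inj DV); rewrite -!fE e.
pose o l' := hyp v (nb D v l') a.
have oE l' : o l' = ocoord c v a (f l') by rewrite /o -fE; exact: hyp_own.
pose q0 : 'rV[R]_(cell_dim D) := \row_l' flip (coords D v 0 l' == 1) (o l').
have q0u : unit_cube q0 by move=> l'; rewrite mxE flip01 oE; exact: ocoord01.
pose Kst := \sum_(j | j \notin codom f) ocoord c v a j ^+ 2.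
have mass (q : 'rV[R]_(cell_dim D)) : unit_cube q -> cell_mass 2 c a (chart D q) =
    \sum_l' (o l' - flip (coords D v 0 l' == 1) (q 0 l')) ^+ 2 + Kst.
  move=> qu; have Dq := carrier_chart qu; have cq := Dc _ Dq.
  rewrite (cell_mass2_sq _ v) (sum_split_image _ injf); congr (_ + _).
    apply: eq_bigr => l' _; rewrite oE; congr ((_ - _) ^+ 2).
    rewrite -(hyp_own X_CAT0 cv)// fE (hyp_own X_CAT0 DV)// /ocoord.
    by rewrite coords_chart.
  apply: eq_bigr => j nj; rewrite [X in _ - X](_ : _ = 0) ?subr0//.
  rewrite -(hyp_own X_CAT0 cv)//; apply: (hyp_out X_CAT0 cv Dv Dq) => -[l' e].
  by case/negP: nj; apply/codomP; exists l'; apply: (nb_inj cv); rewrite fE.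
have euc (q : 'rV[R]_(cell_dim D)) : unit_cube q -> euclid_dist (coords c a) (coords c (chart D q)) =
    (\sum_l' (o l' - flip (coords D v 0 l' == 1) (q 0 l')) ^+ 2 + Kst) `^ 2^-1.
  by move=> qu; rewrite /euclid_dist lp_norm_coords cell_dist.unlock mass.
have q0z : \sum_l' (o l' - flip (coords D v 0 l' == 1) (q0 0 l')) ^+ 2 = 0.
  by rewrite big1// => l' _; rewrite mxE flipK subrr expr0n.
have K0 : 0 <= Kst by apply: sumr_ge0 => *; exact: sqr_ge0.
have S0 (q : 'rV[R]_(cell_dim D)) : 0 <= \sum_l' (o l' - flip (coords D v 0 l' == 1) (q 0 l')) ^+ 2 :> R.
  by apply: sumr_ge0 => *; exact: sqr_ge0.
rewrite /proj; case: xgetP => [q _ [qu qm]|/(_ q0)[]]; last first.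
  split; first exact: q0u.
  move=> r ru; rewrite (euc r ru) (euc q0 q0u) q0z add0r.
  rewrite ler_powR2E ?invr_gt0 ?ltr0n//; first by rewrite lerDr.
  by rewrite addr_ge0.
have le0 : \sum_l' (o l' - flip (coords D v 0 l' == 1) (q 0 l')) ^+ 2 <= 0.
  have := qm q0 q0u; rewrite (euc q qu) (euc q0 q0u) q0z add0r.
  rewrite ler_powR2E ?invr_gt0 ?ltr0n//; first by rewrite gerDr.
  by rewrite addr_ge0.
have : (o l - flip (coords D v 0 l == 1) (q 0 l)) ^+ 2 <= 0.
  apply: le_trans le0; rewrite [leRHS](bigD1 l)//= lerDl.
  by apply: sumr_ge0 => *; exact: sqr_ge0.
move=> h; apply/esym/eqP; rewrite -subr_eq0 -sqrf_eq0 eq_le h sqr_ge0//.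
Qed.

Lemma meet_cell c c' x : carrier c x -> carrier c' x ->
  exists D, carrier D = carrier c `&` carrier c'.
Proof.
move=> cx c'x; have [w [J [vw F]]] := meet_face cx c'x.
have [D DE] := cell_face J vw; exists D; rewrite /carrier DE; apply/seteqP; split.
  move=> _ [u [uu uJ] <-]; split; first exact: carrier_chart.
  by apply/(F _ (carrier_chart uu)); rewrite coords_chart.
move=> z [cz c'z]; exists (coords c z); last exact: chart_coords.
by split; [exact: coords_unit|exact: (F z cz).1].
Qed.

Section Direction.
Variables (p : R) (c : cell X) (v x m : points X).
Hypotheses (p0 : 0 < p) (cx : carrier c x) (cm : carrier c m) (xm : x <> m).

Let L := cell_dist p c x m.
Let Lp : 0 < L. Proof. exact: cell_dist_gt0. Qed.

(* The unit direction, at m, of the segment from m to x. *)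
Definition dir j := (ocoord c v x j - ocoord c v m j) / cell_dist p c x m.

Lemma dirE j : ocoord c v x j - ocoord c v m j = L * dir j.
Proof. by rewrite /dir mulrC divfK// gt_eqF. Qed.

Lemma dir_mass : \sum_j `|dir j| `^ p = 1.
Proof.
apply: psum_normalize => //; rewrite (cell_distK _ _ _ p0) (cell_mass_ocoord _ _ v).
by [].
Qed.

Lemma dist_along_dir (J : {set 'I_(cell_dim c)}) :
  dist_along p J x m = L * (\sum_(j in J) `|dir j| `^ p) `^ p^-1.
Proof.
rewrite /dist_along /lp_norm -[in RHS](powRK p0 (ltW Lp)) -powRM ?powR_ge0 ?psum_ge0// mulr_sumr.
congr (_ `^ _); apply: eq_bigr => j _; rewrite !mxE -(flipB (coords c v 0 j == 1)).
by rewrite [X in `|X|]dirE [in LHS]normrM [in LHS]powRM// (ger0_norm (ltW Lp)).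
Qed.

Lemma ratio01 r : 0 <= r <= L -> 0 <= r / L <= 1.
Proof. by move=> /andP[r0 rL]; rewrite divr_ge0 ?(ltW Lp)// ler_pdivrMr// mul1r. Qed.

Lemma carrier_toward r : 0 <= r <= L -> carrier c (cell_seg c m x (r / L)).
Proof. by move=> rL; apply: carrier_seg; rewrite ?ratio01. Qed.

Lemma ocoord_toward r j : 0 <= r <= L ->
  ocoord c v (cell_seg c m x (r / L)) j - ocoord c v m j = r * dir j.
Proof.
move=> rL; rewrite /ocoord coords_seg ?ratio01// flip_conv -!/(ocoord _ _ _ _).
transitivity (r / L * (ocoord c v x j - ocoord c v m j)); first by ring.
by rewrite dirE mulrA divfK// gt_eqF.
Qed.

Lemma cell_dist_toward r : 0 <= r <= L -> cell_dist p c (cell_seg c m x (r / L)) m = r.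
Proof.
move=> rL; rewrite -[X in cell_dist _ _ _ X](cell_seg0 x cm) cell_dist_seg ?ratio01//.
rewrite subr0 cell_distC -/L ger0_norm ?divfK ?gt_eqF//.
by case/andP: (ratio01 rL).
Qed.

End Direction.

Section AtBreak.
Variables (p : R) (c c' : cell X) (v x m y : points X).
Hypotheses (p1 : 1 < p) (cv : is_vertex c v) (c'v : is_vertex c' v).
Hypotheses (cx : carrier c x) (cm : carrier c m) (c'm : carrier c' m) (c'y : carrier c' y).
Hypotheses (xm : x <> m) (ym : y <> m).

Let p0 : 0 < p. Proof. exact: lt_trans ltr01 p1. Qed.
Let vc : carrier c v. Proof. by case: cv. Qed.
Let vc' : carrier c' v. Proof. by case: c'v. Qed.

Let r1 := cell_dist p c x m.
Let r2 := cell_dist p c' y m.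
Let r1p : 0 < r1. Proof. exact: cell_dist_gt0. Qed.
Let r2p : 0 < r2. Proof. exact: cell_dist_gt0. Qed.

Local Notation al := (@dir p c v x m).
Local Notation be := (@dir p c' v y m).

(** The entry l of the tension vector is, up to sign, the sum of the direction entries of c and c'
    along the edge l of D. *)
Lemma zero_tension_iff : zero_tension p c c' x m y <->
  forall j k, nb c v j = nb c' v k -> al j + be k = 0.
Proof.
rewrite /zero_tension (cell_isometric X_CAT0 p1 cx cm) (cell_isometric X_CAT0 p1 c'y c'm).
have entry D l : carrier D = carrier c `&` carrier c' ->
    (r1^-1 *: (proj c D x - proj c D m) + r2^-1 *: (proj c' D y - proj c' D m)) 0 l = 0 <->
    (forall j k, nb c v j = nb D v l -> nb c' v k = nb D v l -> al j + be k = 0).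
  move=> DE; have Dv : carrier D v by rewrite DE.
  have Dc : carrier D `<=` carrier c by move=> z; rewrite DE => -[].
  have Dc' : carrier D `<=` carrier c' by move=> z; rewrite DE => -[].
  have DV := is_vertex_in cv Dv; set b := coords D v 0 l == 1.
  have pl a : carrier c a -> proj c D a 0 l = flip b (hyp v (nb D v l) a).
    by move=> ca; rewrite -(proj_hyp l cv Dv Dc ca) flipK.
  have pr a : carrier c' a -> proj c' D a 0 l = flip b (hyp v (nb D v l) a).
    by move=> ca; rewrite -(proj_hyp l c'v Dv Dc' ca) flipK.
  have [j ej] := nb_carrier_in X_CAT0 DV vc (Dc _ (carrier_nb l Dv)).
  have [k ek] := nb_carrier_in X_CAT0 DV vc' (Dc' _ (carrier_nb l Dv)).
  have -> : (r1^-1 *: (proj c D x - proj c D m) + r2^-1 *: (proj c' D y - proj c' D m)) 0 l =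
      r1^-1 * (flip b (hyp v (nb D v l) x) - flip b (hyp v (nb D v l) m)) +
      r2^-1 * (flip b (hyp v (nb D v l) y) - flip b (hyp v (nb D v l) m)).
    rewrite row_combE; congr (_ * (_ - _) + _ * (_ - _)).
    - exact: pl.
    - exact: pl.
    - exact: pr.
    - exact: pr.
  have -> : r1^-1 * (flip b (hyp v (nb D v l) x) - flip b (hyp v (nb D v l) m)) +
      r2^-1 * (flip b (hyp v (nb D v l) y) - flip b (hyp v (nb D v l) m)) =
      (if b then -1 else 1) * (al j + be k).
    rewrite /dir -!(hyp_own X_CAT0 cv)// -!(hyp_own X_CAT0 c'v)// ej ek -/r1 -/r2.
    by rewrite /flip; case: (b); ring.
  split=> [/eqP|H]; last by rewrite H ?mulr0.
  rewrite mulf_eq0; case: (b); rewrite ?oppr_eq0 oner_eq0 /= => /eqP e j' k' ej' ek'.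
    by rewrite (_ : j' = j) 1?(_ : k' = k)//; [apply: (nb_inj c'v); rewrite ek|apply: (nb_inj cv); rewrite ej].
  by rewrite (_ : j' = j) 1?(_ : k' = k)//; [apply: (nb_inj c'v); rewrite ek|apply: (nb_inj cv); rewrite ej].
split=> [[D DE e] j k jk|H].
  have Dv : carrier D v by rewrite DE.
  have Dn : carrier D (nb c v j).
    by rewrite DE; split; [exact: carrier_nb|rewrite jk; exact: carrier_nb].
  have [l el] := nb_carrier_in X_CAT0 cv Dv Dn.
  have /(entry D l DE) : (r1^-1 *: (proj c D x - proj c D m) +
      r2^-1 *: (proj c' D y - proj c' D m)) 0 l = 0 by rewrite e mxE.
  by apply; rewrite el.
have [D DE] := meet_cell cm c'm; exists D => //; apply/rowP => l; rewrite [RHS]mxE.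
by apply/(entry D l DE) => j k ej ek; apply: H; rewrite ej.
Qed.

(** Let s and t be the masses of the unit directions in A2 and B1. The complements have masses 1 - s
    and 1 - t, so the ratio inequality says s t <= (1 - s)(1 - t), which is s + t <= 1. *)
Lemma no_shortcut_iff : no_shortcut p c c' v x m y <->
  forall (A : {set 'I_(cell_dim c)}) (B : {set 'I_(cell_dim c')}), product_belongs v B A ->
    \sum_(j in A) `|al j| `^ p + \sum_(k in B) `|be k| `^ p <= 1.
Proof.
have compl (I : finType) (F : I -> R) (S : {set I}) : \sum_i F i = 1 ->
    \sum_(i in (~: S)%SET) F i = 1 - \sum_(i in S) F i.
  move=> <-; rewrite [in RHS](bigID (mem S))/= addrAC subrr add0r.
  by apply: eq_bigl => i; rewrite inE.
have key (A : {set 'I_(cell_dim c)}) (B : {set 'I_(cell_dim c')}) :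
    ratio_ge (dist_along p (~: A)%SET x m) (dist_along p B y m)
             (dist_along p A x m) (dist_along p (~: B)%SET y m) <->
    \sum_(j in A) `|al j| `^ p + \sum_(k in B) `|be k| `^ p <= 1.
  rewrite !(dist_along_dir v p0 cx cm xm) !(dist_along_dir v p0 c'y c'm ym) -/r1 -/r2.
  rewrite ratio_geE ?mulr_ge0 ?powR_ge0 ?(ltW r1p) ?(ltW r2p)//.
  rewrite (compl _ _ A (dir_mass v p0 cx cm xm)) (compl _ _ B (dir_mass v p0 c'y c'm ym)).
  have s0 := psum_ge0 p (mem A) al; have t0 := psum_ge0 p (mem B) be.
  have s1 : 0 <= 1 - \sum_(j in A) `|al j| `^ p.
    by rewrite -(compl _ _ A (dir_mass v p0 cx cm xm)) psum_ge0.
  have t1 : 0 <= 1 - \sum_(k in B) `|be k| `^ p.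
    by rewrite -(compl _ _ B (dir_mass v p0 c'y c'm ym)) psum_ge0.
  move: (\sum_(j in A) _) (\sum_(k in B) _) s0 t0 s1 t1 => s t s0 t0 s1 t1.
  rewrite mulrACA [leRHS]mulrACA [r2 * r1]mulrC ler_pM2l ?mulr_gt0// -!powRM//.
  rewrite ler_powR2E ?mulr_ge0 ?invr_gt0//.
  by split; lra.
split=> [H A B pb|H A1 A2 B1 B2 A2E B2E pb].
  by apply/key/H => //; rewrite finset.setCK.
by rewrite B2E (_ : A1 = (~: A2)%SET); [apply/key/H|rewrite A2E finset.setCK].
Qed.

End AtBreak.
End Conditions.

(** * Both conditions characterise a straight break *)

Section BrokenSegment.
Context {R : realType} {X : cube_complex R}.
Hypothesis X_CAT0 : CAT0_cube_complex X.
Implicit Types (E c : cell X) (x y z m v : points X) (s t e r : R).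

Lemma vertex_of_is_vertex c v : vertex_of c v -> is_vertex c v.
Proof.
move=> [w vw <-]; have uw := cube_vertex_unit vw.
by split; [exact: carrier_chart|rewrite coords_chart].
Qed.

Lemma cell_seg_rev c x y t : cell_seg c x y (1 - t) = cell_seg c y x t.
Proof. by rewrite /cell_seg (_ : 1 - (1 - t) = t) 1?addrC//; ring. Qed.

(* Otherwise both points lie in a smaller face. *)
Lemma minimal_cube_neq c x y j : minimal_cube c x y ->
  coords c y 0 j = 0 \/ coords c y 0 j = 1 -> coords c x 0 j <> coords c y 0 j.
Proof.
move=> [cx cy min] yj xyj; pose a := coords c y 0 j.
pose w : 'rV[R]_(cell_dim c) := \row_i (if i == j then a else 0).
have vw : cube_vertex w by move=> i; rewrite mxE; case: eqP => // _; left.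
have [c1 c1E] := cell_face [set~ j]%SET vw.
have c1P z : carrier c z -> coords c z 0 j = a -> carrier c1 z.
  move=> cz zj; rewrite /carrier c1E; exists (coords c z); last exact: chart_coords.
  by split=> [|i]; [exact: coords_unit|rewrite !inE negbK => /eqP ->; rewrite mxE eqxx].
have sub := min c1 (c1P _ cx xyj) (c1P _ cy erefl).
pose u : 'rV[R]_(cell_dim c) := \row_i (if i == j then 1 - a else 0).
have uu : unit_cube u.
  by move=> i; rewrite mxE; case: eqP => _; [rewrite /a; case: yj => ->|]; lra.
have := sub _ (carrier_chart uu); rewrite /carrier c1E => -[u' [uu' u'E]].
move=> /(chart_inj uu' uu) e; have := u'E j; rewrite !inE eqxx e !mxE eqxx => /(_ isT).
by rewrite /a; case: yj => ->; lra.
Qed.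

Variables (p : R) (c c' : cell X) (v x m y : points X).
Hypotheses (p1 : 1 < p) (cv : is_vertex c v) (c'v : is_vertex c' v).
Hypotheses (cx : carrier c x) (cm : carrier c m) (c'm : carrier c' m) (c'y : carrier c' y).
Hypotheses (xm : x <> m) (ym : y <> m).

Let p0 : 0 < p. Proof. exact: lt_trans ltr01 p1. Qed.
Let vc : carrier c v. Proof. by case: cv. Qed.
Let vc' : carrier c' v. Proof. by case: c'v. Qed.

Local Notation al := (@dir _ _ p c v x m).
Local Notation be := (@dir _ _ p c' v y m).

Let r1 := cell_dist p c x m.
Let r2 := cell_dist p c' y m.
Let r1p : 0 < r1. Proof. exact: cell_dist_gt0. Qed.
Let r2p : 0 < r2. Proof. exact: cell_dist_gt0. Qed.

Lemma broken_dist_le r r' : 0 <= r <= r1 -> 0 <= r' <= r2 ->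
  lp_dist X p (cell_seg c m x (r / r1)) (cell_seg c' m y (r' / r2)) <= r + r'.
Proof.
move=> rl rr; apply: lp_dist_le_string.
rewrite -{2}(cell_dist_toward p0 cx cm xm rl) -{2}(cell_dist_toward p0 c'y c'm ym rr).
apply: string_step => //; first exact: carrier_toward.
by rewrite cell_distC; apply: string_one => //; exact: carrier_toward.
Qed.

(** The midpoint [q] of the shared edge certifies that the direction is common to both cells, and
    the tension is evaluated at m between points at distance r. *)
Lemma straight_opposite r j k : 0 < r -> r <= r1 -> r <= r2 ->
  2 * r <= lp_dist X p (cell_seg c m x (r / r1)) (cell_seg c' m y (r / r2)) ->
  nb c v j = nb c' v k -> al j + be k = 0.
Proof.
move=> r0 rr1 rr2 far jk.
have rl : 0 <= r <= r1 by rewrite (ltW r0).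
have rr : 0 <= r <= r2 by rewrite (ltW r0).
have half : 0 <= (2^-1 : R) <= 1 by lra.
pose q := vdir c v j 2^-1.
have cq : carrier c q by exact: vdir01.
have c'q : carrier c' q.
  apply: (face_sub cv vc' cq) => i; rewrite ocoord_vdir//; case: eqP => // -> _.
  by exists k.
have cP : carrier c (cell_seg c m x (r / r1)) by exact: carrier_toward.
have c'Q : carrier c' (cell_seg c' m y (r / r2)) by exact: carrier_toward.
have h2 := hyp_coord_on X_CAT0 c'v k; rewrite -jk in h2.
have hq : 0 < edge_proj (lp_dist X 2) v (nb c v j) q < 1.
  by rewrite (hyp_own X_CAT0 cv)// ocoord_vdir// eqxx; lra.
have := zero_tension_coord p1 (hyp_coord_on X_CAT0 cv j) h2 cq c'q hq cm c'm cP c'Q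
  (cell_dist_toward p0 cx cm xm rl)
  (cell_dist_toward p0 c'y c'm ym rr) far.
rewrite (hyp_own X_CAT0 cv j cP) (hyp_own X_CAT0 cv j cm) jk (hyp_own X_CAT0 c'v k c'Q).
have := ocoord_toward v p0 cx cm xm j rl; have := ocoord_toward v p0 c'y c'm ym k rr; have := ocoord_commonl X_CAT0 cv c'v cm c'm jk.
move=> e e2 e3 e4; have : r * (al j + be k) = 0 by rewrite mulrDr -e2 -e3 -e; lra.
by move=> /eqP; rewrite mulf_eq0 gt_eqF//= => /eqP.
Qed.

Lemma straight_conditions r : 0 < r -> r <= r1 -> r <= r2 ->
  2 * r <= lp_dist X p (cell_seg c m x (r / r1)) (cell_seg c' m y (r / r2)) ->
  zero_tension p c c' x m y /\ no_shortcut p c c' v x m y.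
Proof.
move=> r0 rr1 rr2 far.
have rl : 0 <= r <= r1 by rewrite (ltW r0).
have rr : 0 <= r <= r2 by rewrite (ltW r0).
have cP : carrier c (cell_seg c m x (r / r1)) by exact: carrier_toward.
have c'Q : carrier c' (cell_seg c' m y (r / r2)) by exact: carrier_toward.
have opp j k := @straight_opposite r j k r0 rr1 rr2 far.
split; first exact/(zero_tension_iff X_CAT0 p1 cv c'v cx cm c'm c'y).
apply/(no_shortcut_iff v p1 cx cm c'm c'y xm ym) => A B pb.
have [E [Ev EB EA AB]] := product_cell X_CAT0 cv c'v pb.
(* Shared directions lie in c and in c', those of A and B in E; the flag property collects all of
   them in E'. *)
pose S j := commonl c' v j || (j \in A).
pose T k := (k \in B) && ~~ commonr c v k.
have [||E' [E'v E'S E'T]] := @flag_cell _ _ X_CAT0 c c' E v S T cv c'v Ev.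
- by move=> j /orP[/asboolP|/EA]; [left|right].
- by move=> k /andP[/EB Ek /asboolP].
have := break_mass X_CAT0 p1 cv c'v cm c'm (dir_mass v p0 cx cm xm)
  (dir_mass v p0 c'y c'm ym) opp (S := S) (T := T) cP c'Q r0
  (fun j => ocoord_toward v p0 cx cm xm j rl) (fun k => ocoord_toward v p0 c'y c'm ym k rr) far E'v.
move=> /(_ (fun j Cj => introT orP (or_introl Cj)) (fun k Tk => proj2 (andP Tk)) E'S E'T).
apply: le_trans.
rewrite (bigID (mem A) S)/= (bigID (commonr c v) (mem B))/= [in leRHS]addrAC -!addrA.
rewrite (eq_bigl (fun j => S j && (j \in A))) => [|j]; last first.
  by rewrite /S; case: (j \in A); rewrite ?orbT ?andbF.
rewrite lerD2l [leRHS]addrC lerD2r.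
(* A shared direction in B is, seen from c, a shared direction outside A, and [opp] gives it the
   same weight; so it is already counted in S. *)
apply: (@sum_le_rel _ _ _ _ _ (fun k j => nb c v j = nb c' v k)).
- move=> k /andP[kB /asboolP[j e]]; exists j => //; apply/andP; split.
    by apply/orP; left; apply/asboolP; exists k.
  by apply/negP => jA; exact: (AB j k jA kB).
- by move=> k k' j _ _ e e'; apply: (nb_inj c'v); rewrite -e -e'.
- by move=> *; exact: powR_ge0.
- by move=> k j _ _ /opp/eqP; rewrite addr_eq0 => /eqP ->; rewrite normrN.
Qed.

(** At an end of the interval both segments could only leave m in the same sense; being opposite,
    both entries are 0, so x and m agree in a coordinate 0 or 1, against the minimality of c. *)
Lemma common_interior j : minimal_cube c x m -> zero_tension p c c' x m y ->
  commonl c' v j -> 0 < coords c m 0 j < 1.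
Proof.
move=> min /(zero_tension_iff X_CAT0 p1 cv c'v cx cm c'm c'y) opp /asboolP[k kj].
have /eqP := opp j k (esym kj); rewrite addr_eq0 => /eqP ab.
have mm := ocoord_commonl X_CAT0 cv c'v cm c'm (esym kj).
have xE := dirE v p0 cx cm xm j; have yE := dirE v p0 c'y c'm ym k; rewrite -mm in yE.
have H : ~ (coords c m 0 j = 0 \/ coords c m 0 j = 1).
  move=> mj; apply: (minimal_cube_neq min mj).
  apply: (flip_inj (b := coords c v 0 j == 1)); apply/eqP.
  rewrite -subr_eq0 -/(ocoord c v x j) -/(ocoord c v m j) xE.
  have /andP[x0 x1] := ocoord01 v j cx; have /andP[y0 y1] := ocoord01 v k c'y.
  have : ocoord c v m j = 0 \/ ocoord c v m j = 1.
    rewrite /ocoord /flip; case: mj => ->; case: eqP => _; rewrite ?subr0 ?subrr; by [left|right].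
  case=> mE; rewrite mE in xE yE; rewrite mulf_eq0; apply/orP; right.
    have a0 : 0 <= r1 * al j by rewrite -[r1 * al j]xE subr0.
    have b0 : 0 <= r2 * be k by rewrite -[r2 * be k]yE subr0.
    rewrite pmulr_rge0// in a0; rewrite pmulr_rge0// in b0.
    by rewrite eq_le a0 ab oppr_le0 b0.
  have a0 : r1 * al j <= 0 by rewrite -[r1 * al j]xE subr_le0.
  have b0 : r2 * be k <= 0 by rewrite -[r2 * be k]yE subr_le0.
  rewrite pmulr_rle0// in a0; rewrite pmulr_rle0// in b0.
  by rewrite eq_le a0 ab oppr_ge0 b0.
have /andP[m0 m1] := coords_unit cm j.
by rewrite !lt_neqAle m0 m1 !andbT; apply/andP; split; apply/eqP => e; apply: H; [left|right].
Qed.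

Lemma conditions_straight : minimal_cube c x m -> zero_tension p c c' x m y ->
  no_shortcut p c c' v x m y ->
  exists2 e, 0 < e & [/\ e <= r1, e <= r2 & forall r r', 0 <= r <= e -> 0 <= r' <= e ->
    lp_dist X p (cell_seg c m x (r / r1)) (cell_seg c' m y (r' / r2)) = r + r'].
Proof.
move=> min zt ns; have [e0 me0] := star_radius_ex m.
have e00 : 0 < e0 by case: me0 => /andP[].
(* [break_lower] asks for r + (r + r') <= e0. *)
have e3 : 0 < e0 / 3 by rewrite divr_gt0.
exists (Num.min (e0 / 3) (Num.min r1 r2)).
  by rewrite !lt_min e3 r1p r2p.
split; [by rewrite !ge_min lexx !orbT|by rewrite !ge_min lexx !orbT|].
move=> r r'; rewrite !le_min => /and4P[r0 re rr1 rr2] /and4P[r'0 r'e r'r1 r'r2].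
have rl : 0 <= r <= r1 by rewrite r0.
have rr : 0 <= r' <= r2 by rewrite r'0.
have cP : carrier c (cell_seg c m x (r / r1)) by exact: carrier_toward.
have c'Q : carrier c' (cell_seg c' m y (r' / r2)) by exact: carrier_toward.
apply/eqP; rewrite eq_le broken_dist_le//=.
apply: (break_lower X_CAT0 p1 cv c'v cm c'm (dir_mass v p0 cx cm xm)
  (dir_mass v p0 c'y c'm ym) _ cP c'Q r0 r'0 (fun j => ocoord_toward v p0 cx cm xm j rl)
  (fun k => ocoord_toward v p0 c'y c'm ym k rr) _ _ me0).
- exact/(zero_tension_iff X_CAT0 p1 cv c'v cx cm c'm c'y).
- by move=> j; exact: common_interior.
- move=> E Em Ev; have pb := product_from_cell X_CAT0 cv c'v Ev.
  have := (no_shortcut_iff v p1 cx cm c'm c'y xm ym).1 ns _ _ pb.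
  apply: le_trans; rewrite le_eqVlt; apply/orP; left; apply/eqP.
  by congr (_ + _); apply: eq_bigl => j; rewrite inE.
- by lra.
Qed.

End BrokenSegment.

(** * Paths *)

Section LpDistSym.
Context {R : realType} {X : cube_complex R}.
Implicit Types (x y : points X) (p : R).

Lemma string_rev p x y l : string_length p x y l -> string_length p y x l.
Proof.
move: x y l; apply: string_points_ind => [x|c x y z l cx cy _ s]; first exact: string_nil.
by rewrite cell_distC addrC; apply: string_cat s _; exact: string_one.
Qed.

Lemma lp_distC p x y : lp_dist X p x y = lp_dist X p y x.
Proof.
by rewrite /lp_dist; congr (inf _); apply/seteqP; split=> l /= /string_rev.
Qed.

End LpDistSym.

Section Path.
Context {R : realType} {X : cube_complex R}.
Hypothesis X_CAT0 : CAT0_cube_complex X.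
Variables (p : R) (k : nat) (b : nat -> points X) (gamma : R -> points X).
Variables (C : nat -> cell X) (tau : nat -> R) (speed : R).
Hypotheses (p1 : 1 < p) (tau0 : tau 0%N = 0) (tau1 : tau k.+1 = 1).
Hypothesis affine : forall i, (i <= k)%N ->
  [/\ tau i < tau i.+1, b i <> b i.+1 &
    exists c,
      [/\ carrier c (b i), carrier c (b i.+1),
        lp_norm p [set: 'I_(cell_dim c)] (coords c (b i.+1) - coords c (b i)) =
          speed * (tau i.+1 - tau i) &
        forall s : R, 0 <= s <= 1 ->
          gamma ((1 - s) * tau i + s * tau i.+1) =
          chart c ((1 - s) *: coords c (b i) + s *: coords c (b i.+1))]].
Hypothesis minC : forall i, (i <= k)%N -> minimal_cube (C i) (b i) (b i.+1).

Let p0 : 0 < p. Proof. exact: lt_trans ltr01 p1. Qed.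

Let tau_lt i : (i <= k)%N -> tau i < tau i.+1. Proof. by case/affine. Qed.
Let neq i : (i <= k)%N -> b i <> b i.+1. Proof. by case/affine. Qed.
Let C0 i : (i <= k)%N -> carrier (C i) (b i). Proof. by case/minC. Qed.
Let C1 i : (i <= k)%N -> carrier (C i) (b i.+1). Proof. by case/minC. Qed.

Lemma seg_len i : (i <= k)%N ->
  cell_dist p (C i) (b i) (b i.+1) = speed * (tau i.+1 - tau i).
Proof.
move=> ik; have [_ _ [c [c0 c1 <- _]]] := affine ik.
rewrite lp_norm_coords cell_distC; apply: cell_dist_meet => //; [by rewrite gt_eqF|exact: C1|exact: C0].
Qed.

Lemma seg_len_gt0 i : (i <= k)%N -> 0 < cell_dist p (C i) (b i) (b i.+1).
Proof.
move=> ik; rewrite lt_neqAle cell_dist_ge0 andbT eq_sym; apply/eqP.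
by move=> /(cell_dist_eq0 p0 (C0 ik) (C1 ik)); exact: neq.
Qed.

Lemma speed_gt0 : 0 < speed.
Proof.
by have := seg_len_gt0 (leq0n k); rewrite seg_len// pmulr_lgt0// subr_gt0 tau_lt.
Qed.

(** The path is described in some cell containing the segment; affine segments agree in all cells
    that contain their ends, so [C i] may be used. *)
Lemma seg_gamma i s : (i <= k)%N -> tau i <= s <= tau i.+1 ->
  gamma s = cell_seg (C i) (b i) (b i.+1) ((s - tau i) / (tau i.+1 - tau i)).
Proof.
move=> ik /andP[s0 s1]; have [_ _ [c [c0 c1 _ g]]] := affine ik.
have d0 : 0 < tau i.+1 - tau i by rewrite subr_gt0 tau_lt.
set u := (s - tau i) / _.
have u01 : 0 <= u <= 1.
  by rewrite divr_ge0 ?ler_pdivrMr ?mul1r ?lerD2r ?subr_ge0// ltW// tau_lt.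
have -> : s = (1 - u) * tau i + u * tau i.+1.
  have e : u * (tau i.+1 - tau i) = s - tau i by rewrite divfK// gt_eqF.
  by lra.
by rewrite g//; apply: conv_meet => //; [exact: C0|exact: C1].
Qed.

Lemma seg_isometry i s t : (i <= k)%N -> tau i <= s <= tau i.+1 -> tau i <= t <= tau i.+1 ->
  lp_dist X p (gamma s) (gamma t) = speed * `|s - t|.
Proof.
move=> ik si ti; rewrite (seg_gamma ik si) (seg_gamma ik ti).
have d0 : 0 < tau i.+1 - tau i by rewrite subr_gt0 tau_lt.
have u01 u : tau i <= u <= tau i.+1 -> 0 <= (u - tau i) / (tau i.+1 - tau i) <= 1.
  by case/andP=> ? ?; rewrite divr_ge0 ?ler_pdivrMr ?mul1r ?lerD2r ?subr_ge0// ltW// tau_lt.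
have c0 := C0 ik; have c1 := C1 ik.
rewrite (cell_isometric X_CAT0 p1 (carrier_seg c0 c1 (u01 _ si)) (carrier_seg c0 c1 (u01 _ ti))).
rewrite cell_dist_seg ?u01// seg_len// -mulrBl opprB addrA subrK normrM.
rewrite [`|_^-1|]ger0_norm ?invr_ge0 ?(ltW d0)//.
by field; rewrite gt_eqF.
Qed.

Lemma tau_le i j : (i <= j <= k.+1)%N -> tau i <= tau j.
Proof.
case/andP; elim: j => [|j IH]; first by rewrite leqn0 => /eqP ->.
rewrite leq_eqVlt => /orP[/eqP ->//|ij jk].
exact: le_trans (IH ij (ltnW jk)) (ltW (tau_lt jk)).
Qed.

Lemma tau01 i : (i <= k.+1)%N -> 0 <= tau i <= 1.
Proof. by move=> ik; rewrite -{1}tau0 -tau1 !tau_le ?ik//=. Qed.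

Lemma tau_locate t : 0 <= t <= 1 -> exists2 i, (i <= k)%N & tau i <= t <= tau i.+1.
Proof.
case/andP=> t0; rewrite -tau1; move: (leqnn k); move: {1 3}k => n.
elim: n => [|n IH] nk tn; first by exists 0%N; rewrite ?tau0 ?t0.
have [|nt] := leP t (tau n.+1); first by apply: IH; exact: ltnW.
by exists n.+1; rewrite ?(ltW nt).
Qed.

Section Break.
Variables (i : nat) (v : points X).
Hypotheses (ik : (i < k)%N) (v0 : is_vertex (C i) v) (v1 : is_vertex (C i.+1) v).

Let ik' : (i <= k)%N. Proof. exact: ltnW. Qed.
Let r1 := cell_dist p (C i) (b i) (b i.+1).
Let r2 := cell_dist p (C i.+1) (b i.+2) (b i.+1).
Let r1E : r1 = speed * (tau i.+1 - tau i). Proof. exact: seg_len. Qed.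
Let r2E : r2 = speed * (tau i.+2 - tau i.+1). Proof. by rewrite /r2 cell_distC seg_len. Qed.
Let sp := speed_gt0.

Lemma gamma_left r : 0 <= r <= r1 ->
  gamma (tau i.+1 - r / speed) = cell_seg (C i) (b i.+1) (b i) (r / r1).
Proof.
rewrite r1E => /andP[r0 rr]; have d0 : 0 < tau i.+1 - tau i by rewrite subr_gt0 tau_lt.
have q0 : 0 <= r / speed by rewrite divr_ge0// ltW.
have q1 : r / speed <= tau i.+1 - tau i by rewrite ler_pdivrMr// mulrC.
rewrite (@seg_gamma i)//; last by lra.
rewrite -(cell_seg_rev (C i) (b i)); congr cell_seg.
by field; rewrite !gt_eqF// mulr_gt0.
Qed.

Lemma gamma_right r : 0 <= r <= r2 ->
  gamma (tau i.+1 + r / speed) = cell_seg (C i.+1) (b i.+1) (b i.+2) (r / r2).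
Proof.
rewrite r2E => /andP[r0 rr]; have d0 : 0 < tau i.+2 - tau i.+1 by rewrite subr_gt0 tau_lt.
have q0 : 0 <= r / speed by rewrite divr_ge0// ltW.
have q1 : r / speed <= tau i.+2 - tau i.+1 by rewrite ler_pdivrMr// mulrC.
rewrite (@seg_gamma i.+1)//; last by lra.
congr cell_seg; by field; rewrite !gt_eqF// mulr_gt0.
Qed.

(** On [t - u, t + u] the path is a geodesic with two arms of length speed u, as
    [straight_conditions] requires. *)
Lemma break_conditions : local_geodesic (lp_dist X p) gamma ->
  zero_tension p (C i) (C i.+1) (b i) (b i.+1) (b i.+2) /\
  no_shortcut p (C i) (C i.+1) v (b i) (b i.+1) (b i.+2).
Proof.
move=> [a geo]; set t := tau i.+1.
have lt0 : tau i < t by exact: tau_lt.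
have lt1 : t < tau i.+2 by exact: tau_lt.
have /andP[t0 _] : 0 <= tau i <= 1 by apply: tau01; rewrite ltnW// ltnS.
have /andP[_ t1] : 0 <= tau i.+2 <= 1 by exact: tau01.
have t01 : 0 <= t <= 1 by lra.
have [e e0 ge] := geo t t01.
pose u := Num.min (e / 2) (Num.min (t - tau i) (tau i.+2 - t)).
have e2 : 0 < e / 2 by rewrite divr_gt0.
have u0 : 0 < u by rewrite !lt_min e2 !subr_gt0 lt0.
have : u <= u by []; rewrite {2}/u !le_min => /and3P[ue ul ur].
have near s : `|s - t| <= u -> `|s - t| < e by move=> h; apply: le_lt_trans h _; lra.
have nt : `|t - t| < e by rewrite subrr normr0.
have nr : `|t + u - t| < e by apply: near; rewrite addrC addKr ger0_norm// ltW.
have nl : `|t - u - t| < e by apply: near; rewrite addrAC subrr sub0r normrN ger0_norm// ltW.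
(* The speed in [local_geodesic] is a priori any number; a short piece of one segment identifies
   it. *)
have aE : a = speed.
  have r01 : 0 <= t + u <= 1 by lra.
  have iso : lp_dist X p (gamma t) (gamma (t + u)) = speed * `|t - (t + u)|.
    by apply: (@seg_isometry i.+1) => //; rewrite -/t; lra.
  have := ge t (t + u) t01 r01 nt nr; rewrite iso opprD addrA subrr sub0r normrN gtr0_norm//.
  by move=> /(mulIf (lt0r_neq0 u0)).
have far : lp_dist X p (gamma (t - u)) (gamma (t + u)) = 2 * (speed * u).
  have l01 : 0 <= t - u <= 1 by lra.
  have r01 : 0 <= t + u <= 1 by lra.
  rewrite (ge _ _ l01 r01 nl nr) aE (_ : t - u - (t + u) = - (2 * u)); last by ring.
  by rewrite normrN gtr0_norm ?mulr_gt0//; ring.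
have su : 0 < speed * u by rewrite mulr_gt0.
have s1 : speed * u <= r1 by rewrite r1E ler_pM2l.
have s2 : speed * u <= r2 by rewrite r2E ler_pM2l.
have nn : (i.+1 <= k)%N by [].
apply: (straight_conditions X_CAT0 p1 v0 v1 (C0 ik') (C1 ik') (C0 nn) (C1 nn) (neq ik')
  (fun e => neq nn (esym e)) su s1 s2).
rewrite -gamma_left ?(ltW su)// -gamma_right ?(ltW su)// mulrAC divff ?gt_eqF// mul1r.
by rewrite far.
Qed.

(** The radius e / speed keeps s and s' in the two adjacent segments. Points on the same side are
    handled by the isometry of cells, points on different sides by [conditions_straight]. *)
Lemma break_local_geodesic :
  zero_tension p (C i) (C i.+1) (b i) (b i.+1) (b i.+2) ->
  no_shortcut p (C i) (C i.+1) v (b i) (b i.+1) (b i.+2) ->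
  exists2 e, 0 < e & forall s s', `|s - tau i.+1| < e -> `|s' - tau i.+1| < e ->
    lp_dist X p (gamma s) (gamma s') = speed * `|s - s'|.
Proof.
move=> zt ns; have nn : (i.+1 <= k)%N by [].
have [e e0 [e1 e2 H]] := conditions_straight X_CAT0 p1 v0 v1 (C0 ik') (C1 ik') (C0 nn) (C1 nn)
  (neq ik') (fun e => neq nn (esym e)) (minC ik') zt ns.
have e1' : e <= speed * (tau i.+1 - tau i) by rewrite -r1E.
have e2' : e <= speed * (tau i.+2 - tau i.+1) by rewrite -r2E.
set t := tau i.+1; exists (e / speed); first by rewrite divr_gt0.
have near u : `|u - t| < e / speed -> - e < speed * (u - t) < e.
  by rewrite ltr_pdivlMr// -[X in _ * X](gtr0_norm sp) -normrM mulrC ltr_norml.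
have left u : u <= t -> - e < speed * (u - t) < e -> tau i <= u <= t.
  move=> ut /andP[ul _]; rewrite ut andbT -(lerD2r (- t)) -(ler_pM2l sp) -/t.
  by apply: le_trans (ltW ul); rewrite -opprB mulrN lerN2.
have right u : t <= u -> - e < speed * (u - t) < e -> t <= u <= tau i.+2.
  move=> ut /andP[_ ur]; rewrite ut -(lerD2r (- t)) -(ler_pM2l sp).
  exact: le_trans (ltW ur) e2'.
have mixed s s' : s <= t -> t <= s' -> - e < speed * (s - t) < e ->
    - e < speed * (s' - t) < e -> lp_dist X p (gamma s) (gamma s') = speed * `|s - s'|.
  move=> st ts' /andP[sl _] /andP[_ sr].
  have a0 : 0 <= speed * (t - s) <= e.
    rewrite mulr_ge0 ?subr_ge0 ?(ltW sp)//= -opprB mulrN lerNl; exact: ltW.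
  have b0 : 0 <= speed * (s' - t) <= e by rewrite mulr_ge0 ?subr_ge0 ?(ltW sp)//= ltW.
  have := H _ _ a0 b0.
  rewrite -gamma_left; last by case/andP: a0 => -> /le_trans; apply.
  rewrite -gamma_right; last by case/andP: b0 => -> /le_trans; apply.
  rewrite ![speed * _ / _]mulrAC !divff ?gt_eqF// !mul1r -/t.
  rewrite (_ : t - (t - s) = s); last by ring.
  rewrite (_ : t + (s' - t) = s'); last by ring.
  move=> ->; rewrite -mulrDr ler0_norm ?subr_le0 ?(le_trans st)//.
  by congr (_ * _); ring.
move=> s s' /near es /near es'.
have [st|ts] := leP s t; have [s't|ts'] := leP s' t.
- by apply: (@seg_isometry i) => //; exact: left.
- exact: mixed (ltW ts') es es'.
- by rewrite lp_distC distrC; exact: mixed (ltW ts) es' es.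
- by apply: (@seg_isometry i.+1) => //; apply: right => //; exact: ltW.
Qed.

End Break.

Lemma segment_local_geodesic i t e : (i <= k)%N -> 0 < e ->
  (forall s, 0 <= s <= 1 -> `|s - t| < e -> tau i <= s <= tau i.+1) ->
  exists2 e, 0 < e & forall s s' : R, 0 <= s <= 1 -> 0 <= s' <= 1 ->
    `|s - t| < e -> `|s' - t| < e -> lp_dist X p (gamma s) (gamma s') = speed * `|s - s'|.
Proof.
move=> ik e0 H; exists e => // s s' s01 s'01 st s't.
by apply: (@seg_isometry i) => //; exact: H.
Qed.

Lemma path_local_geodesic :
  (forall i, (i < k)%N -> exists2 e, 0 < e & forall s s',
     `|s - tau i.+1| < e -> `|s' - tau i.+1| < e ->
     lp_dist X p (gamma s) (gamma s') = speed * `|s - s'|) ->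
  local_geodesic (lp_dist X p) gamma.
Proof.
move=> brk; exists speed => t t01.
have brk' i : (i < k)%N -> t = tau i.+1 -> exists2 e, 0 < e & forall s s' : R,
    0 <= s <= 1 -> 0 <= s' <= 1 -> `|s - t| < e -> `|s' - t| < e ->
    lp_dist X p (gamma s) (gamma s') = speed * `|s - s'|.
  by move=> ik ->; have [e e0 H] := brk i ik; exists e => // s s' _ _; exact: H.
have [i ik /andP[]] := tau_locate t01; have ti := tau_lt ik.
rewrite le_eqVlt => /orP[/eqP te|lt0] lt1.
  (* A left end tau i is a break point unless i = 0; there the constraint 0 <= s leaves the first
     segment alone. *)
  case: i ik te {lt1} ti => [|i] ik te ti; last by exact: (brk' i).
  apply: (@segment_local_geodesic 0%N t (tau 1%N - t)) => //; first by rewrite -te subr_gt0.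
  move=> s /andP[s0 _]; rewrite ltr_distl tau0 s0/= => /andP[_ s1]; lra.
move: lt1; rewrite le_eqVlt => /orP[/eqP te|lt1].
  move: ik; rewrite leq_eqVlt => /orP[/eqP ik|ik]; last exact: (brk' i).
  apply: (@segment_local_geodesic i t (t - tau i)); rewrite ?ik ?subr_gt0 -?ik//.
  by move=> s /andP[_ s1]; rewrite ltr_distl ik tau1 s1 andbT => /andP[s0 _]; lra.
apply: (@segment_local_geodesic i t (Num.min (t - tau i) (tau i.+1 - t))) => //.
  by rewrite lt_min !subr_gt0 lt0.
move=> s _; rewrite lt_min !ltr_distl => /andP[/andP[s0 _] /andP[_ s1]]; lra.
Qed.

End Path.

Theorem theoremF (R : realType) (X : cube_complex R) (p : R) (k : nat)
    (x y : points X) (b : nat -> points X) (gamma : R -> points X)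
    (C : nat -> cell X) (v : nat -> points X)
    (X_CAT0 : CAT0_cube_complex X) (p_gt1 : 1 < p)
    (gamma_affine : piecewise_affine_path p k x y b gamma)
    (C_minimal : forall i, (i <= k)%N -> minimal_cube (C i) (b i) (b i.+1))
    (v_vertex : forall i, (0 < i <= k)%N ->
       vertex_of (C i.-1) (v i) /\ vertex_of (C i) (v i)) :
  local_geodesic (lp_dist X p) gamma <->
  (forall i, (0 < i <= k)%N ->
     zero_tension p (C i.-1) (C i) (b i.-1) (b i) (b i.+1) /\
     no_shortcut p (C i.-1) (C i) (v i) (b i.-1) (b i) (b i.+1)).
Proof.
have [_ _ [tau [speed [tau0 tau1 affine]]]] := gamma_affine.
split=> [geo [//|i] ik|H].
  have [/vertex_of_is_vertex v0 /vertex_of_is_vertex v1] := v_vertex i.+1 ik.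
  exact: (break_conditions X_CAT0 p_gt1 tau0 tau1 affine C_minimal ik v0 v1 geo).
apply: (path_local_geodesic X_CAT0 p_gt1 tau0 tau1 affine C_minimal) => i ik.
have [/vertex_of_is_vertex v0 /vertex_of_is_vertex v1] := v_vertex i.+1 ik.
have [zt ns] := H i.+1 ik.
exact: (break_local_geodesic X_CAT0 p_gt1 affine C_minimal ik v0 v1 zt ns).
Qed.
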